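(* Let $(\Gamma,\mu)$ be a transient random walk on a finitely generated group $\Gamma$ satisfying the moment condition $\sum_{g\in\Gamma}\mu(g)C^{d(g,e)}<\infty$, where $d$ and $C$ are the word metric and the Harnack constant described in the context. Let $\alpha^{D^\mu}$ be the associated flow on $C(\partial_M\Gamma)\rtimes_r\Gamma$. If $\partial_M\Gamma$ contains a spine, then the KMS spectrum of $\alpha^{D^\mu}$ is $\mathbb R$. If $\partial_M\Gamma$ does not contain a spine, then the KMS spectrum of $\alpha^{D^\mu}$ is either $\{0,1\}$ or $\{1\}$.
   Context: A random walk $(\Gamma,\mu)$ consists of a countable discrete group $\Gamma$ with neutral element $e$ and a function $\mu:\Gamma\to[0,1]$ with $\sum_{g}\mu(g)=1$ whose support $\{g:\mu(g)>0\}$ generates $\Gamma$ as a semigroup. Put $\mu_{x,y}=\mu(x^{-1}y)$, and let $\mu^n_{x,y}$ be the entries of the $n$-th power of this matrix ($\mu^0$ is the identity matrix). The walk is transient when $G(x,y)=\sum_{n\ge0}\mu^n_{x,y}<\infty$ for all $x,y\in\Gamma$; then $G>0$. The Martin kernel is $K(g,h)=G(g,h)/G(e,h)$. The Martin compactification is the compact metrizable space containing $\Gamma$ as a dense, open, discrete subset such that every function $h\mapsto K(g,h)$, $g\in\Gamma$, extends continuously to it and such that the extensions separate the points of the complement $\partial_M\Gamma$ of $\Gamma$, which is called the Martin boundary. The extended kernel is also denoted $K:\Gamma\times\partial_M\Gamma\to(0,\infty)$. Left translation of $\Gamma$ on itself extends to an action of $\Gamma$ by homeomorphisms of the compactification,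 hence of $\partial_M\Gamma$, written $\xi\mapsto g\xi$, and $K(x,g\xi)K(g^{-1},\xi)=K(g^{-1}x,\xi)$. A spine is a point $\xi\in\partial_M\Gamma$ with $K(g,\xi)=1$ for all $g\in\Gamma$. Moment condition: $d$ is the word metric on $\Gamma$ coming from a finite symmetric set generating $\Gamma$ as a semigroup, and $C>0$ is a constant such that the Harnack inequality $G(x,z)/G(y,z)\le C^{d(x,y)}$ holds for all $x,y,z\in\Gamma$. In the reduced crossed product $C(\partial_M\Gamma)\rtimes_r\Gamma$, $\{U_g\}_{g\in\Gamma}$ denotes the canonical unitaries, so $(U_gfU_g^* )(\xi)=f(g^{-1}\xi)$. The flow $\alpha^{D^\mu}$ is the continuous one-parameter group of automorphisms with $\alpha^{D^\mu}_t(fU_g)=fU_gK(g^{-1},\cdot)^{-it}$ for $f\in C(\partial_M\Gamma)$, $g\in\Gamma$, $t\in\mathbb R$. For $\beta\in\mathbb R$, a state $\omega$ is a $\beta$-KMS state for a flow $\alpha$ when $\omega(ab)=\omega(b\,\alpha_{i\beta}(a))$ for all $\alpha$-analytic elements $a,b$. The KMS spectrum of $\alpha$ is the set of $\beta\in\mathbb R$ for which a $\beta$-KMS state for $\alpha$ exists. *)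

(* Defs.v *)
From HB Require Import structures.
From mathcomp Require Import all_boot all_order all_algebra.
From mathcomp Require Import complex.
From mathcomp Require Import all_classical all_reals all_analysis.
From mathcomp Require Import ring lra.
Set Implicit Arguments.
Unset Strict Implicit.
Unset Printing Implicit Defensive.
Import Order.TTheory GRing.Theory Num.Theory.
Import numFieldNormedType.Exports.
Local Open Scope classical_set_scope.
Local Open Scope ring_scope.
Local Open Scope complex_scope.

(** * Random walks on groups *)

Section Walk.
Context {R : realType} {G : groupType}.
Local Open Scope group_scope.

Definition word_for (A : set G) (s : seq G) (g : G) : Prop :=
  (forall x, x \in s -> A x) /\ foldr (fun x y => x * y) 1 s = g.

(* Semigroup products are nonempty. *)
Definition semigroup_generates (A : set G) : Prop :=
  forall g, exists2 s, s <> [::] & word_for A s g.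

Definition word_metric (S : seq G) (d : G -> G -> nat) : Prop :=
  forall x y,
    (exists2 s, word_for [set` S] s (x^-1 * y) & size s = d x y) /\
    (forall s, word_for [set` S] s (x^-1 * y) -> (d x y <= size s)%N).

Record random_walk (mu : G -> R) : Prop := RandomWalk {
  walk_countable : countable [set: G];
  walk_ge0 : forall g, (0 <= mu g)%R;
  walk_le1 : forall g, (mu g <= 1)%R;
  walk_sum1 : (\esum_(g in [set: G]) (mu g)%:E = 1)%E;
  walk_generates : semigroup_generates [set g | (0 < mu g)%R] }.

Variable mu : G -> R.

Fixpoint transition (n : nat) (x y : G) : \bar R :=
  if n is m.+1 then
    (\esum_(z in [set: G]) (transition m x z * (mu (z^-1 * y))%:E))%E
  else ((x == y)%:R)%:E.

Definition egreen (x y : G) : \bar R :=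
  (\esum_(n in [set: nat]) transition n x y)%E.

Definition transient : Prop := forall x y, (egreen x y < +oo)%E.

Definition green (x y : G) : R := fine (egreen x y).

Definition martin_kernel (g h : G) : R := (green g h / green 1 h)%R.

(** * The Martin compactification *)

(* The complement of the range of [memb] is the Martin boundary.  The
   conditions determine the space up to a unique homeomorphism extending
   the identity of [G], and [mkernel] and [mact] are then determined by
   continuity and density. *)
Record martin_compactification := MartinCompactification {
  mspace :> metricType R;
  memb : G -> mspace;
  mkernel : G -> mspace -> R;
  mact : G -> mspace -> mspace;
  mspace_compact : compact [set: mspace];
  memb_inj : injective memb;
  memb_open : forall g, open [set memb g];
  memb_dense : dense (range memb);
  mkernel_continuous : forall g, continuous (mkernel g);
  mkernel_memb : forall g h, mkernel g (memb h) = martin_kernel g h;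
  mkernel_separates : forall xi eta,
    ~ range memb xi -> ~ range memb eta ->
    (forall g, mkernel g xi = mkernel g eta) -> xi = eta;
  mact_continuous : forall g, continuous (mact g);
  mact_memb : forall g h, mact g (memb h) = memb (g * h);
  mact1 : forall xi, mact 1 xi = xi;
  mactM : forall g h xi, mact (g * h) xi = mact g (mact h xi) }.

Variable M : martin_compactification.

Definition martin_boundary : set M := ~` range (@memb M).

Lemma mact_boundary g (xi : martin_boundary) :
  mact g (set_val xi) \in martin_boundary.
Proof.
apply/mem_set => -[h _ hE].
have : martin_boundary (set_val xi) by apply: set_mem; exact: valP.
apply; exists (g^-1 * h) => //.
by rewrite -mact_memb hE -mactM mulVg mact1.
Qed.

Definition bact (g : G) (xi : martin_boundary) : martin_boundary :=
  exist _ (mact g (set_val xi)) (mact_boundary g xi).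

Definition bkernel (g : G) (xi : martin_boundary) : R :=
  mkernel g (set_val xi).

Definition spine (xi : martin_boundary) : Prop := forall g, bkernel g xi = 1%R.

End Walk.

Arguments martin_compactification {R G} mu.
Arguments martin_boundary {R G mu} M.

(** * The Hilbert space of square summable families *)

Section Ell2.
Context {R : realType} {I : choiceType}.
Implicit Types v w : I -> R[i].

Definition sqmod (z : R[i]) : R := complex.Re z ^+ 2 + complex.Im z ^+ 2.

Definition sqnorm v : \bar R := (\esum_(i in [set: I]) (sqmod (v i))%:E)%E.

Definition sqsummable : {pred I -> R[i]} := fun v => (sqnorm v < +oo)%E.

Let sqmod_ge0 z : 0 <= sqmod z.
Proof. by rewrite addr_ge0 ?sqr_ge0. Qed.

Fact sqsummable_submod : submod_closed sqsummable.
Proof.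
split.
  rewrite /in_mem /= /sqsummable /sqnorm esum1 ?ltry// => i _.
  by rewrite /sqmod !expr0n/= addr0.
move=> a v w; rewrite /in_mem /= /sqsummable => hv hw.
have le1 (x y : R[i]) : sqmod (a * x + y) <= 2 * sqmod a * sqmod x + 2 * sqmod y.
  case: a x y => a1 a2 [v1 v2] [w1 w2]; rewrite /sqmod /= -subr_ge0.
  set x := a1 * v1 - a2 * v2; set y := a1 * v2 + a2 * v1.
  suff -> : 2 * (a1 ^+ 2 + a2 ^+ 2) * (v1 ^+ 2 + v2 ^+ 2)
    + 2 * (w1 ^+ 2 + w2 ^+ 2) - ((x + w1) ^+ 2 + (y + w2) ^+ 2)
    = (x - w1) ^+ 2 + (y - w2) ^+ 2 by rewrite addr_ge0 ?sqr_ge0.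
  by rewrite /x /y; ring.
have c0 : (0 <= (2 * sqmod a)%:E)%E by rewrite lee_fin mulr_ge0.
have d0 : (0 <= 2%:E :> \bar R)%E by rewrite lee_fin.
have s0 u : (0 <= sqnorm u)%E by apply: esum_ge0 => i _; rewrite lee_fin.
apply: (@le_lt_trans _ _
  ((2 * sqmod a)%:E * sqnorm v + 2%:E * sqnorm w)%E); last first.
  by rewrite lte_add_pinfty// lte_mul_pinfty// ?fin_numE.
apply: ge_ereal_sup => _ [A [finA _] <-].
apply: (@le_trans _ _ (\sum_(i \in A)
  ((2 * sqmod a)%:E * (sqmod (v i))%:E + 2%:E * (sqmod (w i))%:E))%E).
  apply: lee_fsum => // i _; rewrite -!EFinM -EFinD lee_fin; exact: le1.
rewrite fsbig_split//= -!ge0_mule_fsumr; first last.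
- by move=> i; rewrite lee_fin.
- by move=> i; rewrite lee_fin.
apply: leeD; apply: lee_wpmul2l => //; apply: ereal_sup_ubound; by exists A.
Qed.

HB.instance Definition _ := GRing.isSubmodClosed.Build _ _ sqsummable
  sqsummable_submod.

Record ell2 := Ell2 { ell2_fun :> I -> R[i]; _ : ell2_fun \in sqsummable }.

HB.instance Definition _ := [isSub for ell2_fun].
HB.instance Definition _ := [Choice of ell2 by <:].
HB.instance Definition _ := [SubChoice_isSubLmodule of ell2 by <:].

Fact sqsummable_mul (c : R) (k v : I -> R[i]) :
  (forall i, sqmod (k i) <= c) -> v \in sqsummable ->
  (fun i => k i * v i) \in sqsummable.
Proof.
rewrite /in_mem /= /sqsummable => kc hv.
have [i0|noI] := pselect (exists i : I, True); last first.
  by rewrite /sqnorm esum1 ?ltry// => i _; exfalso; apply: noI; exists i.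
have c0 : 0 <= c by case: i0 => i _; exact: le_trans (sqmod_ge0 _) (kc i).
apply: (@le_lt_trans _ _ (c%:E * sqnorm v)%E); last first.
  by rewrite lte_mul_pinfty// ?lee_fin// ?fin_numE.
apply: ge_ereal_sup => _ [A [finA _] <-].
apply: (@le_trans _ _ (\sum_(i \in A) (c%:E * (sqmod (v i))%:E))%E).
  apply: lee_fsum => // i _; rewrite -EFinM lee_fin.
  apply: (@le_trans _ _ (sqmod (k i) * sqmod (v i))).
    by case: (k i) (v i) => a b [x y]; rewrite /sqmod /= le_eqVlt; apply/orP; left;
      apply/eqP; ring.
  by rewrite ler_wpM2r.
rewrite -ge0_mule_fsumr; last by move=> i; rewrite lee_fin.
apply: lee_wpmul2l; first by rewrite lee_fin.
by apply: ereal_sup_ubound; exists A.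
Qed.

Definition ell2_norm (v : ell2) : R := Num.sqrt (fine (sqnorm v)).

(* The sum of an absolutely summable family. *)
Definition rsum (f : I -> R) : R :=
  fine (\esum_(i in [set: I]) (Num.max (f i) 0)%:E)%E -
  fine (\esum_(i in [set: I]) (Num.max (- f i) 0)%:E)%E.

Definition csum (f : I -> R[i]) : R[i] :=
  rsum (fun i => complex.Re (f i)) +i* rsum (fun i => complex.Im (f i)).

Definition ell2_dot (v w : ell2) : R[i] := csum (fun i => v i * (w i)^*).

End Ell2.
Arguments ell2 : clear implicits.

(** * Bounded operators on a Hilbert space of families *)

Section Operators.
Context {R : realType} {I : choiceType}.
Notation op := (ell2 R I -> ell2 R I).

Definition opnorm_le (T : op) (c : R) : Prop :=
  forall v, ell2_norm (T v) <= c * ell2_norm v.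

Definition is_adjoint (T T' : op) : Prop :=
  forall v w, ell2_dot (T v) w = ell2_dot v (T' w).

Definition op_closure (B : set op) : set op :=
  [set T | forall e, 0 < e -> exists2 S, B S & opnorm_le (T - S) e].

(* In the rest of this section [A] is a unital C*-algebra of operators:
   a norm closed *-algebra of bounded operators containing the identity. *)
Variable A : set op.

Record star_endomorphism (phi : op -> op) : Prop := StarEndomorphism {
  star_endo_mem : forall a, A a -> A (phi a);
  star_endo_linear : forall (c : R[i]) a b, A a -> A b ->
    phi (c *: a + b) = c *: phi a + phi b;
  star_endo_mul : forall a b, A a -> A b -> phi (a \o b) = phi a \o phi b;
  star_endo_adjoint : forall a a', A a -> A a' ->
    is_adjoint a a' -> is_adjoint (phi a) (phi a') }.

(* Each [alpha t] is an automorphism of [A], with inverse [alpha (- t)]. *)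
Record flow (alpha : R -> op -> op) : Prop := Flow {
  flow_star : forall t, star_endomorphism (alpha t);
  flow0 : forall a, A a -> alpha 0 a = a;
  flowD : forall s t a, A a -> alpha (s + t) a = alpha s (alpha t a);
  flow_continuous : forall a, A a -> forall s e, 0 < e ->
    exists2 r, 0 < r &
      forall t, `|t - s| < r -> opnorm_le (alpha t a - alpha s a) e }.

Record state (omega : op -> R[i]) : Prop := State {
  state_linear : forall (c : R[i]) a b, A a -> A b ->
    omega (c *: a + b) = c * omega a + omega b;
  state_ge0 : forall a a', A a -> A a' -> is_adjoint a a' ->
    0 <= omega (a' \o a);
  state_id : omega id = 1 }.

(* Norm convergent power series around every point of the plane. *)
Definition entire (F : R[i] -> op) : Prop :=
  forall z, exists2 r : R, 0 < r &
    exists2 c : nat -> op, (forall n, A (c n)) &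
      forall w : R[i], `|w - z| < r%:C -> forall e, 0 < e ->
        exists N, forall n, (N <= n)%N ->
          opnorm_le (F w - \sum_(k < n) (w - z) ^+ k *: c k) e.

(* [F z] is the element usually written [alpha_z(a)]. *)
Definition analytic_extension (alpha : R -> op -> op) (a : op)
    (F : R[i] -> op) : Prop :=
  [/\ forall z, A (F z), entire F & forall t : R, F t%:C = alpha t a].

Definition analytic_element (alpha : R -> op -> op) (a : op) : Prop :=
  A a /\ exists F, analytic_extension alpha a F.

Definition KMS_state (alpha : R -> op -> op) (beta : R)
    (omega : op -> R[i]) : Prop :=
  state omega /\
  forall a b F, analytic_element alpha a -> analytic_element alpha b ->
    analytic_extension alpha a F ->
    omega (a \o b) = omega (b \o F (0 +i* beta)).

Definition KMS_spectrum (alpha : R -> op -> op) : set R :=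
  [set beta | exists omega, KMS_state alpha beta omega].

End Operators.

(** * The reduced crossed product of the Martin boundary *)

Section CrossedProduct.
Context {R : realType} {G : groupType} {mu : G -> R}.
Variable M : martin_compactification mu.

Notation X := (martin_boundary M).

(* The regular representation induced from the faithful representation of
   C(X) on ell2(X) by multiplication operators acts on
   ell2(G, ell2(X)) = ell2(G * X). *)
Notation I := (G * X)%type.
Notation op := (ell2 R I -> ell2 R I).

Definition contC (f : X -> R[i]) : Prop := continuous (f : X -> R[i]^o).

(* A family which is not square summable is replaced by 0; by
   [canonical_unitaryE] and [mult_opE] this never happens in
   [canonical_unitary] nor, for continuous [f], in [mult_op]. *)
Definition to_ell2 (v : I -> R[i]) : ell2 R I := insubd 0 v.

Definition mult_op (f : X -> R[i]) : op :=
  fun v => to_ell2 (fun p => f (bact p.1 p.2) * v p).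

Definition canonical_unitary (g : G) : op :=
  fun v => to_ell2 (fun p => v ((g^-1 * p.1)%g, p.2)).

Lemma canonical_unitaryE g v p :
  canonical_unitary g v p = v ((g^-1 * p.1)%g, p.2).
Proof.
rewrite /canonical_unitary /to_ell2 insubdK//.
rewrite /in_mem /= /sqsummable.
have -> : sqnorm (fun p : I => v ((g^-1 * p.1)%g, p.2)) = sqnorm v.
  rewrite /sqnorm [RHS](reindex_esum [set: I] [set: I]
    (fun p => ((g^-1 * p.1)%g, p.2)))//.
  split => // [[a x] [b y] _ _ /= [/mulgI -> ->]//|[a x] _].
  by exists ((g * a)%g, x) => //=; rewrite mulKg.
by case: v.
Qed.

Lemma martin_boundary_compact : compact X.
Proof.
apply: (subclosed_compact _ (@mspace_compact _ _ _ M)) => //.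
apply: open_closedC.
have -> : range (@memb _ _ _ M) = \bigcup_g [set memb M g].
  by apply/seteqP; split => [x [g _ <-]|x [g _ ->]]; exists g.
by apply: bigcup_open => g _; exact: memb_open.
Qed.

Lemma contC_bounded f : contC f -> exists c, forall xi, sqmod (f xi) <= c.
Proof.
move=> fc; apply: contrapT => nb.
have hB (n : nat) : exists xi, n%:R < sqmod (f xi).
  apply: contrapT => nBn; apply: nb; exists n%:R => xi.
  by rewrite leNgt; apply/negP => lt; apply: nBn; exists xi.
pose F : set_system M := filter_from [set: nat]
  (fun n => set_val @` [set xi : X | n%:R < sqmod (f xi)]).
have FF : ProperFilter F.
  apply: filter_from_proper; last first.
    by move=> n _; have [xi ?] := hB n; exists (set_val xi), xi.
  apply: filter_from_filter; first by exists 0%N.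
  move=> m n _ _; exists (maxn m n) => // _ [xi /= lt <-].
  by split; exists xi => //=; apply: le_lt_trans lt; rewrite ler_nat ?leq_maxl ?leq_maxr.
have FX : F X by exists 0%N => // _ [xi _ <-]; apply: set_mem; exact: valP.
have [p [Xp Fp]] := martin_boundary_compact FF FX.
pose xi : X := exist _ p (mem_set Xp).
have : nbhs xi [set eta | `|f xi - f eta| < 1 :> R[i]].
  have := fc xi; move/(@cvgrPdist_lt _ _ _ _ _ _ _)/(_ 1 ltr01); exact.
move=> [_ [[W oW <-] /= Wxi sub]].
pose c := 2 * sqmod (f xi) + 2.
have [n cn] : exists n : nat, c < n%:R.
  by exists (Num.truncn c).+1; rewrite truncnS_gt.
have FB : F (set_val @` [set xi : X | n%:R < sqmod (f xi)]) by exists n.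
have nW : nbhs p W by apply: open_nbhs_nbhs; split.
have [q [[eta /= lt etaq] Wq]] := Fp _ _ FB nW.
have := sub eta; rewrite /= etaq => /(_ Wq) d1.
have : sqmod (f xi - f eta) <= 1.
  by rewrite -lecR add_Re2_Im2; apply: exprn_ile1; [exact: normr_ge0|exact: ltW].
move: cn lt; rewrite /c; case: (f xi) (f eta) => a b [x y]; rewrite /sqmod /= => cn lt d2.
have sq0 : 0 <= (2 * a - x) ^+ 2 + (2 * b - y) ^+ 2 by rewrite addr_ge0 ?sqr_ge0.
clear - cn lt d2 sq0.
nra.
Qed.

Lemma mult_opE f v p : contC f -> mult_op f v p = f (bact p.1 p.2) * v p.
Proof.
move=> /contC_bounded[c fc]; rewrite /mult_op /to_ell2 insubdK//.
by apply: (@sqsummable_mul _ _ c (fun p => f (bact p.1 p.2))) => //; case: v.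
Qed.

(* The image of the convolution algebra C_c(G, C(X)). *)
Definition algebraic_crossed_product : set op :=
  [set T | exists s : seq G, exists f : G -> X -> R[i],
    (forall g, contC (f g)) /\
    T = \sum_(g <- s) (mult_op (f g) \o canonical_unitary g)].

Definition reduced_crossed_product : set op :=
  op_closure algebraic_crossed_product.

Definition cis (x : R) : R[i] := cos x +i* sin x.

(* [cis (- (t * ln k))] is the value of k^(-it) for positive [k]. *)
Definition martin_flow (alpha : R -> op -> op) : Prop :=
  flow reduced_crossed_product alpha /\
  forall t f g, contC f ->
    alpha t (mult_op f \o canonical_unitary g) =
    mult_op f \o canonical_unitary g \o
      mult_op (fun xi => cis (- (t * ln (bkernel g^-1%g xi)))).

End CrossedProduct.
Arguments reduced_crossed_product {R G mu} M.
Arguments martin_flow {R G mu} M alpha.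

(* Main.v *)
Require Import Defs.
From HB Require Import structures.
From mathcomp Require Import all_boot all_order all_algebra.
From mathcomp Require Import complex.
From mathcomp Require Import all_classical all_reals all_analysis.
From mathcomp Require Import ring lra.
Set Implicit Arguments.
Unset Strict Implicit.
Unset Printing Implicit Defensive.
Import Order.TTheory GRing.Theory Num.Theory.
Import numFieldNormedType.Exports.
Local Open Scope classical_set_scope.
Local Open Scope ring_scope.

(** A state that is KMS at [beta] restricts to a positive unital functional [nu]
    on C(X), X the Martin boundary, with [nu (K_x ^ beta) = 1] for all [x];
    conversely, composing a functional that [g] transports with density
    [K_g ^ beta] with the matrix coefficients on the diagonal gives a KMS state,
    because the coefficients of [alpha_z(a)] are those of [a] times a power of
    the kernel, by analytic continuation from the real line.

    Exponent 1.  A limit of averages of the functions [h |-> F h * green 1 h]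
    over larger and larger cutoffs measures the total mass of potentials
    [rho G].  Translations preserve that mass, and [K_g] is the ratio of [green g]
    to [green 1], so the limit is conformal on the lattice generated by the
    kernels, and then on C(X) by the lattice form of Stone-Weierstrass.

    Spine.  A spine is fixed by the group and its kernel is 1, so the point
    evaluation is conformal for every exponent.

    Exponents other than 0 and 1.  The function k^beta - 1 - beta (k - 1) has a
    constant sign and vanishes only at k = 1.  Under the moment condition
    [K_(_, xi)] is harmonic uniformly in [xi], so that [nu] annihilates the
    functions obtained from it with k = K_(xg) / K_x, weighted by [K_x ^ beta].
    Without a spine a finite sum of them is bounded below by compactness. *)

(** * Green kernels and potentials *)

(** The flow is prescribed only on the elements f U_g, and its automorphisms are not assumed
    continuous in the algebra variable. Reading off the coefficients of [alpha t a] for a general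
    [a] therefore rests on the contractivity of unital star-endomorphisms, obtained from adjoints
    and a Neumann series inside the norm closure; most of the operator theory below serves this.

    The two directions use functionals of different strength. Excluding an exponent takes only
    positivity and nu(K_x^beta) = 1, which the KMS relation yields for U_g and its inverse. Building
    a state takes the full transport rule on continuous functions.

    Potentials enter because the kernels alone are not closed under minima, whereas the minimum of
    two potentials of finite charge is again one, by the Riesz decomposition. This provides the
    lattice for Stone-Weierstrass, and the mass of the charge is the value of the functional on it.

    The exponents 0 and 1 escape the last argument because k^beta - 1 - beta (k - 1) is then
    identically zero. *)

Section EsumFacts.
Context {R : realType}.
Local Open Scope ereal_scope.

Lemma esum_exchange (T U : choiceType) (a : T -> U -> \bar R) :
  (forall i j, 0 <= a i j) ->
  \esum_(i in [set: T]) \esum_(j in [set: U]) a i j =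
  \esum_(j in [set: U]) \esum_(i in [set: T]) a i j.
Proof.
move=> a0; rewrite !esum_esum//.
rewrite (reindex_esum ([set: U] `*`` fun=> [set: T])
  ([set: T] `*`` fun=> [set: U]) (fun x => (x.2, x.1)))//.
split => //= [[i j] [k l] _ _ [-> ->]//|[i j] _].
by exists (j, i).
Qed.

Lemma esum_single (T : choiceType) (i : T) (f : T -> \bar R) :
  0 <= f i -> (forall j, j != i -> f j = 0) -> \esum_(j in [set: T]) f j = f i.
Proof.
move=> fi0 f0; rewrite -(esum_set1 fi0) [RHS]esum_mkcond.
apply: eq_esum => j _; case: ifPn => //; rewrite notin_setE /= => /eqP.
exact: f0.
Qed.

Lemma esum_ub_term (T : choiceType) (f : T -> \bar R) i :
  (forall j, 0 <= f j) -> f i <= \esum_(j in [set: T]) f j.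
Proof.
move=> f0; apply: esum_ge; exists [set i]; first by split.
by rewrite fsbig_set1.
Qed.

Lemma esumZl (T : choiceType) (c : \bar R) (f : T -> \bar R) :
  0 <= c -> (forall i, 0 <= f i) ->
  \esum_(i in [set: T]) (c * f i) = c * \esum_(i in [set: T]) f i.
Proof.
move=> c0 f0.
have le1 (b : R) (g : T -> \bar R) : (0 <= b)%R -> (forall i, 0 <= g i) ->
    \esum_(i in [set: T]) (b%:E * g i) <= b%:E * \esum_(i in [set: T]) g i.
  move=> b0 g0; apply: ge_ereal_sup => _ [A [finA _] <-].
  rewrite -ge0_mule_fsumr//; apply: lee_wpmul2l; first by rewrite lee_fin.
  by apply: ereal_sup_ubound; exists A.
case: c c0 => [b| |] // b0.
  rewrite lee_fin in b0; apply/eqP; rewrite eq_le le1//=.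
  have [->|bn0] := eqVneq b 0%R.
    by rewrite mul0e esum_ge0// => i _; rewrite mul0e.
  rewrite muleC -lee_pdivlMr ?lt_def ?bn0// muleC.
  rewrite (le_trans _ (le1 _ _ _ _)) ?invr_ge0//; last first.
    by move=> i; rewrite mule_ge0.
  by apply: le_esum => i _; rewrite muleA -EFinM mulVf// mul1e.
have [h|h] := pselect (exists i, 0 < f i).
  have [i fi] := h.
  rewrite [RHS]gt0_mulye; last first.
    exact: lt_le_trans fi (esum_ub_term _ f0).
  apply/eqP; rewrite eq_le leey /=.
  apply: le_trans (esum_ub_term i _).
    by rewrite gt0_mulye.
  by move=> j; apply: mule_ge0.
have fz i : f i = 0.
  apply/eqP; rewrite eq_le f0 andbT leNgt; apply/negP => fi.
  by apply: h; exists i.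
rewrite !esum1 ?mule0// => i _; by rewrite fz mule0.
Qed.

Lemma esumZr (T : choiceType) (c : \bar R) (f : T -> \bar R) :
  0 <= c -> (forall i, 0 <= f i) ->
  \esum_(i in [set: T]) (f i * c) = (\esum_(i in [set: T]) f i) * c.
Proof.
by move=> c0 f0; rewrite muleC -esumZl//; apply: eq_esum => i _; rewrite muleC.
Qed.

Lemma esum_nat_le (f : nat -> \bar R) c : (forall n, 0 <= f n) ->
  (forall N, \sum_(0 <= k < N) f k <= c) -> \esum_(n in [set: nat]) f n <= c.
Proof.
move=> f0 h; rewrite -nneseries_esumT//.
by apply: lime_le; [exact: is_cvg_nneseries|exact: nearW].
Qed.

Lemma esum_nat_ge (f : nat -> \bar R) N : (forall n, 0 <= f n) ->
  \sum_(0 <= k < N) f k <= \esum_(n in [set: nat]) f n.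
Proof. by move=> f0; rewrite -nneseries_esumT//; exact: nneseries_lim_ge. Qed.

Lemma esum_nat_split (f : nat -> \bar R) N : (forall n, 0 <= f n) ->
  \esum_(n in [set: nat]) f n =
  \sum_(0 <= k < N) f k + \esum_(n in [set: nat]) f (N + n)%N.
Proof.
move=> f0; elim: N => [|N ih].
  by rewrite big_geq// add0e; apply: eq_esum.
rewrite big_nat_recr//= ih -addeA; congr (_ + _).
rewrite -(@nneseries_esumT _ (fun n => f (N + n)%N))// nneseries_recl//.
rewrite addn0; congr (_ + _).
rewrite -nneseries_esumT// -(@nneseries_addn _ _ 1%N)//.
by apply: eq_eseriesr => i _; rewrite addSnnS addn1.
Qed.

Lemma esum_fin_approx (T : choiceType) (f : T -> R) (r : R) e :
  (forall i, 0 <= f i)%R -> \esum_(i in [set: T]) (f i)%:E = r%:E ->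
  (0 < e)%R ->
  exists s : seq T, uniq s /\ (r - e < \sum_(i <- s) f i)%R.
Proof.
move=> f0 fr e0.
have : (r - e)%:E < \esum_(i in [set: T]) (f i)%:E.
  by rewrite fr lte_fin ltrBlDr ltrDl.
move=> /ereal_sup_gt[_ [A [finA _] <-] h].
exists (finmap.enum_fset (fset_set A)); split; first exact: finmap.fset_uniq.
by move: h; rewrite fsbig_finite//= sumEFin lte_fin.
Qed.

Lemma esum_seq_le (T : choiceType) (f : T -> \bar R) (s : seq T) :
  (forall i, 0 <= f i) -> uniq s ->
  \sum_(i <- s) f i <= \esum_(i in [set: T]) f i.
Proof.
move=> f0 us; apply: esum_ge; exists [set` s]; first by split.
by rewrite -fsbig_seq.
Qed.

End EsumFacts.

(** * Excessive functions of a nonnegative kernel *)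

Section NonnegativeKernel.
Context {R : realType} {T : choiceType}.
Local Open Scope ereal_scope.
Variable q : T -> T -> R.
Hypothesis q0 : forall x y, (0 <= q x y)%R.

(** The kernel stays abstract because the walk enters twice: as [mu (x^-1 * z)], acting on the first
    variable of the Green function, and transposed, acting on the second. *)
Definition kernel_op (w : T -> \bar R) (x : T) : \bar R :=
  \esum_(z in [set: T]) ((q x z)%:E * w z).

Lemma kernel_op_ge0 w : (forall z, 0 <= w z) -> forall x, 0 <= kernel_op w x.
Proof. by move=> w0 x; apply: esum_ge0 => z _; rewrite mule_ge0// lee_fin. Qed.

Lemma iter_kernel_op_ge0 k w : (forall z, 0 <= w z) ->
  forall x, 0 <= iter k kernel_op w x.
Proof. by move=> w0; elim: k => //= k ih; exact: kernel_op_ge0. Qed.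

Lemma le_kernel_op v w :
  (forall z, v z <= w z) -> forall x, kernel_op v x <= kernel_op w x.
Proof.
by move=> vw x; apply: le_esum => z _; apply: lee_wpmul2l => //; rewrite lee_fin.
Qed.

Lemma le_iter_kernel_op k v w :
  (forall z, v z <= w z) -> forall x, iter k kernel_op v x <= iter k kernel_op w x.
Proof. by move=> vw; elim: k => //= k ih; exact: le_kernel_op. Qed.

Lemma kernel_opD v w : (forall z, 0 <= v z) -> (forall z, 0 <= w z) ->
  kernel_op (fun z => v z + w z) = fun x => kernel_op v x + kernel_op w x.
Proof.
move=> v0 w0; apply/funext => x.
rewrite /kernel_op -esumD; last 2 first.
- by move=> z _; rewrite mule_ge0// lee_fin.
- by move=> z _; rewrite mule_ge0// lee_fin.
by apply: eq_esum => z _; rewrite ge0_muleDr.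
Qed.

Lemma iter_kernel_opD k v w : (forall z, 0 <= v z) -> (forall z, 0 <= w z) ->
  iter k kernel_op (fun z => v z + w z) =
  fun x => iter k kernel_op v x + iter k kernel_op w x.
Proof.
move=> v0 w0; elim: k => //= k ->; rewrite kernel_opD//; exact: iter_kernel_op_ge0.
Qed.

Lemma kernel_op_esum (f : nat -> T -> \bar R) : (forall n z, 0 <= f n z) ->
  kernel_op (fun z => \esum_(n in [set: nat]) f n z) =
  fun x => \esum_(n in [set: nat]) kernel_op (f n) x.
Proof.
move=> f0; apply/funext => x; rewrite /kernel_op [RHS]esum_exchange; last first.
  by move=> n z; rewrite mule_ge0// lee_fin.
by apply: eq_esum => z _; rewrite esumZl// lee_fin.
Qed.

Lemma iter_kernel_op_esum k (f : nat -> T -> \bar R) : (forall n z, 0 <= f n z) ->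
  iter k kernel_op (fun z => \esum_(n in [set: nat]) f n z) =
  fun x => \esum_(n in [set: nat]) iter k kernel_op (f n) x.
Proof.
move=> f0; elim: k => //= k ->; rewrite kernel_op_esum// => n.
exact: iter_kernel_op_ge0.
Qed.

(* Riesz decomposition: an excessive function dominated by a potential has no
   harmonic part. *)
Lemma excessive_potential (w : T -> R) (r : T -> \bar R) :
  (forall x, 0 <= w x)%R -> (forall x, 0 <= r x) ->
  (forall x, kernel_op (EFin \o w) x <= (w x)%:E) ->
  (forall x, (w x)%:E <= \esum_(k in [set: nat]) iter k kernel_op r x) ->
  (forall x, \esum_(k in [set: nat]) iter k kernel_op r x < +oo) ->
  exists2 rho : T -> R, (forall x, 0 <= rho x)%R &
    forall x, (w x)%:E = \esum_(k in [set: nat]) iter k kernel_op (EFin \o rho) x.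
Proof.
move=> w0 r0 Qw wr roo.
have we0 x : 0 <= (EFin \o w) x by rewrite /= lee_fin.
have Qfin x : kernel_op (EFin \o w) x \is a fin_num.
  rewrite ge0_fin_numE; last exact: kernel_op_ge0.
  exact: le_lt_trans (Qw x) (ltry _).
pose rho x := (w x - fine (kernel_op (EFin \o w) x))%R.
have rho0 x : (0 <= rho x)%R.
  by rewrite subr_ge0 -lee_fin fineK.
have rhoe0 x : 0 <= (EFin \o rho) x by rewrite /= lee_fin.
exists rho => // x.
have stepE : EFin \o w = fun x => kernel_op (EFin \o w) x + (EFin \o rho) x.
  by apply/funext => y; rewrite /= /rho -[kernel_op _ y in RHS]fineK// -EFinD addrC subrK.
have decomp N : (w x)%:E = iter N kernel_op (EFin \o w) x +
    \sum_(0 <= k < N) iter k kernel_op (EFin \o rho) x.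
  elim: N => [|N ih]; first by rewrite big_geq// adde0.
  rewrite ih big_nat_recr//= [in LHS]stepE iter_kernel_opD//; last first.
    exact: kernel_op_ge0.
  by rewrite -iterSr addeAC addeA.
have it0 k y := iter_kernel_op_ge0 k rhoe0 y.
apply/eqP; rewrite eq_le; apply/andP; split; last first.
  apply: esum_nat_le => [n|N]; first exact: iter_kernel_op_ge0.
  by rewrite [leRHS](decomp N) leeDr// iter_kernel_op_ge0.
set S := \esum_(k in _) _; set v := \esum_(k in [set: nat]) iter k kernel_op r x.
have vfin : v \is a fin_num.
  rewrite ge0_fin_numE ?roo// esum_ge0// => k _; exact: iter_kernel_op_ge0.
(* By [decomp], [w x] is at most [S] plus the N-th iterate of [w], and that iterate is at most the
   tail of [v] from N on. Adding the first N terms of [v] makes the bound uniform in N; letting N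
   grow and cancelling the finite [v] then gives [w x <= S]. *)
have key N : \sum_(0 <= k < N) iter k kernel_op r x <= v + S - (w x)%:E.
  rewrite leeBrDr// /v (esum_nat_split N); last first.
    by move=> n; exact: iter_kernel_op_ge0.
  rewrite -addeA leeD2lE; last first.
    rewrite ge0_fin_numE; last first.
      by apply: sume_ge0 => k _; exact: iter_kernel_op_ge0.
    apply: le_lt_trans (roo x); apply: esum_nat_ge => n.
    exact: iter_kernel_op_ge0.
  rewrite (decomp N); apply: leeD; last exact: esum_nat_ge.
  apply: (le_trans (le_iter_kernel_op N wr x)).
  rewrite iter_kernel_op_esum; last by move=> n; exact: iter_kernel_op_ge0.
  by apply: le_esum => k _; rewrite -iterD.
have : v <= v + S - (w x)%:E.
  by apply: esum_nat_le key => n; exact: iter_kernel_op_ge0.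
by rewrite leeBrDr// leeD2lE.
Qed.

Lemma iter_kernel_opE (t : nat -> T -> T -> \bar R) (r : T -> \bar R) :
  (forall k x y, 0 <= t k x y) -> (forall x, 0 <= r x) ->
  (forall x y, t 0%N x y = (x == y)%:R%:E) ->
  (forall k x y, t k.+1 x y = \esum_(z in [set: T]) ((q x z)%:E * t k z y)) ->
  forall k x, iter k kernel_op r x = \esum_(y in [set: T]) (t k x y * r y).
Proof.
move=> t0 r0 tE tS; elim => [|k ih] x.
  rewrite (@esum_single _ _ x) ?tE ?eqxx ?mul1e//=.
  by move=> y yx; rewrite tE eq_sym (negPf yx) mul0e.
rewrite /= /kernel_op; under eq_esum do rewrite ih.
transitivity (\esum_(z in [set: T]) \esum_(y in [set: T])
    ((q x z)%:E * t k z y * r y)).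
  apply: eq_esum => z _; rewrite -esumZl ?lee_fin//; last first.
    by move=> y; rewrite mule_ge0.
  by apply: eq_esum => y _; rewrite muleA.
rewrite esum_exchange; last by move=> z y; rewrite !mule_ge0// lee_fin.
apply: eq_esum => y _; rewrite tS esumZr// => z.
by rewrite mule_ge0// lee_fin.
Qed.

(** The Riesz decomposition with the iterates of the kernel summed into a Green kernel [g]. Only the
    recursion of [t] on its first variable is used, so the walk and its transpose both qualify. *)
Lemma excessive_green (t : nat -> T -> T -> \bar R) (g : T -> T -> R) (u r : T -> R) :
  (forall k x y, 0 <= t k x y) -> (forall x y, t 0%N x y = (x == y)%:R%:E) ->
  (forall k x y, t k.+1 x y = \esum_(z in [set: T]) ((q x z)%:E * t k z y)) ->
  (forall x y, \esum_(k in [set: nat]) t k x y = (g x y)%:E) ->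
  (forall x, 0 <= u x)%R -> (forall x, 0 <= r x)%R ->
  (forall x, kernel_op (EFin \o u) x <= (u x)%:E) ->
  (forall x, (u x)%:E <= \esum_(y in [set: T]) ((g x y)%:E * (r y)%:E)) ->
  (forall x, \esum_(y in [set: T]) ((g x y)%:E * (r y)%:E) < +oo) ->
  exists2 phi : T -> R, (forall x, 0 <= phi x)%R &
    forall x, (u x)%:E = \esum_(y in [set: T]) ((g x y)%:E * (phi y)%:E).
Proof.
move=> tge0 t0 tS tg u0 r0 Pu ur roo.
have potE (f : T -> R) x : (forall y, 0 <= f y)%R ->
    \esum_(k in [set: nat]) iter k kernel_op (EFin \o f) x =
    \esum_(y in [set: T]) ((g x y)%:E * (f y)%:E).
  move=> f0; transitivity (\esum_(k in [set: nat])
      \esum_(y in [set: T]) (t k x y * (f y)%:E)).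
    by apply: eq_esum => k _; apply: (iter_kernel_opE (t := t)).
  rewrite esum_exchange; last by move=> n y; rewrite mule_ge0 ?lee_fin.
  by apply: eq_esum => y _; rewrite esumZr ?lee_fin// tg.
have [||||phi phi0 h] := @excessive_potential u (EFin \o r) u0.
- by move=> x; rewrite /= lee_fin.
- exact: Pu.
- by move=> x; rewrite potE.
- by move=> x; rewrite potE.
by exists phi => // x; rewrite -potE.
Qed.

End NonnegativeKernel.

(** * The Green function of the walk and its left potentials *)

Section Green.
Context {R : realType} {G : groupType}.
Variable mu : G -> R.
Hypothesis walk : random_walk mu.
Hypothesis trans : transient mu.
Local Open Scope group_scope.
Local Open Scope ereal_scope.

Let mu0 g : (0 <= mu g)%R := walk_ge0 walk g.
Let mue0 g : 0 <= (mu g)%:E. Proof. by rewrite lee_fin. Qed.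

Lemma transition_ge0 n x y : 0 <= transition mu n x y.
Proof.
elim: n y => [|n ih] y /=; first by rewrite lee_fin ler0n.
by apply: esum_ge0 => z _; rewrite mule_ge0.
Qed.

(** [transition] splits off the last step of a path; harmonicity in the first variable needs the
    first step split off instead. *)
Lemma transitionSl n x y : transition mu n.+1 x y =
  \esum_(z in [set: G]) ((mu (x^-1 * z))%:E * transition mu n z y).
Proof.
elim: n y => [|n ih] y.
  rewrite [LHS](@esum_single _ _ x) /=; last 2 first.
  - by rewrite eqxx mul1e.
  - by move=> z zx; rewrite eq_sym (negPf zx) mul0e.
  rewrite [RHS](@esum_single _ _ y) /= ?eqxx ?mul1e ?mule1//.
  by move=> z zy; rewrite (negPf zy) mule0.
rewrite [LHS]/=.
transitivity (\esum_(v in [set: G]) \esum_(z in [set: G])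
   ((mu (x^-1 * z))%:E * transition mu n z v * (mu (v^-1 * y))%:E)).
  apply: eq_esum => v _; rewrite -/(transition mu n.+1 x v) ih -esumZr//.
  by move=> z; rewrite mule_ge0// transition_ge0.
rewrite esum_exchange; last by move=> *; rewrite !mule_ge0// transition_ge0.
apply: eq_esum => z _; rewrite -esumZl//; last first.
  by move=> v; rewrite mule_ge0// transition_ge0.
by apply: eq_esum => v _; rewrite muleA.
Qed.

Lemma esum_mull (g : G) (f : G -> \bar R) :
  \esum_(x in [set: G]) f (g * x)%g = \esum_(x in [set: G]) f x.
Proof.
rewrite [RHS](reindex_esum [set: G] [set: G] (fun x => g * x)%g)//.
split => //= [x y _ _ /mulgI//|x _].
by exists (g^-1 * x)%g => //=; rewrite mulVKg.
Qed.

Lemma transition_mull n g x y :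
  transition mu n (g * x)%g (g * y)%g = transition mu n x y.
Proof.
elim: n y => [|n ih] y /=; first by rewrite (inj_eq (mulgI g)).
rewrite -(esum_mull g); apply: eq_esum => z _.
by rewrite ih invgM -mulgA mulKg.
Qed.

Lemma egreen_ge0 x y : 0 <= egreen mu x y.
Proof. by apply: esum_ge0 => n _; exact: transition_ge0. Qed.

Lemma egreenE x y : egreen mu x y = (green mu x y)%:E.
Proof. by rewrite /green fineK// ge0_fin_numE ?trans ?egreen_ge0. Qed.

Lemma green_ge0 x y : (0 <= green mu x y)%R.
Proof. by rewrite -lee_fin -egreenE egreen_ge0. Qed.

Lemma green_mull g x y : green mu (g * x)%g (g * y)%g = green mu x y.
Proof.
by rewrite /green; congr fine; apply: eq_esum => n _; rewrite transition_mull.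
Qed.

Lemma green_gt0 x y : (0 < green mu x y)%R.
Proof.
have word_gt0 s z : (forall w, w \in s -> (0 < mu w)%R) ->
    0 < transition mu (size s) z (z * foldr (fun x y => x * y) 1 s)%g.
  elim: s z => [|w s ih] z h /=; first by rewrite mulg1 eqxx lte_fin ltr01.
  have h1 : 0 < transition mu (size s) (z * w)%g
      (z * w * foldr (fun x y => x * y) 1 s)%g.
    by apply: ih => v vs; apply: h; rewrite in_cons vs orbT.
  rewrite -/(transition mu (size s).+1 _ _) transitionSl.
  apply: (lt_le_trans _ (esum_ub_term (z * w)%g _)); last first.
    by move=> v; rewrite mule_ge0// transition_ge0.
  by rewrite mulKg mulgA mule_gt0// lte_fin h// mem_head.
have [s _ [sA sg]] := walk_generates walk (x^-1 * y)%g.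
have := word_gt0 s x sA; rewrite sg mulVKg => h.
rewrite -lte_fin -egreenE (lt_le_trans h)//; apply: esum_ub_term => n.
exact: transition_ge0.
Qed.

Lemma mu_sum1 x : \esum_(z in [set: G]) (mu (x^-1 * z))%:E = 1.
Proof. by rewrite (esum_mull x^-1 (fun z => (mu z)%:E)) (walk_sum1 walk). Qed.

Lemma green_step x y : (green mu x y)%:E = (x == y)%:R%:E +
  \esum_(z in [set: G]) ((mu (x^-1 * z))%:E * (green mu z y)%:E).
Proof.
rewrite -egreenE /egreen (esum_nat_split 1); last first.
  by move=> n; exact: transition_ge0.
rewrite big_nat1; congr (_ + _).
transitivity (\esum_(n in [set: nat]) \esum_(z in [set: G])
  ((mu (x^-1 * z))%:E * transition mu n z y)).
  by apply: eq_esum => n _; rewrite add1n transitionSl.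
rewrite esum_exchange; last by move=> *; rewrite mule_ge0// transition_ge0.
apply: eq_esum => z _; rewrite esumZl// ?lee_fin//.
- by rewrite -egreenE.
- by move=> n; exact: transition_ge0.
Qed.

Lemma right_excessive_potential (u : G -> R) (r : G -> R) :
  (forall x, 0 <= u x)%R -> (forall x, 0 <= r x)%R ->
  (forall x, \esum_(z in [set: G]) ((mu (x^-1 * z))%:E * (u z)%:E) <= (u x)%:E) ->
  (forall x, (u x)%:E <= \esum_(y in [set: G]) ((green mu x y)%:E * (r y)%:E)) ->
  (forall x, \esum_(y in [set: G]) ((green mu x y)%:E * (r y)%:E) < +oo) ->
  exists2 phi : G -> R, (forall x, 0 <= phi x)%R &
    forall x, (u x)%:E = \esum_(y in [set: G]) ((green mu x y)%:E * (phi y)%:E).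
Proof.
move=> u0 r0 Pu ur roo.
apply: (@excessive_green _ _ (fun x z => mu (x^-1 * z)) _ (transition mu) _ u r) => //.
- exact: transition_ge0.
- exact: transitionSl.
- exact: egreenE.
Qed.

Lemma left_excessive_potential (w : G -> R) (r : G -> R) :
  (forall x, 0 <= w x)%R -> (forall x, 0 <= r x)%R ->
  (forall y, \esum_(z in [set: G]) ((mu (z^-1 * y))%:E * (w z)%:E) <= (w y)%:E) ->
  (forall y, (w y)%:E <= \esum_(x in [set: G]) ((green mu x y)%:E * (r x)%:E)) ->
  (forall y, \esum_(x in [set: G]) ((green mu x y)%:E * (r x)%:E) < +oo) ->
  exists2 rho : G -> R, (forall x, 0 <= rho x)%R &
    forall y, (w y)%:E = \esum_(x in [set: G]) ((green mu x y)%:E * (rho x)%:E).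
Proof.
move=> w0 r0 Pw wr roo.
apply: (@excessive_green _ _ (fun y z => mu (z^-1 * y)) _
  (fun n y x => transition mu n x y) (fun y x => green mu x y) w r) => //.
- by move=> n y x; exact: transition_ge0.
- by move=> y x /=; rewrite eq_sym.
- by move=> n y x /=; apply: eq_esum => v _; rewrite muleC.
- by move=> y x; exact: egreenE.
Qed.

(** The constant 1 is excessive but need not be a potential. Its minimum with n times a Green
    function is excessive and lies below a potential, hence is a potential, and it increases to 1
    because [green] is positive. *)
Definition cutoff (n : nat) (x : G) : R :=
  Num.min 1%R (n%:R * green mu x 1%g)%R.

Lemma cutoff_ge0 n x : (0 <= cutoff n x)%R.
Proof. by rewrite le_min ler01 mulr_ge0 ?ler0n ?green_ge0. Qed.

Lemma cutoff_le1 n x : (cutoff n x <= 1)%R.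
Proof. by rewrite ge_min lexx. Qed.

Lemma cutoff_eventually1 (s : seq G) :
  exists N, forall n x, (N <= n)%N -> x \in s -> cutoff n x = 1%R.
Proof.
have one x : exists N, forall n, (N <= n)%N -> cutoff n x = 1%R.
  exists (Num.truncn (green mu x 1%g)^-1).+1 => n hn.
  apply/min_idPl; rewrite -ler_pdivrMr ?green_gt0// mul1r.
  by rewrite (le_trans (ltW (truncnS_gt _)))// ler_nat.
elim: s => [|y s [N hN]]; first by exists 0%N.
have [N' hN'] := one y.
exists (maxn N N') => n x; rewrite geq_max => /andP[n1 n2].
by rewrite inE => /orP[/eqP ->|xs]; [exact: hN'|exact: hN].
Qed.

Lemma cutoff_potential n : exists2 phi : G -> R, (forall x, 0 <= phi x)%R &
  forall x, (cutoff n x)%:E =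
    \esum_(y in [set: G]) ((green mu x y)%:E * (phi y)%:E).
Proof.
pose r (y : G) : R := (n%:R * (y == 1%g)%:R)%R.
have rE x : \esum_(y in [set: G]) ((green mu x y)%:E * (r y)%:E) =
    (n%:R * green mu x 1%g)%:E.
  rewrite (@esum_single _ _ 1%g) /r ?eqxx ?mulr1.
  - by rewrite -EFinM mulrC.
  - by rewrite mule_ge0// lee_fin ?green_ge0.
  - by move=> y y1; rewrite (negPf y1) mulr0 mule0.
apply: (@right_excessive_potential _ r).
- exact: cutoff_ge0.
- by move=> x; rewrite mulr_ge0.
- move=> x; rewrite {2}/cutoff EFin_min le_min; apply/andP; split.
    rewrite -(mu_sum1 x); apply: le_esum => z _.
    by rewrite -EFinM lee_fin ler_piMr// cutoff_le1.
  apply: (@le_trans _ _ (\esum_(z in [set: G])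
    (n%:R%:E * ((mu (x^-1 * z))%:E * (green mu z 1%g)%:E)))).
    apply: le_esum => z _; rewrite -!EFinM lee_fin mulrCA ler_wpM2l//.
    by rewrite ge_min lexx orbT.
  rewrite esumZl ?lee_fin//; last by move=> z; rewrite mule_ge0 ?lee_fin ?green_ge0.
  rewrite EFinM lee_wpmul2l ?lee_fin// [leRHS]green_step leeDr// lee_fin.
- by move=> x; rewrite rE lee_fin ge_min lexx orbT.
- by move=> x; rewrite rE ltry.
Qed.

Definition cutoff_charge n : G -> R := s2val (cid2 (cutoff_potential n)).

Lemma cutoff_charge_ge0 n x : (0 <= cutoff_charge n x)%R.
Proof. exact: (s2valP (cid2 (cutoff_potential n))). Qed.

Lemma cutoff_chargeE n x : (cutoff n x)%:E =
  \esum_(y in [set: G]) ((green mu x y)%:E * (cutoff_charge n y)%:E).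
Proof. exact: (s2valP' (cid2 (cutoff_potential n))). Qed.

Definition left_charge (w rho : G -> R) : Prop :=
  (forall x, 0 <= rho x)%R /\
  forall y, (w y)%:E = \esum_(x in [set: G]) ((green mu x y)%:E * (rho x)%:E).

Definition left_potential (w : G -> R) (r : R) : Prop :=
  exists2 rho : G -> R, left_charge w rho &
    \esum_(x in [set: G]) (rho x)%:E = r%:E.

Lemma left_potential_ge0 w r y : left_potential w r -> (0 <= w y)%R.
Proof.
move=> [rho [rho0 wE] _]; rewrite -lee_fin wE esum_ge0// => x _.
by rewrite mule_ge0 ?lee_fin ?green_ge0.
Qed.

(** Exchanging the sums turns the pairing of [rho G] with [cutoff_charge n] into the pairing of
    [rho] with the potential of [cutoff_charge n], which is [cutoff n]. As the cutoffs increase to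
    1, the total mass of [rho] is recovered from [w] alone. *)
Lemma left_charge_pairing w rho n : left_charge w rho ->
  \esum_(y in [set: G]) (w y * cutoff_charge n y)%:E =
  \esum_(x in [set: G]) (rho x * cutoff n x)%:E.
Proof.
move=> [rho0 wE].
transitivity (\esum_(y in [set: G]) \esum_(x in [set: G])
   ((green mu x y)%:E * (rho x)%:E * (cutoff_charge n y)%:E)).
  apply: eq_esum => y _; rewrite EFinM wE esumZr ?lee_fin ?cutoff_charge_ge0//.
  by move=> x; rewrite mule_ge0 ?lee_fin ?green_ge0.
rewrite esum_exchange; last first.
  by move=> y x; rewrite !mule_ge0 ?lee_fin ?green_ge0 ?cutoff_charge_ge0.
apply: eq_esum => x _; rewrite EFinM cutoff_chargeE -esumZl ?lee_fin//.
  by apply: eq_esum => y _; rewrite muleCA muleA.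
by move=> y; rewrite mule_ge0 ?lee_fin ?green_ge0 ?cutoff_charge_ge0.
Qed.

Lemma left_potential_pairing_le w r n : left_potential w r ->
  \esum_(y in [set: G]) (w y * cutoff_charge n y)%:E <= r%:E.
Proof.
move=> [rho [rho0 wE] <-]; rewrite (left_charge_pairing _ (conj rho0 wE)).
by apply: le_esum => x _; rewrite lee_fin ler_piMr// cutoff_le1.
Qed.

Lemma left_charge_pairing_ge w rho (s : seq G) : left_charge w rho -> uniq s ->
  exists N, forall n, (N <= n)%N -> (\sum_(x <- s) rho x)%:E <=
    \esum_(y in [set: G]) (w y * cutoff_charge n y)%:E.
Proof.
move=> [rho0 wE] us; have [N hN] := cutoff_eventually1 s.
exists N => n hn; rewrite (left_charge_pairing _ (conj rho0 wE)).
apply: le_trans (esum_seq_le _ us); last first.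
  by move=> x; rewrite lee_fin mulr_ge0// cutoff_ge0.
rewrite sumEFin lee_fin le_eqVlt; apply/orP; left; apply/eqP.
by apply: eq_big_seq => x xs; rewrite hN// mulr1.
Qed.

Lemma left_potential_pairing_ge w r e : left_potential w r -> (0 < e)%R ->
  exists N, forall n, (N <= n)%N ->
    (r - e)%:E <= \esum_(y in [set: G]) (w y * cutoff_charge n y)%:E.
Proof.
move=> [rho wrho rE] e0; have [s [us hs]] := esum_fin_approx wrho.1 rE e0.
have [N hN] := left_charge_pairing_ge wrho us.
exists N => n hn; apply: le_trans (hN n hn); rewrite lee_fin; exact: ltW.
Qed.

Lemma left_potentialD w1 r1 w2 r2 : left_potential w1 r1 ->
  left_potential w2 r2 -> left_potential (fun y => w1 y + w2 y)%R (r1 + r2)%R.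
Proof.
move=> [p1 [p10 w1E] r1E] [p2 [p20 w2E] r2E].
exists (fun x => p1 x + p2 x)%R; first split.
- by move=> x; rewrite addr_ge0.
- move=> y; rewrite EFinD w1E w2E -esumD.
  + by apply: eq_esum => x _; rewrite EFinD ge0_muleDr ?lee_fin.
  + by move=> x _; rewrite mule_ge0 ?lee_fin ?green_ge0.
  + by move=> x _; rewrite mule_ge0 ?lee_fin ?green_ge0.
- by rewrite EFinD -r1E -r2E -esumD//; move=> *; rewrite lee_fin.
Qed.

Lemma left_potentialZ c w r : (0 <= c)%R -> left_potential w r ->
  left_potential (fun y => c * w y)%R (c * r)%R.
Proof.
move=> c0 [p [p0 wE] rE].
exists (fun x => c * p x)%R; first split.
- by move=> x; rewrite mulr_ge0.
- move=> y; rewrite EFinM wE -esumZl ?lee_fin//.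
  + by apply: eq_esum => x _; rewrite EFinM muleCA.
  + by move=> x; rewrite mule_ge0 ?lee_fin ?green_ge0.
- by rewrite EFinM -rE -esumZl ?lee_fin.
Qed.

Lemma green_step_le x y :
  \esum_(z in [set: G]) ((mu (z^-1 * y))%:E * (green mu x z)%:E) <=
  (green mu x y)%:E.
Proof.
rewrite -(egreenE x y) /egreen (esum_nat_split 1); last first.
  by move=> n; exact: transition_ge0.
rewrite big_nat1.
have -> : \esum_(n in [set: nat]) transition mu (1 + n) x y =
  \esum_(n in [set: nat]) \esum_(z in [set: G])
  ((mu (z^-1 * y))%:E * transition mu n x z).
  apply: eq_esum => n _; rewrite add1n /=; apply: eq_esum => z _.
  by rewrite muleC.
rewrite esum_exchange; last by move=> *; rewrite mule_ge0// transition_ge0.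
rewrite -[leLHS]add0e; apply: leeD; first exact: transition_ge0.
apply: le_esum => z _; rewrite esumZl// ?lee_fin//.
- by rewrite -egreenE.
- by move=> n; exact: transition_ge0.
Qed.

Lemma left_charge_excessive w rho : left_charge w rho ->
  forall y, \esum_(z in [set: G]) ((mu (z^-1 * y))%:E * (w z)%:E) <= (w y)%:E.
Proof.
move=> [rho0 wE] y; rewrite wE.
apply: (@le_trans _ _ (\esum_(z in [set: G]) \esum_(x in [set: G])
   ((mu (z^-1 * y))%:E * (green mu x z)%:E * (rho x)%:E))).
  apply: le_esum => z _; rewrite wE -esumZl//; last first.
    by move=> x; rewrite mule_ge0 ?lee_fin ?green_ge0.
  by apply: le_esum => x _; rewrite muleA.
rewrite esum_exchange; last first.
  by move=> *; rewrite !mule_ge0 ?lee_fin ?green_ge0.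
apply: le_esum => x _; rewrite esumZr ?lee_fin//; last first.
  by move=> z; rewrite mule_ge0 ?lee_fin ?green_ge0.
by apply: lee_wpmul2r; [rewrite lee_fin|exact: green_step_le].
Qed.

(** A minimum of excessive functions is excessive, and here it lies below the potential [w1], so the
    Riesz decomposition supplies a charge. The delicate point is that this charge has finite
    mass. *)
Lemma left_potential_min w1 r1 w2 r2 : left_potential w1 r1 ->
  left_potential w2 r2 ->
  exists r, left_potential (fun y => Num.min (w1 y) (w2 y)) r.
Proof.
move=> h1 h2; have [p1 w1p r1E] := h1; have [p2 w2p _] := h2.
pose w y := Num.min (w1 y) (w2 y).
have w0 y : (0 <= w y)%R.
  by rewrite le_min (left_potential_ge0 y h1) (left_potential_ge0 y h2).
have [||||rho rho0 wE] := @left_excessive_potential w p1 w0.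
- exact: w1p.1.
- move=> y; rewrite /w EFin_min le_min; apply/andP; split.
    apply: le_trans (left_charge_excessive w1p y); apply: le_esum => z _.
    by rewrite -!EFinM lee_fin ler_wpM2l// ge_min lexx.
  apply: le_trans (left_charge_excessive w2p y); apply: le_esum => z _.
  by rewrite -!EFinM lee_fin ler_wpM2l// ge_min lexx orbT.
- by move=> y; rewrite -w1p.2 lee_fin ge_min lexx.
- by move=> y; rewrite -w1p.2 ltry.
(* The mass of [rho] on a finite set is at most the pairing of the minimum with a late cutoff
   charge; pairings are monotone in the potential, and that of [w1] is at most [r1]. *)
have ler1 : \esum_(x in [set: G]) (rho x)%:E <= r1%:E.
  apply: ge_ereal_sup => _ [A [finA _] <-].
  rewrite fsbig_finite//= sumEFin.
  have [N hN] := left_charge_pairing_ge (conj rho0 wE) (finmap.fset_uniq (fset_set A)).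
  apply: le_trans (hN N (leqnn N)) _.
  apply: le_trans (left_potential_pairing_le N h1).
  apply: le_esum => y _; rewrite lee_fin ler_wpM2r ?cutoff_charge_ge0//.
  by rewrite ge_min lexx.
exists (fine (\esum_(x in [set: G]) (rho x)%:E)); exists rho => //.
rewrite fineK// ge0_fin_numE; first exact: le_lt_trans ler1 (ltry _).
by apply: esum_ge0 => x _; rewrite lee_fin.
Qed.

Lemma left_potential_green x : left_potential (green mu x) 1%R.
Proof.
exists (fun z => (z == x)%:R%R); first split.
- by move=> z; rewrite ler0n.
- move=> y; rewrite (@esum_single _ _ x) ?eqxx ?mule1//.
    by rewrite lee_fin green_ge0.
  by move=> z zx; rewrite (negPf zx) mule0.
- rewrite (@esum_single _ _ x) ?eqxx//.
  by move=> z zx; rewrite (negPf zx).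
Qed.

(** Subtracting the diagonal term replaces the unit charge at [x] by the law of the walk one step
    after [x], again of mass 1. Comparison with [left_potential_green] will show that single points
    of the group carry no mass in the limit. *)
Lemma left_potential_green_step x :
  left_potential (fun y => green mu x y - (x == y)%:R)%R 1%R.
Proof.
exists (fun z => mu (x^-1 * z)); first split => //.
- move=> y; rewrite EFinB (green_step x y) addeAC subee// add0e.
  by apply: eq_esum => z _; rewrite muleC.
- exact: mu_sum1.
Qed.

Lemma left_potential_translate g w r : left_potential w r ->
  left_potential (fun y => w (g * y)%g) r.
Proof.
move=> [p [p0 wE] rE]; exists (fun x => p (g * x)%g); first split => //.
- move=> y; rewrite wE -(esum_mull g); apply: eq_esum => x _.
  by rewrite green_mull.
- by rewrite (esum_mull g (fun x => (p x)%:E)).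
Qed.

End Green.

(** * The Martin boundary *)

Section SubtypeTopology.
Context {X : topologicalType} (A : set X).

Lemma set_val_continuous : continuous (set_val : A -> X).
Proof. exact: initial_continuous. Qed.

Lemma nbhs_set_type (x : A) (V : set A) : nbhs x V ->
  exists2 U, nbhs (set_val x) U & forall y : A, U (set_val y) -> V y.
Proof.
move=> [_ [[W oW <-] Wx sub]]; exists W; last by move=> y; exact: sub.
by apply: open_nbhs_nbhs; split.
Qed.

Lemma compact_set_type : compact A -> compact [set: A].
Proof.
move=> cA F PF _; pose F' : set_system X := set_val @ F.
have FA : F' A.
  by apply: (@filterS _ F _ [set: A] _ _ filterT) => x _; exact: set_valP.
have [p [Ap Fp]] := cA F' _ FA.
exists (exist _ p (mem_set Ap)); split => // B V FB /nbhs_set_type[U Up sub].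
have F'B : F' (set_val @` B).
    by apply: (@filterS _ F _ B _ _ FB) => x Bx; exists x.
by have [_ [[y By <-] Uy]] := Fp _ _ F'B Up; exists y; split => //; exact: sub.
Qed.

End SubtypeTopology.

Section MartinBoundary.
Context {R : realType} {G : groupType}.
Variable mu : G -> R.
Hypothesis walk : random_walk mu.
Hypothesis trans : transient mu.
Variables (S : seq G) (d : G -> G -> nat) (C : R).
Hypothesis d_word : word_metric S d.
Hypothesis C_gt0 : 0 < C.
Hypothesis harnack : forall x y z, green mu x z / green mu y z <= C ^+ d x y.
Variable M : martin_compactification mu.
Notation X := (martin_boundary M).
Notation K := (@mkernel _ _ _ M).
Notation emb := (@memb _ _ _ M).
Notation green := (green mu).

Let green_gt0 x y : 0 < green x y := green_gt0 walk trans x y.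

Lemma mkernelE g h : K g (emb h) = green g h / green 1%g h.
Proof. exact: mkernel_memb. Qed.

Lemma mkernel_green g h : K g (emb h) * green 1%g h = green g h.
Proof. by rewrite mkernelE divfK// gt_eqF. Qed.

Lemma dense_le (f : M -> R) c : continuous f -> (forall h, f (emb h) <= c) ->
  forall z, f z <= c.
Proof.
move=> fc fe z; rewrite leNgt; apply/negP => cz.
have [||z' [/= h1 [h _ hE]]] := @memb_dense _ _ _ M (f @^-1` [set x | c < x]).
- by exists z.
- by apply: open_comp; [move=> x _; exact: fc|exact: open_gt].
- by move: h1; rewrite -hE ltNge fe.
Qed.

Lemma dense_eq (f g : M -> R) : continuous f -> continuous g ->
  (forall h, f (emb h) = g (emb h)) -> f =1 g.
Proof.
move=> fc gc fg z; apply/eqP; rewrite eq_le -subr_le0 -[X in _ && X]subr_le0.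
apply/andP; split.
  apply: (@dense_le (fun x => f x - g x)) => [x|h]; last by rewrite fg subrr.
  by apply: cvgB; [exact: fc|exact: gc].
apply: (@dense_le (fun x => g x - f x)) => [x|h]; last by rewrite fg subrr.
by apply: cvgB; [exact: gc|exact: fc].
Qed.

(* A boundary point is a limit of group elements other than any given one. *)
Lemma boundary_le (f : M -> R) x c : continuous f ->
  (forall h, h != x -> f (emb h) <= c) -> forall xi : X, f (set_val xi) <= c.
Proof.
move=> fc fe xi; rewrite leNgt; apply/negP => cz.
have oP : open (~` [set emb x]).
  apply: closed_openC; apply: accessible_closed_set1; apply: hausdorff_accessible.
  exact: metric_hausdorff.
have [||z' [/= [h1 h2] [h _ hE]]] := @memb_dense _ _ _ M
  ((f @^-1` [set x | c < x]) `&` ~` [set emb x]).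
- exists (set_val xi); split => //= xix.
  by have := set_mem (valP xi); apply; exists x => //; rewrite -xix.
- by apply: openI => //; apply: open_comp; [move=> y _; exact: fc|exact: open_gt].
- move: h1; rewrite -hE ltNge fe//; apply/eqP => hx.
  by apply: h2; rewrite -hE hx.
Qed.

(** Mere positivity on the group would be lost in passing to the boundary. The Harnack inequality,
    with its two base points exchanged, bounds the kernel below uniformly in [h], and this bound
    survives the limit. *)
Lemma mkernel_ge g z : (C ^+ d 1%g g)^-1 <= K g z.
Proof.
rewrite -lerN2; apply: (@dense_le (fun z => - K g z)) => [x|h].
  by apply: cvgN; exact: mkernel_continuous.
rewrite lerN2 mkernelE -[leRHS]invrK lef_pV2 ?posrE ?exprn_gt0//.
  by rewrite invf_div; exact: harnack.
by rewrite invr_gt0 divr_gt0.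
Qed.

Lemma mkernel_gt0 g z : 0 < K g z.
Proof. by apply: lt_le_trans (mkernel_ge g z); rewrite invr_gt0 exprn_gt0. Qed.

Lemma mkernel_le g z : K g z <= C ^+ d g 1%g.
Proof.
apply: (@dense_le (K g)) => [|h]; first exact: mkernel_continuous.
by rewrite mkernelE; exact: harnack.
Qed.

Lemma word_metric_mul x g : d (x * g)%g x = d g 1%g.
Proof.
have [[s sw ss] dle] := d_word (x * g)%g x.
have [[t tw ts] dle'] := d_word g 1%g.
have E : ((x * g)^-1 * x = g^-1 * 1)%g by rewrite invgM mulg1 -mulgA mulVg mulg1.
apply/eqP; rewrite eqn_leq -{1}ts -{2}ss dle ?E//=.
by apply: dle'; rewrite -E.
Qed.

Lemma mkernel1 z : K 1%g z = 1.
Proof.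
apply: (@dense_eq (K 1%g) (fun=> 1)) => [||h].
- exact: mkernel_continuous.
- by move=> x; exact: cvg_cst.
- by rewrite mkernelE divff// gt_eqF.
Qed.

Lemma mkernel_act x g z : K x (mact g z) * K g^-1%g z = K (g^-1 * x)%g z.
Proof.
apply: (@dense_eq (fun z => K x (mact g z) * K g^-1%g z) (K (g^-1 * x)%g)).
- move=> y; apply: cvgM; last exact: mkernel_continuous.
  by apply: continuous_comp; [exact: mact_continuous|exact: mkernel_continuous].
- exact: mkernel_continuous.
- move=> h; rewrite mact_memb !mkernelE.
  rewrite -(green_mull mu g (g^-1 * x)%g h) mulVKg.
  rewrite -(green_mull mu g (g^-1)%g h) mulgV.
  by rewrite mulrA divfK// gt_eqF.
Qed.

Lemma bkernel_gt0 g (xi : X) : 0 < bkernel g xi.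
Proof. exact: mkernel_gt0. Qed.

Lemma bkernel1 (xi : X) : bkernel 1%g xi = 1.
Proof. exact: mkernel1. Qed.

Lemma bkernel_act x g (xi : X) :
  bkernel x (bact g xi) * bkernel g^-1%g xi = bkernel (g^-1 * x)%g xi.
Proof. exact: mkernel_act. Qed.

Lemma bkernel_continuous g : continuous (bkernel g : X -> R).
Proof.
move=> xi; apply: continuous_comp; first exact: set_val_continuous.
exact: mkernel_continuous.
Qed.

Lemma bact_continuous g : continuous (bact g : X -> X).
Proof.
move=> xi; apply: (@cvg_trans _ (fmap (bact g) (nbhs xi))) => // V.
move=> /nbhs_set_type[U /= Ux sub].
have : \forall y \near xi, U (mact g (set_val y)).
  have c : {for xi, continuous (mact g \o (set_val : X -> M))}.
    apply: continuous_comp; first exact: set_val_continuous.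
    exact: mact_continuous.
  exact: c.
by apply: filterS => y Uy; exact: sub.
Qed.

Lemma bact1 (xi : X) : bact 1%g xi = xi.
Proof. by apply: val_inj => /=; exact: mact1. Qed.

Lemma bactM g h (xi : X) : bact (g * h)%g xi = bact g (bact h xi).
Proof. by apply: val_inj => /=; exact: mactM. Qed.

Lemma bactK g (xi : X) : bact g^-1%g (bact g xi) = xi.
Proof. by rewrite -bactM mulVg bact1. Qed.

Lemma bactVK g (xi : X) : bact g (bact g^-1%g xi) = xi.
Proof. by rewrite -bactM mulgV bact1. Qed.

(** By the cocycle identity the kernel at the translate of [xi] is also constantly 1, and kernels
    separate boundary points. *)
Lemma spine_fixed g (xi : X) : spine xi -> bact g xi = xi.
Proof.
move=> sxi; apply: val_inj.
apply: mkernel_separates; [exact: (@set_valP _ (martin_boundary M) (bact g xi))|exact: (@set_valP _ (martin_boundary M) xi)|].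
move=> x; have := bkernel_act x g xi; rewrite (sxi g^-1%g) (sxi (g^-1 * x)%g).
by rewrite mulr1 => E; exact: etrans E (esym (sxi x)).
Qed.

Lemma boundary_space_compact : compact [set: X].
Proof. by apply: compact_set_type; exact: martin_boundary_compact. Qed.

(** Traces on the group of the neighbourhoods of [xi]. They give a meaning to boundary limits of
    functions known only on the group, without extending these to the whole compactification. *)
Definition boundary_nbhs (xi : X) : set_system G :=
  filter_from (nbhs (set_val xi)) (fun U => emb @^-1` U).

Global Instance boundary_nbhs_filter xi : Filter (boundary_nbhs xi).
Proof.
apply: filter_from_filter; first by exists setT; exact: filterT.
by move=> U V hU hV; exists (U `&` V) => //; exact: filterI.
Qed.

Lemma cvg_mkernel g (xi : X) :
  (fun h => K g (emb h)) @ boundary_nbhs xi --> bkernel g xi.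
Proof.
move=> V /(@mkernel_continuous _ _ _ M g) /= h.
by exists [set z | V (K g z)].
Qed.

Lemma cvg_mull g (xi : X) (T : topologicalType) (F : G -> T) (l : T) :
  F @ boundary_nbhs (bact g xi) --> l ->
  (fun h => F (g * h)%g) @ boundary_nbhs xi --> l.
Proof.
move=> Fl V /Fl [U /= Ux sub].
exists (mact g @^-1` U); first exact: (mact_continuous Ux).
by move=> h /= Uh; apply: sub => /=; rewrite -mact_memb.
Qed.

(** Infinitely many exceptions would cluster somewhere in the compact space. Group points are
    isolated, so the cluster point would lie on the boundary, where [P] holds nearby. *)
Lemma boundary_cofinite (P : G -> Prop) :
  (forall xi : X, \forall h \near boundary_nbhs xi, P h) ->
  exists s : seq G, forall h, h \notin s -> P h.
Proof.
move=> near_P; apply: contrapT => nP.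
have hB (s : seq G) : exists h, h \notin s /\ ~ P h.
  apply: contrapT => nh; apply: nP; exists s => h hs.
  by apply: contrapT => nPh; apply: nh; exists h.
pose F : set_system M := filter_from [set: seq G]
  (fun s => emb @` [set h | h \notin s /\ ~ P h]).
have FF : ProperFilter F.
  apply: filter_from_proper; last first.
    by move=> s _; have [h hh] := hB s; exists (emb h), h.
  apply: filter_from_filter; first by exists [::].
  move=> s t _ _; exists (s ++ t) => // _ [h [/= hst nPh] <-].
  move: hst; rewrite mem_cat negb_or => /andP[hs ht].
  by split; exists h.
have [p [_ Fp]] := @mspace_compact _ _ _ M F FF filterT.
have [[h0 _ h0p]|bp] := pselect (range emb p).
  have Fh : F (emb @` [set h | h \notin [:: h0] /\ ~ P h]) by exists [:: h0].
  have np : nbhs p [set p].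
    by apply: open_nbhs_nbhs; split => //; rewrite -h0p; exact: memb_open.
  have [q [[h [/= hh0 _] <-] qp]] := Fp _ _ Fh np.
  by move: hh0; rewrite inE; have /memb_inj -> := etrans qp (esym h0p); rewrite eqxx.
have [U /= Up sub] := near_P (exist _ p (mem_set bp)).
have FB : F (emb @` [set h | h \notin [::] /\ ~ P h]) by exists [::].
by have [q [[h [_ nPh] <-] Uh]] := Fp _ _ FB Up; apply: nPh; exact: sub.
Qed.

Section Projection.
Variable xi0 : X.

(** An almost nearest boundary point. Since [emb h] is isolated, its distance to the boundary is
    positive, so some boundary point comes within twice that distance. Composition with the
    resulting [projection] turns functions on the boundary into functions on the group with the same
    boundary values. *)
Lemma exists_projection h : exists xi : X, forall eta : X,
  mdist (emb h) (set_val xi) <= 2 * mdist (emb h) (set_val eta).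
Proof.
pose D : set R := [set mdist (emb h) (set_val eta) | eta in [set: X]].
have D0 : D !=set0 by exists (mdist (emb h) (set_val xi0)), xi0.
have infD : has_inf D.
  by split => //; exists 0 => _ [eta _ <-]; exact: mdist_ge0.
have /nbhs_ballP[r /= r0 sub] : nbhs (emb h) [set emb h].
  by apply: open_nbhs_nbhs; split => //; exact: memb_open.
have rD : r <= inf D.
  apply: lb_le_inf => // _ [eta _ <-]; rewrite leNgt; apply/negP => lt.
  have /sub /= E : ball (emb h) r (set_val eta) by rewrite ballEmdist.
  by have := set_mem (valP eta); apply; exists h.
have i0 : 0 < inf D by exact: lt_le_trans r0 rD.
have [_ [xi _ <-] lt] := inf_adherent i0 infD.
exists xi => eta; apply: le_trans (ltW lt) _; rewrite mulr_natl mulr2n.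
by apply: lerD; apply: inf_lbound => //; [exact: infD.2|exists eta|exact: infD.2|exists eta].
Qed.

Definition projection h : X := sval (cid (exists_projection h)).

Lemma cvg_projection (xi : X) : projection @ boundary_nbhs xi --> xi.
Proof.
move=> V /nbhs_set_type[U /nbhs_ballP[e /= e0 eU] sub].
(* If [emb h] is within e/3 of [xi], its projection is within 2e/3 of [emb h], hence within e of
   [xi]. *)
exists (ball (set_val xi) (e / 3)); first by apply: nbhsx_ballx; rewrite divr_gt0.
move=> h; rewrite /= ballEmdist /= => hx.
apply: sub; apply: eU; rewrite ballEmdist /=.
have := svalP (cid (exists_projection h)) xi; rewrite -/(projection h).
rewrite (metric_sym (emb h) (set_val xi)) => ph.
have := metric_triangle (set_val xi) (emb h) (set_val (projection h)).
move: hx ph; set u := mdist _ (emb h); set v := mdist _ (set_val (projection h)).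
set w := mdist _ _; lra.
Qed.

End Projection.

End MartinBoundary.

(** * Absolutely summable families, generalized limits, Stone-Weierstrass *)

Section SignedSums.
Context {R : realType} {I : choiceType}.
Implicit Types f g : I -> R.

Definition abs_summable f := (\esum_(i in [set: I]) `|f i|%:E < +oo)%E.

Lemma le_abs_summable f g : (forall i, `|f i| <= `|g i|) ->
  abs_summable g -> abs_summable f.
Proof.
move=> fg; apply: le_lt_trans; apply: le_esum => i _; by rewrite lee_fin.
Qed.

Lemma abs_summableD f g : abs_summable f -> abs_summable g ->
  abs_summable (fun i => f i + g i).
Proof.
move=> sf sg; apply: (@le_lt_trans _ _ (\esum_(i in [set: I]) `|f i|%:E +
  \esum_(i in [set: I]) `|g i|%:E)%E); last exact: lte_add_pinfty.
rewrite -esumD; [|by move=> *; rewrite lee_fin..].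
by apply: le_esum => i _; rewrite -EFinD lee_fin ler_normD.
Qed.

Lemma abs_summableZ c f : abs_summable f -> abs_summable (fun i => c * f i).
Proof.
move=> sf; rewrite /abs_summable; under eq_esum do rewrite normrM EFinM.
rewrite esumZl ?lee_fin//.
by rewrite lte_mul_pinfty ?lee_fin.
Qed.

Lemma abs_summableN f : abs_summable f -> abs_summable (fun i => - f i).
Proof. by apply: le_abs_summable => i; rewrite normrN. Qed.

Lemma esum_fin_num f : (forall i, 0 <= f i) -> abs_summable f ->
  (\esum_(i in [set: I]) (f i)%:E)%E \is a fin_num.
Proof.
move=> f0 sf; rewrite ge0_fin_numE; last by apply: esum_ge0 => *; rewrite lee_fin.
by move: sf; rewrite /abs_summable; under eq_esum do rewrite ger0_norm//.
Qed.

(** [rsum] is defined by positive and negative parts. Any other splitting into nonnegative summable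
    families gives the same value, since the two splittings agree after adding across; additivity of
    [rsum] follows from this freedom. *)
Lemma rsum_sub f g : (forall i, 0 <= f i) -> (forall i, 0 <= g i) ->
  abs_summable f -> abs_summable g ->
  rsum (fun i => f i - g i) = fine (\esum_(i in [set: I]) (f i)%:E)%E -
    fine (\esum_(i in [set: I]) (g i)%:E)%E.
Proof.
move=> f0 g0 sf sg; rewrite /rsum.
set p := fun i => Num.max (f i - g i) 0; set n := fun i => Num.max (- (f i - g i)) 0.
have p0 i : 0 <= p i by rewrite le_max lexx orbT.
have n0 i : 0 <= n i by rewrite le_max lexx orbT.
have pn i : p i + g i = n i + f i.
  rewrite /p /n; case: (leP (f i - g i) 0) => h.
    by rewrite (elimT max_idPl) ?oppr_ge0//; lra.
  by rewrite (elimT max_idPr) ?oppr_le0 1?ltW//; lra.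
have sp : abs_summable p.
  apply: (le_abs_summable _ sf) => i; rewrite !ger0_norm// ge_max f0 andbT.
  by rewrite lerBlDr lerDl.
have sn : abs_summable n.
  apply: (le_abs_summable _ sg) => i; rewrite !ger0_norm// ge_max g0 andbT.
  by rewrite opprB lerBlDr lerDl.
have E : (\esum_(i in [set: I]) (p i)%:E + \esum_(i in [set: I]) (g i)%:E =
    \esum_(i in [set: I]) (n i)%:E + \esum_(i in [set: I]) (f i)%:E)%E.
  rewrite -!esumD; try by move=> *; rewrite lee_fin.
  by apply: eq_esum => i _; rewrite -!EFinD pn.
have := congr1 fine E; rewrite !fineD ?esum_fin_num//.
set a := fine _; set b := fine _; set c := fine _; set e := fine _; lra.
Qed.

Lemma rsum_ge0E f : (forall i, 0 <= f i) -> abs_summable f ->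
  rsum f = fine (\esum_(i in [set: I]) (f i)%:E)%E.
Proof.
move=> f0 sf; have := @rsum_sub f (fun=> 0) f0 (fun=> lexx _) sf.
rewrite [X in _ - fine X]esum1// subr0 => <-.
  by congr rsum; apply/funext => i; rewrite subr0.
by rewrite /abs_summable esum1 ?ltry// => i _; rewrite normr0.
Qed.

Lemma rsum_ge0 f : (forall i, 0 <= f i) -> 0 <= rsum f.
Proof.
move=> f0; rewrite /rsum.
have -> : (\esum_(i in [set: I]) (Num.max (- f i) 0)%:E = 0)%E.
  by apply: esum1 => i _; rewrite (elimT max_idPr)// oppr_le0.
rewrite subr0 fine_ge0// esum_ge0// => i _.
by rewrite lee_fin le_max f0.
Qed.

Lemma rsumN f : rsum (fun i => - f i) = - rsum f.
Proof. by rewrite /rsum opprB; under [in X in _ - X]eq_esum do rewrite opprK. Qed.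

Let pos f i := Num.max (f i) 0.
Let neg f i := Num.max (- f i) 0.
Let posneg f i : f i = pos f i - neg f i.
Proof.
rewrite /pos /neg; case: (leP (f i) 0) => h.
  by rewrite (elimT max_idPl) ?oppr_ge0//; lra.
by rewrite (elimT max_idPr) ?oppr_le0 1?ltW//; lra.
Qed.
Let pos0 f i : 0 <= pos f i. Proof. by rewrite le_max lexx orbT. Qed.
Let neg0 f i : 0 <= neg f i. Proof. by rewrite le_max lexx orbT. Qed.
Let spos f : abs_summable f -> abs_summable (pos f).
Proof.
apply: le_abs_summable => i; rewrite ger0_norm// ge_max normr_ge0 andbT.
exact: ler_norm.
Qed.
Let sneg f : abs_summable f -> abs_summable (neg f).
Proof.
apply: le_abs_summable => i; rewrite ger0_norm// ge_max normr_ge0 andbT.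
by rewrite -normrN ler_norm.
Qed.

Lemma rsumD f g : abs_summable f -> abs_summable g ->
  rsum (fun i => f i + g i) = rsum f + rsum g.
Proof.
move=> sf sg.
have -> : (fun i => f i + g i) =
    (fun i => (pos f i + pos g i) - (neg f i + neg g i)).
  by apply/funext => i; rewrite {1}(posneg f) {1}(posneg g); ring.
rewrite rsum_sub//.
- rewrite /rsum -/(pos f) -/(pos g) -/(neg f) -/(neg g).
  under eq_esum do rewrite EFinD; under [in X in _ - X]eq_esum do rewrite EFinD.
  rewrite !esumD ?fineD; try by move=> *; rewrite ?lee_fin ?pos0 ?neg0.
  + rewrite /pos /neg; ring.
  + exact: esum_fin_num (neg0 f) (sneg sf).
  + exact: esum_fin_num (neg0 g) (sneg sg).
  + exact: esum_fin_num (pos0 f) (spos sf).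
  + exact: esum_fin_num (pos0 g) (spos sg).
- by move=> i; rewrite addr_ge0.
- by move=> i; rewrite addr_ge0.
- by apply: abs_summableD; exact: spos.
- by apply: abs_summableD; exact: sneg.
Qed.

Lemma rsumZ c f : abs_summable f -> rsum (fun i => c * f i) = c * rsum f.
Proof.
move=> sf; wlog c0 : c / 0 <= c.
  move=> h; have [/h//|/ltW c0] := leP 0 c.
  apply: oppr_inj; rewrite -mulNr -h ?oppr_ge0// -rsumN.
  by congr rsum; apply/funext => i; rewrite mulNr.
have -> : (fun i => c * f i) = (fun i => c * pos f i - c * neg f i).
  by apply/funext => i; rewrite {1}(posneg f) mulrBr.
rewrite rsum_sub//; first last.
- by apply: abs_summableZ; exact: sneg.
- by apply: abs_summableZ; exact: spos.
- by move=> i; rewrite mulr_ge0.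
- by move=> i; rewrite mulr_ge0.
have E h : (forall i, 0 <= h i) -> abs_summable h ->
    fine (\esum_(i in [set: I]) (c * h i)%:E)%E =
    c * fine (\esum_(i in [set: I]) (h i)%:E)%E.
  move=> h0 sh; under eq_esum do rewrite EFinM.
  rewrite esumZl ?lee_fin// fineM//; exact: esum_fin_num.
by rewrite !E -?mulrBr//; [exact: sneg|exact: spos].
Qed.

Lemma rsumB f g : abs_summable f -> abs_summable g ->
  rsum (fun i => f i - g i) = rsum f - rsum g.
Proof. by move=> sf sg; rewrite rsumD ?rsumN//; exact: abs_summableN. Qed.

Lemma ler_rsum f g : abs_summable f -> abs_summable g ->
  (forall i, f i <= g i) -> rsum f <= rsum g.
Proof.
by move=> sf sg fg; rewrite -subr_ge0 -rsumB// rsum_ge0// => i; rewrite subr_ge0.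
Qed.

Lemma rsum_single i f : (forall j, j != i -> f j = 0) -> rsum f = f i.
Proof.
move=> f0; rewrite /rsum !(@esum_single _ _ i) /=; first exact/esym/posneg.
- by rewrite lee_fin neg0.
- by move=> j /f0 ->; rewrite oppr0 maxxx.
- by rewrite lee_fin pos0.
- by move=> j /f0 ->; rewrite maxxx.
Qed.

End SignedSums.

Section GeneralizedLimit.
Context {R : realType}.

Definition bounded_fun_on (T : Type) (f : T -> R) := exists c, forall x, `|f x| <= c.

(* Limits along an ultrafilter containing the cofinite sets. *)
Lemma generalized_limit : exists L : (nat -> R) -> R,
  [/\ forall c u v, bounded_fun_on u -> bounded_fun_on v ->
        L (fun n => c * u n + v n) = c * L u + L v,
      forall u, bounded_fun_on u -> (forall n, 0 <= u n) -> 0 <= L u &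
      forall u l, u @ \oo --> l -> L u = l].
Proof.
have [U [UU subU]] := @ultraFilterLemma nat \oo _.
have PU : ProperFilter U := ultra_proper.
pose L (u : nat -> R) := lim (u @ U).
have LE u l : u @ U --> l -> L u = l by exact: cvg_lim.
have cvgU u : bounded_fun_on u -> u @ U --> L u.
  move=> [c uc].
  have : compact `[- c, c] by exact: segment_compact.
  have uu : UltraFilter (u @ U).
    split; first exact: fmap_proper_filter.
    move=> F PF sub; rewrite predeqE => A; split; last exact: sub.
    move=> FA; have [//|h] := in_ultra_setVsetC (u @^-1` A) UU.
    have : F set0.
      rewrite -(setICr A); apply: filterI => //; apply: sub; exact: h.
    by move/filter_not_empty.
  rewrite compact_ultra => /(_ _ uu)[].
    apply: (@filterS _ U _ [set: nat] _ _ filterT) => n _ /=.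
    by rewrite in_itv /= -ler_norml.
  by move=> l [_ ul]; rewrite /= (LE _ _ ul).
exists L; split.
- move=> c u v bu bv; apply: LE; apply: cvgD; last exact: cvgU.
  by apply: cvgMr; exact: cvgU.
- move=> u bu u0; apply: (cvgr_to_ge (cvgU u bu)).
  exact: nearW.
- by move=> u l ul; apply: LE; apply: cvg_trans ul; exact: cvg_app.
Qed.

End GeneralizedLimit.

(** * Lattice form of the Stone-Weierstrass theorem *)

Section LatticeStoneWeierstrass.
Context {R : realType} {T : topologicalType}.
Hypothesis cT : compact [set: T].

(** The finite subcover argument in directed form. If no index were good everywhere, the sets of bad
    points would generate a proper filter, and near a cluster point of it some index is good. *)
Lemma compact_directed (J : Type) (V : set J) (good : J -> T -> Prop) :
  V !=set0 ->
  (forall v w, V v -> V w -> exists2 u, V u &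
     forall z, good v z \/ good w z -> good u z) ->
  (forall y : T, exists2 v, V v & \forall z \near y, good v z) ->
  exists2 v, V v & forall z, good v z.
Proof.
move=> [v0 Vv0] dir near_good; apply: contrapT => nV.
pose F : set_system T := filter_from V (fun v => [set z | ~ good v z]).
have FF : ProperFilter F.
  apply: filter_from_proper; last first.
    move=> v Vv; apply: contrapT => h; apply: nV; exists v => // z.
    by apply: contrapT => nz; apply: h; exists z.
  apply: filter_from_filter; first by exists v0.
  move=> v w Vv Vw; have [u Vu uP] := dir v w Vv Vw; exists u => // z /= nu.
  by split => h; apply: nu; apply: uP; [left|right].
have [p [_ Fp]] := cT FF filterT.
have [v Vv vp] := near_good p.
have [z [/= nz gz]] : [set z | ~ good v z] `&` [set z | good v z] !=set0.
  by apply: Fp => //; exists v.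
exact: nz.
Qed.

Lemma lattice_approximation (V : set (T -> R)) (q : T -> R) (e : R) :
  [set: T] !=set0 ->
  (forall v, V v -> continuous v) -> continuous q ->
  (forall v w, V v -> V w -> V (fun z => Num.max (v z) (w z))) ->
  (forall v w, V v -> V w -> V (fun z => Num.min (v z) (w z))) ->
  (forall x y, exists2 v, V v & v x = q x /\ v y = q y) -> 0 < e ->
  exists2 v, V v & forall z, `|v z - q z| < e.
Proof.
move=> [x0 _] Vc qc Vmax Vmin interp e0.
have near_lt (f g : T -> R) x : continuous f -> continuous g -> f x < g x ->
    \forall z \near x, f z < g z.
  move=> fc gc fg; have : \forall z \near x, 0 < g z - f z.
    apply: (@cvgr_gt _ _ _ _ (fun z => g z - f z) (g x - f x)); last by rewrite subr_gt0.
    by apply: cvgB; [exact: gc|exact: fc].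
  by apply: filterS => z; rewrite subr_gt0.
have qec (c : R) : continuous (fun z => q z + c).
  by move=> z; apply: cvgD; [exact: qc|exact: cvg_cst].
(* With [x] fixed, maxima of functions interpolating [q] at [x] and [y] rise above q - e everywhere
   while keeping the value of [q] at [x]. Minima of the resulting functions over varying [x] then
   fall below q + e. *)
have low x : exists2 v, V v /\ v x = q x & forall z, q z - e < v z.
  apply: (@compact_directed _ [set v | V v /\ v x = q x]
    (fun v z => q z - e < v z)).
  - by have [v Vv [vx _]] := interp x x; exists v.
  - move=> v w [Vv vx] [Vw wx]; exists (fun z => Num.max (v z) (w z)).
      by split; [exact: Vmax|rewrite vx wx maxxx].
    by move=> z; rewrite lt_max => -[->|->]; rewrite ?orbT.
  - move=> y; have [v Vv [vx vy]] := interp x y; exists v => //.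
    by apply: near_lt; [exact: qec|exact: Vc|rewrite vy ltrBlDr ltrDl].
have [v [Vv vlow] vup] : exists2 v, V v /\ (forall z, q z - e < v z) &
    forall z, v z < q z + e.
  apply: (@compact_directed _ [set v | V v /\ (forall z, q z - e < v z)]
    (fun v z => v z < q z + e)).
  - by have [v [Vv _] vq] := low x0; exists v.
  - move=> v w [Vv vx] [Vw wx]; exists (fun z => Num.min (v z) (w z)).
      by split; [exact: Vmin|move=> z; rewrite lt_min vx wx].
    by move=> z; rewrite gt_min => -[->|->]; rewrite ?orbT.
  - move=> y; have [v [Vv vy] vq] := low y; exists v => //.
    by apply: near_lt; [exact: Vc|exact: qec|rewrite vy ltrDl].
exists v => // z; rewrite ltr_norml ltrBrDr addrC vlow /=.
by rewrite ltrBlDr addrC vup.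
Qed.

End LatticeStoneWeierstrass.

(** * The conformal functional of exponent 1 *)

Section ConformalFunctional.
Context {R : realType} {G : groupType} {mu : G -> R}.
Variable M : martin_compactification mu.
Notation X := (martin_boundary M).

(* A positive unital functional [nu], read as a measure, for which translation
   by [g] has Radon-Nikodym derivative [bkernel g `^ beta]. *)
Record conformal (beta : R) (nu : (X -> R) -> R) : Prop := Conformal {
  conformal_linear : forall c p q, bounded_fun_on p -> bounded_fun_on q ->
    nu (fun x => c * p x + q x) = c * nu p + nu q;
  conformal_ge0 : forall q, bounded_fun_on q -> (forall x, 0 <= q x) -> 0 <= nu q;
  conformal_one : nu (fun=> 1) = 1;
  conformal_act : forall g (q : X -> R), continuous q ->
    nu (fun xi => q (bact g^-1%g xi) * bkernel g xi `^ beta) = nu q }.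

End ConformalFunctional.

Section BoundedFunctions.
Context {R : realType} {T : Type}.
Implicit Types f g : T -> R.

Lemma bounded_fun_onD f g : bounded_fun_on f -> bounded_fun_on g ->
  bounded_fun_on (fun x => f x + g x).
Proof.
move=> [a fa] [b gb]; exists (a + b) => x.
by apply: le_trans (ler_normD _ _) _; exact: lerD.
Qed.

Lemma bounded_fun_onM f g : bounded_fun_on f -> bounded_fun_on g ->
  bounded_fun_on (fun x => f x * g x).
Proof.
move=> [a fa] [b gb]; exists (a * b) => x.
by rewrite normrM ler_pM.
Qed.

Lemma bounded_fun_on_cst (c : R) : bounded_fun_on (fun _ : T => c).
Proof. by exists `|c|. Qed.

Lemma bounded_fun_onZ c f : bounded_fun_on f -> bounded_fun_on (fun x => c * f x).
Proof. by move=> bf; apply: bounded_fun_onM => //; exact: bounded_fun_on_cst. Qed.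

Lemma bounded_fun_onB f g : bounded_fun_on f -> bounded_fun_on g ->
  bounded_fun_on (fun x => f x - g x).
Proof.
move=> [a fa] [b gb]; exists (a + b) => x.
by apply: le_trans (ler_normB _ _) _; exact: lerD.
Qed.

Lemma bounded_fun_on_min f g : bounded_fun_on f -> bounded_fun_on g ->
  bounded_fun_on (fun x => Num.min (f x) (g x)).
Proof.
move=> [a fa] [b gb]; exists (Num.max a b) => x.
by case: (leP (f x) (g x)) => _; rewrite le_max ?fa ?gb ?orbT.
Qed.

Lemma bounded_fun_on_comp (U : Type) (h : U -> T) f : bounded_fun_on f ->
  bounded_fun_on (fun x => f (h x)).
Proof. by move=> [c fc]; exists c. Qed.

Lemma bounded_fun_on_itv f a b : (forall x, a <= f x <= b) -> bounded_fun_on f.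
Proof.
move=> h; exists (`|a| + `|b|) => x; have /andP[h1 h2] := h x.
have := ler_norm (- a); have := ler_norm b; rewrite normrN.
have := normr_ge0 a; have := normr_ge0 b => ? ? ? ?.
by rewrite ler_norml; apply/andP; split; lra.
Qed.

End BoundedFunctions.

Section PositiveFunctional.
Context {R : realType} {T : Type}.
Implicit Types F H : T -> R.
Variable L : (T -> R) -> R.
Hypothesis L_linear : forall c F H, bounded_fun_on F -> bounded_fun_on H ->
  L (fun h => c * F h + H h) = c * L F + L H.
Hypothesis L_ge0 : forall F, bounded_fun_on F -> (forall h, 0 <= F h) -> 0 <= L F.

Lemma functional0 : L (fun=> 0) = 0.
Proof.
have b0 := @bounded_fun_on_cst R T 0; have := L_linear (-1) b0 b0.
have -> : (fun _ : T => -1 * 0 + 0 : R) = fun=> 0.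
  by apply/funext => h; rewrite mulr0 addr0.
by move=> E; lra.
Qed.

Lemma functionalD F H : bounded_fun_on F -> bounded_fun_on H ->
  L (fun h => F h + H h) = L F + L H.
Proof.
by move=> bF bH; rewrite -[L F]mul1r -L_linear//; congr L; apply/funext => h; rewrite mul1r.
Qed.

Lemma functionalZ c F : bounded_fun_on F -> L (fun h => c * F h) = c * L F.
Proof.
move=> bF; have := L_linear c bF (bounded_fun_on_cst 0); rewrite functional0 addr0 => <-.
by congr L; apply/funext => h; rewrite addr0.
Qed.

Lemma functionalB F H : bounded_fun_on F -> bounded_fun_on H ->
  L (fun h => F h - H h) = L F - L H.
Proof.
move=> bF bH; rewrite -[- L H]mulN1r addrC -L_linear//.
by congr L; apply/funext => h; rewrite mulN1r addrC.
Qed.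

Lemma functional_abs_le F e : L (fun=> 1) = 1 -> (forall h, `|F h| <= e) ->
  `|L F| <= e.
Proof.
move=> L1 Fe; have bF : bounded_fun_on F by exists e.
have bc c := @bounded_fun_on_cst R T c.
have Lc c : L (fun=> c) = c.
  rewrite -[RHS]mulr1 -L1 -functionalZ//; congr L.
  by apply/funext => h; rewrite mulr1.
have L_le F1 F2 : bounded_fun_on F1 -> bounded_fun_on F2 ->
    (forall h, F1 h <= F2 h) -> L F1 <= L F2.
  move=> b1 b2 F12; rewrite -subr_ge0 -functionalB//.
  by apply: L_ge0 => [|h]; [exact: bounded_fun_onB|rewrite subr_ge0].
rewrite ler_norml -{1}(Lc (- e)) -{2}(Lc e).
by apply/andP; split; apply: L_le => // h; have := Fe h; rewrite ler_norml => /andP[].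
Qed.

End PositiveFunctional.

(** * Averages over the cutoff charges *)

Section BoundaryAverage.
Context {R : realType} {G : groupType}.
Variable mu : G -> R.
Hypothesis walk : random_walk mu.
Hypothesis trans : transient mu.
Notation green := (green mu).
Notation lp := (left_potential mu).

Let green_gt0 x y : 0 < green x y := green_gt0 walk trans x y.

(** As green x h = K x h * green 1 h, the function [cutoff n] is the mixture of the kernels K(., h)
    with these weights. In the limit they represent the constant function 1 by kernels, as a
    harmonic measure does. *)
Let weight n h : R := green 1%g h * cutoff_charge walk trans n h.

Let weight_ge0 n h : 0 <= weight n h.
Proof. by rewrite mulr_ge0 ?cutoff_charge_ge0// ltW. Qed.

Let weight_sum n : (\esum_(h in [set: G]) (weight n h)%:E = (cutoff mu n 1%g)%:E)%E.
Proof. by rewrite (cutoff_chargeE walk trans); apply: eq_esum => h _; rewrite EFinM. Qed.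

Let weight_summable n F : bounded_fun_on F ->
  abs_summable (fun h => weight n h * F h).
Proof.
move=> [c Fc].
apply: (@le_abs_summable _ _ _ (fun h => `|c| * weight n h)) => [h|].
  rewrite !normrM normr_id mulrC ler_wpM2r//.
  by apply: le_trans (Fc h) _; exact: ler_norm.
apply: abs_summableZ; rewrite /abs_summable.
under eq_esum do rewrite ger0_norm//.
by rewrite weight_sum ltry.
Qed.

Let average n F := rsum (fun h => weight n h * F h).

Let average_bounded F : bounded_fun_on F -> bounded_fun_on (average^~ F).
Proof.
move=> [c Fc]; have bF : bounded_fun_on F by exists c.
have s1 n : abs_summable (fun h => weight n h * 1).
  by apply: weight_summable; exact: bounded_fun_on_cst.
have I1 n : rsum (fun h => weight n h * 1) <= 1.
  rewrite rsum_ge0E//; last by move=> h; rewrite mulr1.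
  under eq_esum do rewrite mulr1.
  by rewrite weight_sum /= cutoff_le1.
exists `|c| => n; rewrite ler_norml; apply/andP; split.
  rewrite lerNl -rsumN; apply: (@le_trans _ _ (`|c| * rsum (fun h => weight n h * 1))).
    rewrite -rsumZ//; apply: ler_rsum => [||h].
    - exact/abs_summableN/weight_summable.
    - exact: abs_summableZ.
    - rewrite mulr1 -mulrN mulrC ler_wpM2r//.
      by apply: le_trans (ler_norm _) _; rewrite normrN (le_trans (Fc h))// ler_norm.
  by rewrite ler_piMr.
apply: (@le_trans _ _ (`|c| * rsum (fun h => weight n h * 1))).
  rewrite -rsumZ//; apply: ler_rsum => [||h].
  - exact: weight_summable.
  - exact: abs_summableZ.
  - rewrite mulr1 mulrC ler_wpM2r//.
    by apply: le_trans (ler_norm _) _; rewrite (le_trans (Fc h))// ler_norm.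
by rewrite ler_piMr.
Qed.

(* On the left potential [rho G] divided by [green 1] the averages converge to
   the total mass of [rho], whatever the cutoff; this is what makes the limit
   equivariant. *)
Lemma boundary_average : exists L : (G -> R) -> R,
  [/\ forall c F H, bounded_fun_on F -> bounded_fun_on H ->
        L (fun h => c * F h + H h) = c * L F + L H,
      forall F, bounded_fun_on F -> (forall h, 0 <= F h) -> 0 <= L F &
      forall F r, bounded_fun_on F -> lp (fun h => F h * green 1%g h) r ->
        L F = r].
Proof.
have [lim_ [limD lim0 limE]] := @generalized_limit R.
exists (fun F => lim_ (average^~ F)); split.
- move=> c F H bF bH; rewrite -limD; try exact: average_bounded.
  congr lim_; apply/funext => n; rewrite /average -rsumZ; last exact: weight_summable.
  rewrite -rsumD.
  + by congr rsum; apply/funext => h; ring.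
  + by apply: abs_summableZ; exact: weight_summable.
  + exact: weight_summable.
- move=> F bF F0; apply: lim0 => [|n]; first exact: average_bounded.
  by apply: rsum_ge0 => h; rewrite mulr_ge0.
- move=> F r bF wr; apply: limE.
  have F0 h : 0 <= F h.
    by have := left_potential_ge0 walk trans h wr; rewrite pmulr_lge0.
  have aE n : (average n F)%:E = (\esum_(y in [set: G])
      (F y * green 1%g y * cutoff_charge walk trans n y)%:E)%E.
    rewrite /average rsum_ge0E; last 2 first.
    + by move=> h; rewrite mulr_ge0.
    + exact: weight_summable.
    rewrite fineK.
      by apply: eq_esum => h _; rewrite /weight; congr EFin; ring.
    apply: esum_fin_num; last exact: weight_summable.
    by move=> h; rewrite mulr_ge0.
  apply/cvgrPdist_le => e e0; have [N hN] := left_potential_pairing_ge walk trans wr e0.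
  exists N => // n /= Nn; rewrite ler_norml; apply/andP; split.
    have := left_potential_pairing_le walk trans n wr; rewrite -aE lee_fin; lra.
  have := hN n Nn; rewrite -aE lee_fin; lra.
Qed.

End BoundaryAverage.

Section MinMaxLimits.
Context {R : realType} {T : Type} {F : set_system T} {FF : Filter F}.
Implicit Types f g : T -> R.

Lemma cvg_maxr f g (a b : R) : f @ F --> a -> g @ F --> b ->
  (fun x => Num.max (f x) (g x)) @ F --> Num.max a b.
Proof.
move=> fa gb; rewrite maxr_absE; under eq_fun do rewrite maxr_absE.
by apply: cvgMl; apply: cvgD; [exact: cvgD|apply: cvg_norm; exact: cvgB].
Qed.

Lemma cvg_minr f g (a b : R) : f @ F --> a -> g @ F --> b ->
  (fun x => Num.min (f x) (g x)) @ F --> Num.min a b.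
Proof.
move=> fa gb; rewrite minr_absE; under eq_fun do rewrite minr_absE.
by apply: cvgMl; apply: cvgB; [exact: cvgD|apply: cvg_norm; exact: cvgB].
Qed.

End MinMaxLimits.

(** * Conformality of the limit functional *)

Section Conformal1.
Context {R : realType} {G : groupType}.
Variable mu : G -> R.
Hypothesis walk : random_walk mu.
Hypothesis trans : transient mu.
Variables (S : seq G) (d : G -> G -> nat) (C : R).
Hypothesis d_word : word_metric S d.
Hypothesis C_gt0 : 0 < C.
Hypothesis harnack : forall x y z, green mu x z / green mu y z <= C ^+ d x y.
Variable M : martin_compactification mu.
Notation X := (martin_boundary M).
Notation K := (@mkernel _ _ _ M).
Notation emb := (@memb _ _ _ M).
Notation green := (green mu).
Notation lp := (left_potential mu).

Let green_gt0 x y : 0 < green x y := green_gt0 walk trans x y.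

Variable L : (G -> R) -> R.
Hypothesis L_linear : forall c F H, bounded_fun_on F -> bounded_fun_on H ->
        L (fun h => c * F h + H h) = c * L F + L H.
Hypothesis L_ge0 : forall F, bounded_fun_on F -> (forall h, 0 <= F h) -> 0 <= L F.
Hypothesis L_potential : forall F r, bounded_fun_on F ->
  lp (fun h => F h * green 1%g h) r -> L F = r.

Let bK g : bounded_fun_on (fun h => K g (emb h)).
Proof.
apply: (@bounded_fun_on_itv _ _ _ 0 (C ^+ d g 1%g)) => h; apply/andP; split.
- by rewrite ltW// (mkernel_gt0 walk trans C_gt0 harnack).
- exact: mkernel_le.
Qed.

Let L_kernel g : L (fun h => K g (emb h)) = 1.
Proof.
apply: L_potential => //; under eq_fun do rewrite (mkernel_green walk trans).
exact: left_potential_green.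
Qed.

Let L_one : L (fun=> 1) = 1.
Proof.
rewrite -(L_kernel 1%g); congr L; apply/funext => h.
by rewrite (mkernel1 walk trans).
Qed.

Let L_D := functionalD L_linear.
Let L_0 := functional0 L_linear.
Let L_Z := functionalZ L_linear.
Let L_B := functionalB L_linear.

Let delta_bounded (y : G) : bounded_fun_on (fun h => (y == h)%:R : R).
Proof.
by exists 1 => h; case: (y == h); rewrite ?normr0 ?normr1.
Qed.

(* [green y] and [green y - delta_y] are potentials of the same mass. *)
Let L_delta (y : G) : L (fun h => (y == h)%:R) = 0.
Proof.
pose F h := (green y h - (y == h)%:R) / green 1%g h.
have FE h : F h = K y (emb h) + (- (green 1%g y)^-1) * (y == h)%:R.
  rewrite /F mkernelE mulrBl; congr (_ + _).
  by have [<-|] := eqVneq y h; rewrite ?mulr1 ?mulr0 ?mul1r ?mul0r ?oppr0.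
have bF : bounded_fun_on F.
  have -> : F = (fun h => K y (emb h) + (- (green 1%g y)^-1) * (y == h)%:R).
    exact/funext.
  by apply: bounded_fun_onD => //; exact: bounded_fun_onZ.
have : L F = 1.
  apply: L_potential => //; under eq_fun do rewrite /F divfK ?gt_eqF//.
  exact: left_potential_green_step.
have -> : F = (fun h => K y (emb h) + (- (green 1%g y)^-1) * (y == h)%:R).
  exact/funext.
rewrite L_D//; last exact: bounded_fun_onZ.
rewrite L_kernel L_Z// => /eqP; rewrite -subr_eq0 addrAC subrr add0r.
by rewrite mulf_eq0 oppr_eq0 invr_eq0 gt_eqF//= => /eqP.
Qed.

Let L_finite_support (s : seq G) F : bounded_fun_on F ->
  (forall h, h \notin s -> F h = 0) -> L F = 0.
Proof.
elim: s F => [|y s ih] F bF Fs.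
  by rewrite -L_0; congr L; apply/funext => h; exact: Fs.
have bFy : bounded_fun_on (fun h => F h - F y * (y == h)%:R).
  by apply: bounded_fun_onB => //; exact: bounded_fun_onZ.
have := ih _ bFy; rewrite L_B//; last exact: bounded_fun_onZ.
rewrite L_Z// L_delta mulr0 subr0; apply => h hs.
have [<-|yh] := eqVneq y h; first by rewrite mulr1 subrr.
by rewrite mulr0 subr0 Fs// inE negb_or hs eq_sym yh.
Qed.

(** Finite sets carry no mass, so [L] is controlled by the behaviour of functions near the boundary
    only. With [boundary_cofinite] this turns boundary limits into estimates of [L]. *)
Let L_cofinite_le (s : seq G) F H e : bounded_fun_on F -> bounded_fun_on H ->
  (forall h, h \notin s -> `|F h - H h| <= e) -> 0 <= e -> `|L F - L H| <= e.
Proof.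
move=> bF bH FH e0.
pose D h := (h \in s)%:R * (F h - H h).
pose E h := F h - H h - D h.
have bD : bounded_fun_on D.
  apply: bounded_fun_onM; last exact: bounded_fun_onB.
  by exists 1 => h; case: (h \in s); rewrite ?normr0 ?normr1.
have bFH := bounded_fun_onB bF bH.
have bE : bounded_fun_on E by exact: bounded_fun_onB.
have Ee h : `|E h| <= e.
  rewrite /E /D; have [hs|hs] := boolP (h \in s).
    by rewrite mul1r subrr normr0.
  by rewrite mul0r subr0 FH.
have -> : L F - L H = L E.
  rewrite -L_B// /E [RHS]L_B// (@L_finite_support s D)// ?subr0//.
  by move=> h /negPf hs; rewrite /D hs mul0r.
exact: (functional_abs_le L_linear L_ge0 L_one Ee).
Qed.

(** An empty boundary would make every property hold off a finite set, so the group would be finite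
    and [L] would vanish on 1. *)
Let boundary_nonempty : exists xi : X, True.
Proof.
apply: contrapT => nX.
have [|s hs] := @boundary_cofinite _ _ _ M (fun=> False).
  by move=> xi; exfalso; apply: nX; exists xi.
have : L (fun=> 1) = 0.
  apply: (@L_finite_support s); first exact: bounded_fun_on_cst.
  by move=> h /hs.
by rewrite L_one => /eqP; rewrite oner_eq0.
Qed.

Definition potential_difference (F : G -> R) := exists f1 f2 r1 r2,
  [/\ bounded_fun_on f1 /\ bounded_fun_on f2,
      lp (fun h => f1 h * green 1%g h) r1, lp (fun h => f2 h * green 1%g h) r2 &
      F = fun h => f1 h - f2 h].

(** The identity max(a - b, c - e) = (a + c) - min(a + e, c + b) reduces maxima to sums and minima
    of potentials, and both stay in the class. *)
Lemma potential_difference_max F H : potential_difference F ->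
  potential_difference H ->
  potential_difference (fun h => Num.max (F h) (H h)).
Proof.
move=> [a [b [r1 [r2 [[ba bb] la lb ->]]]]] [c [e [r3 [r4 [[bc be] lc le ->]]]]].
have lae := left_potentialD walk trans la le.
have lcb := left_potentialD walk trans lc lb.
have [r lm] := left_potential_min walk trans lae lcb.
exists (fun h => a h + c h), (fun h => Num.min (a h + e h) (c h + b h)).
exists (r1 + r3), r; split.
- split; first exact: bounded_fun_onD.
  by apply: bounded_fun_on_min; exact: bounded_fun_onD.
- under eq_fun do rewrite mulrDl; exact: left_potentialD.
- under eq_fun do rewrite minr_pMl 1?ltW// !mulrDl; exact: lm.
- apply/funext => h; case: (leP (a h + e h) (c h + b h)) => h1.
  + by rewrite (elimT max_idPr); lra.
  + by rewrite (elimT max_idPl); lra.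
Qed.

Lemma potential_differenceN F : potential_difference F ->
  potential_difference (fun h => - F h).
Proof.
move=> [a [b [r1 [r2 [[ba bb] la lb ->]]]]]; exists b, a, r2, r1; split=> //.
by apply/funext => h; rewrite opprB.
Qed.

Lemma potential_difference_min F H : potential_difference F ->
  potential_difference H ->
  potential_difference (fun h => Num.min (F h) (H h)).
Proof.
move=> /potential_differenceN pF /potential_differenceN pH.
have := potential_differenceN (potential_difference_max pF pH).
by under eq_fun do rewrite oppr_max !opprK.
Qed.

Lemma potential_difference_kernel g (a b : R) :
  potential_difference (fun h => a * K g (emb h) + b).
Proof.
have pot_a (c : R) x : 0 <= c ->
    lp (fun h => c * K x (emb h) * green 1%g h) (c * 1).
  move=> c0; under eq_fun do rewrite -mulrA (mkernel_green walk trans).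
  by apply: left_potentialZ => //; exact: left_potential_green.
have pn (c : R) : c = Num.max c 0 - Num.max (- c) 0.
  case: (leP c 0) => h; first by rewrite (elimT max_idPl) ?oppr_ge0//; lra.
  by rewrite (elimT max_idPr) ?oppr_le0 1?ltW//; lra.
have m0 (c : R) : 0 <= Num.max c 0 by rewrite le_max lexx orbT.
exists (fun h => Num.max a 0 * K g (emb h) + Num.max b 0 * K 1%g (emb h)).
exists (fun h => Num.max (- a) 0 * K g (emb h) + Num.max (- b) 0 * K 1%g (emb h)).
eexists; eexists; split.
- by split; apply: bounded_fun_onD; exact: bounded_fun_onZ.
- under eq_fun do rewrite mulrDl; apply: (left_potentialD walk trans);
    exact: pot_a.
- under eq_fun do rewrite mulrDl; apply: (left_potentialD walk trans);
    exact: pot_a.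
- apply/funext => h; rewrite (mkernel1 walk trans) {1}(pn a) {1}(pn b); ring.
Qed.

(** K g h * green 1 h = green g h = green 1 (g^-1 * h). Hence multiplying the weighted translate by
    [green 1] gives the translate of the original potential, and left translation preserves the mass
    of the charge. *)
Let L_translate g F : potential_difference F ->
  L (fun h => F (g^-1 * h)%g * K g (emb h)) = L F.
Proof.
move=> [f1 [f2 [r1 [r2 [[b1 b2] l1 l2 ->]]]]].
have tr f r : bounded_fun_on f -> lp (fun h => f h * green 1%g h) r ->
    L (fun h => f (g^-1 * h)%g * K g (emb h)) = r.
  move=> bf lf; apply: L_potential.
    by apply: bounded_fun_onM => //; exact: bounded_fun_on_comp.
  have := left_potential_translate g^-1%g lf; congr left_potential.
  apply/funext => h; rewrite -mulrA (mkernel_green walk trans).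
  by rewrite -(green_mull mu g 1%g) mulg1 mulVKg.
have bt f : bounded_fun_on f -> bounded_fun_on (fun h => f (g^-1 * h)%g * K g (emb h)).
  by move=> bf; apply: bounded_fun_onM => //; exact: bounded_fun_on_comp.
rewrite L_B// (L_potential b1 l1) (L_potential b2 l2).
under eq_fun do rewrite mulrBl.
by rewrite L_B ?(tr _ _ b1 l1) ?(tr _ _ b2 l2)//; exact: bt.
Qed.

(** The function [F] on the group is kept along with its boundary values because [L], and with it
    the equivariance, is available for [F] only. *)
Definition boundary_lattice : set (X -> R) :=
  [set v | continuous v /\ exists2 F, potential_difference F &
     forall xi : X, F @ boundary_nbhs xi --> v xi].

Lemma boundary_lattice_approx (q : X -> R) e : continuous q -> 0 < e ->
  exists2 v, boundary_lattice v & forall z, `|v z - q z| < e.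
Proof.
move=> qc e0; apply: lattice_approximation => //.
- exact: boundary_space_compact.
- by move=> v [].
- move=> v w [vc [F pF Fv]] [wc [H pH Hw]]; split.
    by move=> x; apply: (cvg_maxr (F := nbhs x)); [exact: vc|exact: wc].
  exists (fun h => Num.max (F h) (H h)); first exact: potential_difference_max.
  by move=> xi; apply: cvg_maxr; [exact: Fv|exact: Hw].
- move=> v w [vc [F pF Fv]] [wc [H pH Hw]]; split.
    by move=> x; apply: (cvg_minr (F := nbhs x)); [exact: vc|exact: wc].
  exists (fun h => Num.min (F h) (H h)); first exact: potential_difference_min.
  by move=> xi; apply: cvg_minr; [exact: Fv|exact: Hw].
- move=> x y.
  have lin g a b : boundary_lattice (fun z => a * bkernel g z + b).
    split.
      move=> z; apply: (@cvgD _ _ _ (nbhs z)); last exact: cvg_cst.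
      by apply: (@cvgMr _ _ (nbhs z)); exact: bkernel_continuous.
    exists (fun h => a * K g (emb h) + b); first exact: potential_difference_kernel.
    by move=> xi; apply: cvgD; [apply: cvgMr; exact: cvg_mkernel|exact: cvg_cst].
  have [->|xy] := eqVneq x y.
    by exists (fun z => 0 * bkernel 1%g z + q y); [exact: lin|rewrite mul0r add0r].
  have [g gxy] : exists g, bkernel g x != bkernel g y.
    apply: contrapT => ng; move/eqP: xy; apply; apply: val_inj.
    apply: mkernel_separates; [exact: (@set_valP _ X x)|exact: (@set_valP _ X y)|].
    by move=> g; apply/eqP; apply: contrapT => /negP h; apply: ng; exists g.
  have gxy' : bkernel g x - bkernel g y != 0 by rewrite subr_eq0.
  exists (fun z => (q x - q y) / (bkernel g x - bkernel g y) * bkernel g z +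
    (q y - (q x - q y) / (bkernel g x - bkernel g y) * bkernel g y)).
    exact: lin.
  split; last by ring.
  by rewrite addrCA -mulrBr divfK// addrCA subrr addr0.
Qed.

(** [nu] is [L] composed with the projection to the boundary. The projection need not commute with
    translations, so conformality is checked by replacing [q] near the boundary by a function [F] of
    the lattice, for which [L_translate] is exact. *)
Lemma conformal_functional1 : exists nu : (X -> R) -> R, conformal 1 nu.
Proof.
have [xi0 _] := boundary_nonempty.
pose proj := projection xi0.
have bproj (q : X -> R) : bounded_fun_on q -> bounded_fun_on (fun h => q (proj h)).
  exact: bounded_fun_on_comp.
exists (fun q => L (fun h => q (proj h))); split.
- by move=> c p q bp bq; rewrite -L_linear//; exact: bproj.
- by move=> q bq q0; apply: L_ge0 => //; exact: bproj.
- exact: L_one.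
move=> g q qc.
have bcont (v : X -> R) : continuous v -> bounded_fun_on v.
  move=> vc; have [||x0 _ vmax] := @compact_EVT_max _ _ v setT _ (@boundary_space_compact _ _ _ M).
  - by exists xi0.
  - exact: continuous_subspaceT.
  have [||x1 _ vmin] := @compact_EVT_min _ _ v setT _ (@boundary_space_compact _ _ _ M).
  - by exists xi0.
  - exact: continuous_subspaceT.
  apply: (@bounded_fun_on_itv _ _ _ (v x1) (v x0)) => x.
  by rewrite vmin ?vmax// inE.
have bq := bcont q qc.
pose A := L (fun h => q (bact g^-1%g (proj h)) * bkernel g (proj h) `^ 1).
rewrite -/A; apply/eqP; rewrite -subr_eq0 -normr_le0.
apply/ler_addgt0Pr => e e0; rewrite add0r.
pose c := C ^+ d g 1%g.
have c0 : 0 < c by rewrite exprn_gt0.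
(* The replacement costs 2 e' before translation and 2 c e' after it, where [c] bounds the kernel of
   [g]; together they make [e]. *)
pose e' := e / (2 * c + 2).
have e'0 : 0 < e' by rewrite divr_gt0// addr_gt0// mulr_gt0.
have [v [vc [F pF Fv]] vq] := boundary_lattice_approx qc e'0.
have Kg h : 0 < K g (emb h) <= c.
  by rewrite (mkernel_gt0 walk trans C_gt0 harnack) mkernel_le.
have bk0 (xi : X) : 0 <= bkernel g xi.
  by apply: ltW; exact: (bkernel_gt0 walk trans C_gt0 harnack).
have bkc (xi : X) : bkernel g xi <= c by exact: (mkernel_le harnack).
have bF : bounded_fun_on F.
  have [f1 [f2 [_ [_ [[b1 b2] _ _ ->]]]]] := pF; exact: bounded_fun_onB.
have bFt : bounded_fun_on (fun h => F (g^-1 * h)%g * K g (emb h)).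
  by apply: bounded_fun_onM => //; exact: bounded_fun_on_comp.
have bAt : bounded_fun_on (fun h => q (bact g^-1%g (proj h)) * bkernel g (proj h) `^ 1).
  apply: bounded_fun_onM; first exact: (@bounded_fun_on_comp _ _ _ (fun h => bact g^-1%g (proj h))).
  apply: (@bounded_fun_on_itv _ _ _ 0 c) => h.
  by rewrite powRr1 bk0//= bkc.
(* One e' is the uniform distance from [q] to [v], the other pays for being near rather than at the
   boundary; the finitely many remaining [h] do not count for [L]. *)
have step1 : `|L (fun h => q (proj h)) - L F| <= 2 * e'.
  have [|s hs] := @boundary_cofinite _ _ _ M (fun h => `|q (proj h) - F h| <= 2 * e').
    move=> xi.
    have qp : (fun h => q (proj h)) @ boundary_nbhs xi --> q xi.
      apply: (@cvg_comp _ _ _ proj q _ (nbhs xi)); last exact: qc.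
      exact: cvg_projection.
    have := (cvgrPdist_lt _ _).1 (cvgB qp (Fv xi)) _ e'0.
    move=> /(_ (boundary_nbhs_filter xi) (boundary_nbhs_filter xi)).
    apply: filterS => h; have := vq xi; rewrite !fctE.
    rewrite !ltr_norml ler_norml => /andP[? ?] /andP[? ?].
    by apply/andP; split; lra.
  by apply: (L_cofinite_le (s := s)) => //; [exact: bproj|rewrite mulr_ge0// ltW].
have step2 : `|A - L (fun h => F (g^-1 * h)%g * K g (emb h))| <= 2 * c * e'.
  have [|s hs] := @boundary_cofinite _ _ _ M (fun h =>
    `|q (bact g^-1%g (proj h)) * bkernel g (proj h) `^ 1 -
      F (g^-1 * h)%g * K g (emb h)| <= 2 * c * e').
    move=> xi.
    have projc := @cvg_projection _ _ _ M xi0 xi.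
    have q1 : (fun h => q (bact g^-1%g (proj h))) @ boundary_nbhs xi --> q (bact g^-1%g xi).
      apply: (@cvg_comp _ _ _ proj (fun z => q (bact g^-1%g z)) _ (nbhs xi)) => //.
      apply: (@cvg_comp _ _ _ (bact g^-1%g) q _ (nbhs (bact g^-1%g xi))).
        exact: bact_continuous.
      exact: qc.
    have k1 : (fun h => bkernel g (proj h)) @ boundary_nbhs xi --> bkernel g xi.
      apply: (@cvg_comp _ _ _ proj (bkernel g) _ (nbhs xi)) => //.
      exact: bkernel_continuous.
    have F1 : (fun h => F (g^-1 * h)%g) @ boundary_nbhs xi --> v (bact g^-1%g xi).
      exact: cvg_mull.
    have ce : 0 < c * e' by rewrite mulr_gt0.
    have := (cvgrPdist_lt _ _).1
      (cvgB (cvgM q1 k1) (cvgM F1 (@cvg_mkernel _ _ _ M g xi))) _ ce.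
    have FF := boundary_nbhs_filter xi; move=> /(_ FF FF)/(_ FF FF).
    apply: filterS => h; rewrite !fctE /= powRr1 ?bk0//.
    rewrite -mulrBl => h1.
    have h2 : `|(q (bact g^-1%g xi) - v (bact g^-1%g xi)) * bkernel g xi| <= c * e'.
      rewrite normrM mulrC; apply: ler_pM => //; first by rewrite ger0_norm.
      by rewrite distrC ltW.
    move: h1 h2; rewrite !ltr_norml !ler_norml => /andP[? ?] /andP[? ?].
    by apply/andP; split; lra.
  have c20 : 0 <= 2 * c * e'.
    by apply: ltW; apply: mulr_gt0 => //; apply: mulr_gt0.
  exact: (L_cofinite_le bAt bFt hs c20).
rewrite (L_translate g pF) in step2.
have -> : A - L (fun h => q (proj h)) = (A - L F) - (L (fun h => q (proj h)) - L F) by ring.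
apply: le_trans (ler_normB _ _) _; apply: le_trans (lerD step2 step1) _.
rewrite le_eqVlt; apply/orP; left; apply/eqP.
rewrite /e' -mulrDl mulrC divfK//.
by rewrite gt_eqF// addr_gt0// mulr_gt0.
Qed.

End Conformal1.

(** * The Hilbert space of square summable families *)

Section Ell2Space.
Local Open Scope complex_scope.
Context {R : realType} {I : choiceType}.
Implicit Types v w : ell2 R I.
Local Notation N := (@ell2_norm R I).
Local Notation C := R[i].

Lemma ell2P v w : (forall i, v i = w i) -> v = w.
Proof. by move=> vw; apply: val_inj; apply/funext. Qed.

Lemma ell2_funD v w : ell2_fun (v + w) = ell2_fun v + ell2_fun w.
Proof. by []. Qed.

Lemma ell2_funN v : ell2_fun (- v) = - ell2_fun v.
Proof. by []. Qed.

Lemma ell2_funZ (c : C) v : ell2_fun (c *: v) = c *: ell2_fun v.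
Proof. by []. Qed.

Lemma ell2_fun0 : ell2_fun (0 : ell2 R I) = 0.
Proof. by []. Qed.

Lemma ell2D v w i : (v + w) i = v i + w i.
Proof. by rewrite ell2_funD. Qed.

Lemma ell2N v i : (- v) i = - v i.
Proof. by rewrite ell2_funN. Qed.

Lemma ell2B v w i : (v - w) i = v i - w i.
Proof. by rewrite ell2D ell2N. Qed.

Lemma ell2Z (c : C) v i : (c *: v) i = c * v i.
Proof. by rewrite ell2_funZ. Qed.

Lemma ell20 i : (0 : ell2 R I) i = 0.
Proof. by rewrite ell2_fun0. Qed.

Lemma sqmod_ge0 (z : C) : 0 <= sqmod z.
Proof. by rewrite addr_ge0 ?sqr_ge0. Qed.

Lemma sqmodM (y z : C) : sqmod (y * z) = sqmod y * sqmod z.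
Proof. by case: y z => a b [x y]; rewrite /sqmod /=; ring. Qed.

Lemma ell2_summable v : abs_summable (fun i => sqmod (v i)).
Proof.
have : ell2_fun v \in sqsummable by exact: (valP v).
rewrite /in_mem /= /sqsummable /sqnorm /abs_summable.
by under [in X in _ -> X]eq_esum do rewrite ger0_norm ?sqmod_ge0//.
Qed.

Definition rdot_term v w i : R :=
  complex.Re (v i) * complex.Re (w i) + complex.Im (v i) * complex.Im (w i).

(** The real part of the inner product. The imaginary part is the same form with [w] multiplied by i
    ([ell2_dotE]), so norms and adjoints can be handled over the reals. *)
Definition rdot v w : R := rsum (rdot_term v w).

Lemma rdot_summable v w : abs_summable (rdot_term v w).
Proof.
apply: (@le_abs_summable _ _ _ (fun i => sqmod (v i) + sqmod (w i))) => [i|].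
  rewrite /= [leRHS]ger0_norm; last by rewrite addr_ge0 ?sqmod_ge0.
  rewrite ler_norml /rdot_term /sqmod.
  case: (v i) (w i) => a b [x y] /=; apply/andP; split.
    have := sqr_ge0 (a + x); have := sqr_ge0 (b + y); have := sqr_ge0 (a - x).
    have := sqr_ge0 (b - y); nra.
  have := sqr_ge0 (a + x); have := sqr_ge0 (b + y); have := sqr_ge0 (a - x).
  have := sqr_ge0 (b - y); nra.
by apply: abs_summableD; exact: ell2_summable.
Qed.

Lemma rdotC v w : rdot v w = rdot w v.
Proof.
congr rsum; apply/funext => i; rewrite /rdot_term.
by rewrite [X in X + _]mulrC [X in _ + X]mulrC.
Qed.

Lemma rdotDl v1 v2 w : rdot (v1 + v2) w = rdot v1 w + rdot v2 w.
Proof.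
rewrite /rdot -rsumD; try exact: rdot_summable.
congr rsum; apply/funext => i; rewrite /rdot_term ell2D.
by case: (v1 i) (v2 i) (w i) => a b [c d] [x y] /=; ring.
Qed.

Lemma rdotZl (c : R) v w : rdot (c%:C *: v) w = c * rdot v w.
Proof.
rewrite /rdot -rsumZ; last exact: rdot_summable.
congr rsum; apply/funext => i; rewrite /rdot_term ell2Z.
by case: (v i) (w i) => a b [x y] /=; ring.
Qed.

Lemma rdotNl v w : rdot (- v) w = - rdot v w.
Proof.
rewrite /rdot -rsumN; congr rsum; apply/funext => i; rewrite /rdot_term ell2N.
by case: (v i) (w i) => a b [x y] /=; ring.
Qed.

Lemma rdotBl v1 v2 w : rdot (v1 - v2) w = rdot v1 w - rdot v2 w.
Proof. by rewrite rdotDl rdotNl. Qed.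

Lemma rdotDr v w1 w2 : rdot v (w1 + w2) = rdot v w1 + rdot v w2.
Proof. by rewrite rdotC rdotDl !(rdotC v). Qed.

Lemma rdotBr v w1 w2 : rdot v (w1 - w2) = rdot v w1 - rdot v w2.
Proof. by rewrite rdotC rdotBl !(rdotC v). Qed.

Lemma rdotZr (c : R) v w : rdot v (c%:C *: w) = c * rdot v w.
Proof. by rewrite rdotC rdotZl rdotC. Qed.

Lemma ell2_dotE v w : ell2_dot v w = rdot v w +i* rdot v ('i *: w).
Proof.
rewrite /ell2_dot /csum /rdot; congr (_ +i* _); congr rsum; apply/funext => i.
  by rewrite /rdot_term; case: (v i) (w i) => a b [x y] /=; ring.
by rewrite /rdot_term ell2Z; case: (v i) (w i) => a b [x y] /=; ring.
Qed.

Lemma ell2_norm_ge0 v : 0 <= N v. Proof. exact: sqrtr_ge0. Qed.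

Lemma rdot_norm v : rdot v v = N v ^+ 2.
Proof.
have E : rdot v v = fine (sqnorm v).
  rewrite /rdot (_ : rdot_term v v = (fun i => sqmod (v i))); last first.
    by apply/funext => i; rewrite /rdot_term /sqmod !expr2.
  rewrite rsum_ge0E//; [by move=> i; exact: sqmod_ge0|exact: ell2_summable].
rewrite E sqr_sqrtr// -E; apply: rsum_ge0 => i.
by rewrite /rdot_term -!expr2 addr_ge0 ?sqr_ge0.
Qed.

Lemma rdot_ge0 v : 0 <= rdot v v. Proof. by rewrite rdot_norm sqr_ge0. Qed.

Lemma ell2_cauchy_schwarz v w : rdot v w <= N v * N w.
Proof.
have [w0|w0] := eqVneq (N w) 0.
  have h (t : R) : 0 <= N v ^+ 2 - 2 * t * rdot v w.
    have := rdot_ge0 (v - t%:C *: w).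
    rewrite rdotBl !rdotBr !rdotZl !rdotZr !rdot_norm w0 (rdotC w v); nra.
  rewrite w0 mulr0 leNgt; apply/negP => p.
  have := h ((N v ^+ 2 + 1) / rdot v w).
  rewrite -mulrA divfK ?gt_eqF//; have := sqr_ge0 (N v); nra.
have wp : 0 < N w by rewrite lt_def w0 ell2_norm_ge0.
have := rdot_ge0 ((N w)%:C *: v - (N v)%:C *: w).
rewrite rdotBl !rdotBr !rdotZl !rdotZr !rdot_norm (rdotC w v).
have [v0 _|v0] := eqVneq (N v) 0.
  rewrite v0 mul0r.
  have h (t : R) : 0 <= N w ^+ 2 - 2 * t * rdot v w.
    have := rdot_ge0 (w - t%:C *: v).
    rewrite rdotBl !rdotBr !rdotZl !rdotZr !rdot_norm v0 (rdotC w v); nra.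
  rewrite leNgt; apply/negP => p.
  have := h ((N w ^+ 2 + 1) / rdot v w).
  rewrite -mulrA divfK ?gt_eqF//; have := sqr_ge0 (N w); nra.
have vp : 0 < N v by rewrite lt_def v0 ell2_norm_ge0.
have vwp : 0 < N v * N w by rewrite mulr_gt0.
set x := rdot v w; set a := N v in vp vwp *; set b := N w in wp vwp *.
move=> h; rewrite -subr_ge0 -(pmulr_rge0 _ vwp); nra.
Qed.

Lemma ell2_normD v w : N (v + w) <= N v + N w.
Proof.
have s0 : 0 <= N v + N w by rewrite addr_ge0 ?ell2_norm_ge0.
rewrite -(@ler_pXn2r _ 2)// ?nnegrE ?ell2_norm_ge0// -rdot_norm.
rewrite rdotDl !rdotDr !rdot_norm (rdotC w v).
have := ell2_cauchy_schwarz v w; nra.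
Qed.

Lemma ell2_normZ (c : C) v : N (c *: v) = Num.sqrt (sqmod c) * N v.
Proof.
apply/eqP; rewrite -(@eqrXn2 _ 2)// ?mulr_ge0 ?ell2_norm_ge0 ?sqrtr_ge0//.
rewrite exprMn (sqr_sqrtr (sqmod_ge0 c)) -!rdot_norm /rdot -rsumZ; last first.
  exact: rdot_summable.
apply/eqP; congr rsum; apply/funext => i; rewrite /rdot_term ell2Z.
by case: c (v i) => a b [x y]; rewrite /sqmod /=; ring.
Qed.

Lemma ell2_normN v : N (- v) = N v.
Proof.
rewrite -scaleN1r ell2_normZ (_ : sqmod (-1) = 1) ?sqrtr1 ?mul1r//.
by rewrite /sqmod /= oppr0 expr0n addr0 sqrrN expr1n.
Qed.

Lemma ell2_normB v w : N (v - w) <= N v + N w.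
Proof. by rewrite (le_trans (ell2_normD _ _))// ell2_normN. Qed.

Lemma ell2_norm0 : N 0 = 0.
Proof. by rewrite -(scale0r 0) ell2_normZ /sqmod /= expr0n addr0 sqrtr0 mul0r. Qed.

Lemma sqmod_le_norm v i : sqmod (v i) <= N v ^+ 2.
Proof.
rewrite -rdot_norm /rdot.
rewrite (_ : rdot_term v v = (fun i => sqmod (v i))); last first.
  by apply/funext => j; rewrite /rdot_term /sqmod !expr2.
rewrite rsum_ge0E; [|by move=> j; exact: sqmod_ge0|exact: ell2_summable].
rewrite -lee_fin fineK; last first.
  by apply: esum_fin_num; [move=> j; exact: sqmod_ge0|exact: ell2_summable].
by apply: (@esum_ub_term _ _ (fun j => (sqmod (v j))%:E)) => j; rewrite lee_fin sqmod_ge0.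
Qed.

Lemma ell2_norm_eq0 v : N v = 0 -> v = 0.
Proof.
move=> v0; apply: ell2P => i; rewrite ell20.
have := sqmod_le_norm v i; rewrite v0 expr0n /= /sqmod.
case: (v i) => a b /= h.
have a0 : a ^+ 2 = 0 by have := sqr_ge0 a; have := sqr_ge0 b; lra.
have b0 : b ^+ 2 = 0 by have := sqr_ge0 a; have := sqr_ge0 b; lra.
by move/eqP: a0; move/eqP: b0; rewrite !sqrf_eq0 => /eqP -> /eqP ->.
Qed.

Fact delta_sqsummable (p : I) : (fun i => (i == p)%:R : C) \in sqsummable.
Proof.
rewrite /in_mem /= /sqsummable /sqnorm (@esum_single _ _ p).
- by rewrite ltry.
- by rewrite lee_fin sqmod_ge0.
- by move=> j /negPf ->; rewrite /sqmod /= expr0n addr0.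
Qed.

Definition delta (p : I) : ell2 R I := Ell2 (delta_sqsummable p).

Lemma deltaE p i : delta p i = (i == p)%:R. Proof. by []. Qed.

Lemma rdot_delta v p : rdot v (delta p) = complex.Re (v p).
Proof.
rewrite /rdot (@rsum_single _ _ p) /rdot_term ?deltaE.
  by rewrite eqxx /= mulr1 mulr0 addr0.
by move=> j /negPf; rewrite deltaE => -> /=; rewrite !mulr0 addr0.
Qed.

Lemma norm_delta p : N (delta p) = 1.
Proof.
apply/eqP; rewrite -(@eqrXn2 _ 2)// ?ell2_norm_ge0// -rdot_norm rdot_delta.
by rewrite deltaE eqxx expr1n.
Qed.

(** The limit is taken coordinatewise, and a Fatou argument on finite sets of coordinates carries
    the rate [e] over to it. Keeping the rate explicit lets [op_complete] treat all vectors at once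
    and obtain an operator norm estimate. *)
Lemma ell2_complete (v : nat -> ell2 R I) (e : nat -> R) :
  (forall n m, (n <= m)%N -> N (v m - v n) <= e n) -> e @ \oo --> (0 : R) ->
  exists w, forall n, N (w - v n) <= e n.
Proof.
move=> ve e0.
have en0 n : 0 <= e n by apply: le_trans (ve n n _); rewrite ?ell2_norm_ge0.
have cauchyR (x : nat -> R) : (forall n m, (n <= m)%N -> `|x m - x n| <= e n) ->
    exists l : R, x @ \oo --> l.
  move=> xe; suff : cvg (x @ \oo) by exists (lim (x @ \oo)).
  apply/cauchy_cvgP; apply/cauchyP => eps eps0.
  have /cvgrPdist_lt/(_ _ eps0)[k _ hk] := e0.
  exists (x k); exists k => // n /= kn.
  rewrite -ball_normE /= distrC; apply: le_lt_trans (xe _ _ kn) _.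
  by have := hk k (leqnn k); rewrite /= sub0r normrN ger0_norm.
have re_le (z : C) (b : R) : 0 <= b -> sqmod z <= b ^+ 2 -> `|complex.Re z| <= b.
  move=> b0 zb; rewrite -(@ler_pXn2r _ 2)// ?nnegrE//.
  by rewrite real_normK ?num_real// (le_trans _ zb)// /sqmod lerDl sqr_ge0.
have im_le (z : C) (b : R) : 0 <= b -> sqmod z <= b ^+ 2 -> `|complex.Im z| <= b.
  move=> b0 zb; rewrite -(@ler_pXn2r _ 2)// ?nnegrE//.
  by rewrite real_normK ?num_real// (le_trans _ zb)// /sqmod lerDr sqr_ge0.
have coord n m i : (n <= m)%N -> sqmod (v m i - v n i) <= e n ^+ 2.
  move=> nm; rewrite -ell2B; apply: le_trans (sqmod_le_norm _ _) _.
  by rewrite ler_pXn2r// ?nnegrE ?ell2_norm_ge0// ve.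
have reB (y z : C) : complex.Re (y - z) = complex.Re y - complex.Re z by case: y z => ? ? [].
have imB (y z : C) : complex.Im (y - z) = complex.Im y - complex.Im z by case: y z => ? ? [].
have /choice[a ha] : forall i, exists l : R, (fun n => complex.Re (v n i)) @ \oo --> l.
  by move=> i; apply: cauchyR => n m nm; rewrite -reB; apply: re_le => //; exact: coord.
have /choice[b hb] : forall i, exists l : R, (fun n => complex.Im (v n i)) @ \oo --> l.
  by move=> i; apply: cauchyR => n m nm; rewrite -imB; apply: im_le => //; exact: coord.
pose f i : C := a i +i* b i.
have fatou n : (sqnorm (fun i => f i - v n i)%R <= (e n ^+ 2)%:E)%E.
  apply: ge_ereal_sup => _ [A [finA _] <-].
  rewrite fsbig_finite//= sumEFin lee_fin.
  have cv : (fun m => \sum_(i <- finmap.enum_fset (fset_set A)) sqmod (v m i - v n i)) @ \oo -->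
      \sum_(i <- finmap.enum_fset (fset_set A)) sqmod (f i - v n i).
    apply: cvg_big => [|i _]; first exact: add_continuous.
    rewrite /sqmod; under eq_fun do rewrite reB imB.
    have cre : (fun m => complex.Re (v m i) - complex.Re (v n i)) @ \oo -->
        complex.Re (f i - v n i).
      by rewrite reB; apply: cvgB; [exact: ha|exact: cvg_cst].
    have cim : (fun m => complex.Im (v m i) - complex.Im (v n i)) @ \oo -->
        complex.Im (f i - v n i).
      by rewrite imB; apply: cvgB; [exact: hb|exact: cvg_cst].
    rewrite !expr2; under eq_fun do rewrite !expr2.
    by apply: cvgD; apply: cvgM.
  apply: (cvgr_to_le cv); exists n => // m /= nm.
  apply: (@le_trans _ _ (N (v m - v n) ^+ 2)); last first.
    by rewrite ler_pXn2r// ?nnegrE ?ell2_norm_ge0// ve.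
  rewrite -rdot_norm /rdot.
  rewrite (_ : rdot_term _ _ = (fun i => sqmod ((v m - v n) i))); last first.
    by apply/funext => j; rewrite /rdot_term /sqmod !expr2.
  rewrite rsum_ge0E; [|by move=> j; exact: sqmod_ge0|exact: ell2_summable].
  rewrite -lee_fin fineK; last first.
    by apply: esum_fin_num; [move=> j; exact: sqmod_ge0|exact: ell2_summable].
  rewrite -sumEFin; under eq_bigr do rewrite -ell2B.
  apply: (@esum_seq_le _ _ (fun j => (sqmod ((v m - v n) j))%:E)); last exact: finmap.fset_uniq.
  by move=> j; rewrite lee_fin sqmod_ge0.
have fv n : (fun i => f i - v n i) \in sqsummable.
  by rewrite /in_mem /= /sqsummable (le_lt_trans (fatou n))// ltry.
pose w : ell2 R I := Ell2 (fv 0%N) + v 0%N.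
have wE i : w i = f i by rewrite ell2D /= subrK.
exists w => n.
have E : sqnorm (w - v n) = sqnorm (fun i => f i - v n i).
  by apply: eq_esum => i _; rewrite ell2B wE.
rewrite -(@ler_pXn2r _ 2)// ?nnegrE ?ell2_norm_ge0// /ell2_norm E sqr_sqrtr; last first.
  by rewrite fine_ge0// esum_ge0// => i _; rewrite lee_fin sqmod_ge0.
rewrite -lee_fin fineK//.
rewrite ge0_fin_numE; first exact: le_lt_trans (fatou n) (ltry _).
by rewrite esum_ge0// => i _; rewrite lee_fin sqmod_ge0.
Qed.

End Ell2Space.

(** * Bounded operators *)

Section BoundedOperators.
Context {R : realType} {I : choiceType}.
Notation op := (ell2 R I -> ell2 R I).
Local Notation N := (@ell2_norm R I).
Implicit Types (T : op) (v w : ell2 R I).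

Definition linear_op T := forall (c : R[i]) v w, T (c *: v + w) = c *: T v + T w.

Definition bounded_op T := linear_op T /\ exists2 c, 0 <= c & opnorm_le T c.

Lemma opE_sub (S T : op) v : (S - T) v = S v - T v. Proof. by []. Qed.
Lemma opE_add (S T : op) v : (S + T) v = S v + T v. Proof. by []. Qed.
Lemma opE_scale c T v : (c *: T) v = c *: T v. Proof. by []. Qed.

Lemma linear_opD T v w : linear_op T -> T (v + w) = T v + T w.
Proof. by move=> Tl; rewrite -[v]scale1r Tl !scale1r. Qed.

Lemma linear_op0 T : linear_op T -> T 0 = 0.
Proof.
move=> Tl; have := Tl (-1) 0 0.
by rewrite scaler0 addr0 scaleN1r addNr.
Qed.

Lemma linear_opZ T c v : linear_op T -> T (c *: v) = c *: T v.
Proof. by move=> Tl; rewrite -[c *: v]addr0 Tl linear_op0// addr0. Qed.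

Lemma linear_opB T v w : linear_op T -> T (v - w) = T v - T w.
Proof. by move=> Tl; rewrite -scaleN1r linear_opD// linear_opZ// scaleN1r. Qed.

Lemma opnorm_le_trans T a b : opnorm_le T a -> a <= b -> opnorm_le T b.
Proof.
move=> Ta ab v; apply: le_trans (Ta v) _.
by rewrite ler_wpM2r ?ell2_norm_ge0.
Qed.

Lemma opnorm_leD (S T : op) a b :
  opnorm_le S a -> opnorm_le T b -> opnorm_le (S + T) (a + b).
Proof.
move=> Sa Tb v; rewrite opE_add mulrDl; apply: le_trans (ell2_normD _ _) _.
by apply: lerD; [exact: Sa|exact: Tb].
Qed.

Lemma opnorm_leZ c T a : opnorm_le T a -> opnorm_le (c *: T) (Num.sqrt (sqmod c) * a).
Proof.
move=> Ta v; rewrite opE_scale ell2_normZ -mulrA.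
by apply: ler_wpM2l; [exact: sqrtr_ge0|exact: Ta].
Qed.

Lemma opnorm_le_comp (S T : op) a b : 0 <= a ->
  opnorm_le S a -> opnorm_le T b -> opnorm_le (S \o T) (a * b).
Proof.
move=> a0 Sa Tb v; apply: le_trans (Sa _) _.
by rewrite -mulrA; apply: ler_wpM2l => //; exact: Tb.
Qed.

Lemma opnorm_le_id : opnorm_le (id : op) 1.
Proof. by move=> v; rewrite mul1r. Qed.

Lemma opnorm_le_subC (S T : op) a : opnorm_le (S - T) a -> opnorm_le (T - S) a.
Proof.
by move=> h v; have := h v; rewrite !opE_sub -[N (T v - S v)]ell2_normN opprB.
Qed.

Lemma opnorm_le_sub_trans (S T U : op) a b :
  opnorm_le (S - T) a -> opnorm_le (T - U) b -> opnorm_le (S - U) (a + b).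
Proof.
move=> h1 h2; have := opnorm_leD h1 h2; congr opnorm_le.
by apply/funext => v; rewrite opE_add !opE_sub addrA subrK.
Qed.

Lemma linear_op_lin (c : R[i]) (S T : op) : linear_op S -> linear_op T ->
  linear_op (c *: S + T).
Proof.
move=> Sl Tl d v w; rewrite !opE_add !opE_scale Sl Tl.
by rewrite !scalerDr !scalerA (mulrC c d) addrACA.
Qed.

Lemma mul_div_succ_le (c e : R) : 0 <= c -> 0 <= e -> c * (e / (c + 1)) <= e.
Proof.
move=> c0 e0; rewrite mulrC mulrAC ler_pdivrMr ?ltr_wpDl//.
by apply: ler_wpM2l => //; rewrite lerDl.
Qed.

Lemma eps_eq0 (w : ell2 R I) c : (forall e, 0 < e -> N w <= e * c) -> w = 0.
Proof.
move=> h; apply: ell2_norm_eq0; apply/eqP; rewrite eq_le ell2_norm_ge0 andbT.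
apply/ler_addgt0Pr => e e0; rewrite add0r.
have c0 : 0 < `|c| + 1 by rewrite ltr_wpDl.
apply: le_trans (h (e / (`|c| + 1)) (divr_gt0 e0 c0)) _.
apply: le_trans (mul_div_succ_le (normr_ge0 c) (ltW e0)).
by rewrite mulrC; apply: ler_wpM2r; [rewrite ltW ?divr_gt0|exact: ler_norm].
Qed.

(** The members of [op_closure] are arbitrary maps that happen to be approximable, so even their
    linearity must be derived from the approximants. *)
Lemma bounded_op_lim T :
  (forall e, 0 < e -> exists2 S, bounded_op S & opnorm_le (T - S) e) ->
  bounded_op T.
Proof.
move=> h; split; last first.
  have [S [_ [c c0 Sc]] TS] := h 1 ltr01.
  exists (1 + c); first by rewrite addr_ge0.
  have := opnorm_leD TS Sc; congr opnorm_le.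
  by apply/funext => v; rewrite opE_add opE_sub subrK.
move=> c v w; apply/eqP; rewrite -subr_eq0; apply/eqP.
apply: (@eps_eq0 _ (N (c *: v + w) + Num.sqrt (sqmod c) * N v + N w)) => e e0.
have [S [Sl _] TS] := h e e0.
have -> : T (c *: v + w) - (c *: T v + T w) =
    (T - S) (c *: v + w) - c *: (T - S) v - (T - S) w.
  rewrite !opE_sub Sl scalerBr -[RHS]addrA -opprD addrACA -[- _ - S w]opprD.
  by rewrite opprB addrA subrK.
rewrite mulrDr mulrDr; apply: le_trans (ell2_normB _ _) _.
apply: lerD; last exact: TS.
apply: le_trans (ell2_normB _ _) _; apply: lerD; first exact: TS.
rewrite ell2_normZ mulrCA; apply: ler_wpM2l; first exact: sqrtr_ge0.
exact: TS.
Qed.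

Lemma op_complete (T : nat -> op) (e : nat -> R) :
  (forall n m, (n <= m)%N -> opnorm_le (T m - T n) (e n)) ->
  e @ \oo --> (0 : R) ->
  exists U : op, forall n, opnorm_le (U - T n) (e n).
Proof.
move=> Te e0.
have /choice[U hU] : forall v, exists w, forall n, N (w - T n v) <= e n * N v.
  move=> v; apply: (@ell2_complete _ _ (fun n => T n v) (fun n => e n * N v)).
    by move=> n m nm; exact: Te.
  by rewrite -(mul0r (N v)); apply: cvgMl.
by exists U => n v; exact: hU.
Qed.

Definition radjoint T T' := forall v w, rdot (T v) w = rdot v (T' w).

Lemma radjoint_sym T T' : radjoint T T' -> radjoint T' T.
Proof. by move=> h v w; rewrite rdotC -h rdotC. Qed.

Lemma is_adjoint_radjoint T T' : is_adjoint T T' -> radjoint T T'.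
Proof. by move=> h v w; have := h v w; rewrite !ell2_dotE => -[]. Qed.

Lemma radjoint_is_adjoint T T' : linear_op T' -> radjoint T T' -> is_adjoint T T'.
Proof. by move=> Tl h v w; rewrite !ell2_dotE !h linear_opZ. Qed.

Lemma radjoint_opnorm T T' c : 0 <= c -> radjoint T T' -> opnorm_le T c ->
  opnorm_le T' c.
Proof.
move=> c0 h Tc w.
have [->|n0] := eqVneq (N (T' w)) 0; first by rewrite mulr_ge0 ?ell2_norm_ge0.
have np : 0 < N (T' w) by rewrite lt_def n0 ell2_norm_ge0.
rewrite -(ler_pM2l np) -expr2 -rdot_norm -h.
apply: le_trans (ell2_cauchy_schwarz _ _) _.
by rewrite mulrA ler_wpM2r ?ell2_norm_ge0// mulrC.
Qed.

End BoundedOperators.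

(** * Norm closures of star-algebras of operators *)

Section ClosedStarAlgebra.
Context {R : realType} {I : choiceType}.
Notation op := (ell2 R I -> ell2 R I).
Local Notation N := (@ell2_norm R I).
Variable B : set op.
Hypothesis B_bounded : forall a, B a -> bounded_op a.
Hypothesis B_lin : forall (c : R[i]) a b, B a -> B b -> B (c *: a + b).
Hypothesis B_comp : forall a b, B a -> B b -> B (a \o b).
Hypothesis B_id : B id.
Hypothesis B_adj : forall a, B a -> exists2 a', B a' & radjoint a a'.
Notation A := (op_closure B).

Lemma closure_sub a : B a -> A a.
Proof.
move=> Ba e e0; exists a => // v.
by rewrite opE_sub subrr ell2_norm0 mulr_ge0 ?ell2_norm_ge0// ltW.
Qed.

Lemma closure_bounded a : A a -> bounded_op a.
Proof.
move=> Aa; apply: bounded_op_lim => e e0; have [S BS aS] := Aa e e0.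
by exists S => //; exact: B_bounded.
Qed.

Lemma closure_lim a :
  (forall e, 0 < e -> exists2 b, A b & opnorm_le (a - b) e) -> A a.
Proof.
move=> h e e0; have e2 : 0 < e / 2 by rewrite divr_gt0.
have [b Ab ab] := h _ e2; have [c Bc bc] := Ab _ e2; exists c => //.
by rewrite [e]splitr; exact: opnorm_le_sub_trans ab bc.
Qed.

Lemma closure_id : A id. Proof. exact: closure_sub. Qed.

Lemma closure_lin (c : R[i]) a b : A a -> A b -> A (c *: a + b).
Proof.
move=> Aa Ab e e0.
have s0 : 0 < Num.sqrt (sqmod c) + 1 by rewrite ltr_wpDl ?sqrtr_ge0.
have e1 : 0 < e / 2 / (Num.sqrt (sqmod c) + 1) by rewrite !divr_gt0.
have [a1 Ba aa1] := Aa _ e1.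
have e2 : 0 < e / 2 by rewrite divr_gt0.
have [b1 Bb bb1] := Ab _ e2.
exists (c *: a1 + b1); first exact: B_lin.
have := opnorm_leD (opnorm_leZ c aa1) bb1 => h.
apply: (@opnorm_le_trans _ _ _ (Num.sqrt (sqmod c) * (e / 2 / (Num.sqrt (sqmod c) + 1)) + e / 2)).
  move: h; congr opnorm_le; apply/funext => v.
  by rewrite opE_add opE_scale !opE_sub !opE_add !opE_scale scalerBr addrACA opprD.
rewrite [leRHS]splitr lerD2r; apply: mul_div_succ_le; first exact: sqrtr_ge0.
exact: ltW.
Qed.

Lemma closure_comp a b : A a -> A b -> A (a \o b).
Proof.
move=> Aa Ab e e0.
have [al [ca ca0 ha]] := closure_bounded Aa.
have e2 : 0 < e / 2 by rewrite divr_gt0.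
have e1 : 0 < e / 2 / (ca + 1) by rewrite divr_gt0// ltr_wpDl.
have [b1 Bb bb1] := Ab _ e1.
have [_ [cb cb0 hb]] := B_bounded Bb.
have e3 : 0 < e / 2 / (cb + 1) by rewrite divr_gt0// ltr_wpDl.
have [a1 Ba aa1] := Aa _ e3.
exists (a1 \o b1); first exact: B_comp.
have h1 := opnorm_le_comp ca0 ha bb1.
have h2 := opnorm_le_comp (ltW e3) aa1 hb.
have := opnorm_leD h1 h2 => h.
apply: (@opnorm_le_trans _ _ _ (ca * (e / 2 / (ca + 1)) + e / 2 / (cb + 1) * cb)).
  move: h; congr opnorm_le; apply/funext => v.
  by rewrite opE_add opE_sub /= !opE_sub (linear_opB _ _ al) addrA subrK.
rewrite [leRHS]splitr; apply: lerD.
  by apply: mul_div_succ_le => //; exact: ltW.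
by rewrite mulrC; apply: mul_div_succ_le => //; exact: ltW.
Qed.

Let inv_cvg0 : (fun n : nat => n.+1%:R^-1 : R) @ \oo --> (0 : R).
Proof. exact: cvg_harmonic. Qed.

(** Adjoints have the same norm bounds, so the adjoints of a sequence approximating [a] form a
    Cauchy sequence; its limit lies in the closure and is the adjoint. *)
Lemma closure_adj a : A a -> exists2 a', A a' & radjoint a a'.
Proof.
move=> Aa.
have inv_gt0 (n : nat) : 0 < n.+1%:R^-1 :> R by rewrite invr_gt0 ltr0Sn.
have /choice[s hs] : forall n : nat, exists b, B b /\ opnorm_le (a - b) n.+1%:R^-1.
  by move=> n; have [b Bb ab] := Aa _ (inv_gt0 n); exists b.
have /choice[s' hs'] : forall n : nat, exists b, B b /\ radjoint (s n) b.
  by move=> n; have [b Bb ab] := B_adj (hs n).1; exists b.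
pose e (n : nat) : R := 2 * n.+1%:R^-1.
have e0 : e @ \oo --> (0 : R).
  by rewrite -(mulr0 2); apply: cvgMr.
have [n m nm|a' ha'] := op_complete (T := s') (e := e) _ e0.
  apply: (@radjoint_opnorm _ _ (s m - s n)).
  - by rewrite mulr_ge0// ltW.
  - move=> v w; rewrite !opE_sub rdotBl rdotBr (hs' m).2 (hs' n).2//.
  - apply: (@opnorm_le_trans _ _ _ (m.+1%:R^-1 + n.+1%:R^-1)).
      by apply: opnorm_le_sub_trans (hs n).2; apply: opnorm_le_subC; exact: (hs m).2.
    rewrite /e mulr_natl mulr2n lerD2r lef_pV2 ?posrE ?ltr0Sn//.
    by rewrite ler_nat ltnS.
exists a'.
  apply: closure_lim => eps eps0.
  have /cvgrPdist_lt/(_ _ eps0)[k _ hk] := e0.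
  exists (s' k); first by apply: closure_sub; exact: (hs' k).1.
  apply: opnorm_le_trans (ha' k) _; apply: ltW; apply: le_lt_trans (hk k _) => //=.
  by rewrite sub0r normrN ler_norm.
move=> v w; apply/eqP; rewrite -subr_eq0 -normr_le0; apply/ler_addgt0Pr => eps eps0.
rewrite add0r.
have c0 : 0 < 3 * N v * N w + 1.
  by rewrite ltr_wpDl// !mulr_ge0 ?ell2_norm_ge0.
have e1 : 0 < eps / (3 * N v * N w + 1) by rewrite divr_gt0.
have /cvgrPdist_lt/(_ _ e1)[k _ /(_ k (leqnn k)) hk] := inv_cvg0.
have {}hk : k.+1%:R^-1 < eps / (3 * N v * N w + 1).
  by move: hk; rewrite /= sub0r normrN ger0_norm// ltW.
have -> : rdot (a v) w - rdot v (a' w) =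
    rdot ((a - s k) v) w - rdot v ((a' - s' k) w).
  by rewrite !opE_sub rdotBl rdotBr (hs' k).2; ring.
have abs_dot x y : `|rdot x y| <= N x * N y.
  rewrite ler_norml ell2_cauchy_schwarz andbT lerNl -rdotNl.
  by rewrite -(ell2_normN x) ell2_cauchy_schwarz.
apply: le_trans (ler_normB _ _) _.
apply: (@le_trans _ _ (k.+1%:R^-1 * (3 * N v * N w))).
  have h1 : `|rdot ((a - s k) v) w| <= k.+1%:R^-1 * N v * N w.
    apply: le_trans (abs_dot _ _) _; rewrite ler_wpM2r ?ell2_norm_ge0//.
    exact: (hs k).2.
  have h2 : `|rdot v ((a' - s' k) w)| <= 2 * (k.+1%:R^-1 * N v * N w).
    rewrite (_ : 2 * _ = N v * (2 * k.+1%:R^-1 * N w)); last by ring.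
    apply: le_trans (abs_dot _ _) _; rewrite ler_wpM2l ?ell2_norm_ge0//.
    exact: ha'.
  apply: le_trans (lerD h1 h2) _.
  by rewrite le_eqVlt; apply/orP; left; apply/eqP; ring.
move: hk; rewrite ltr_pdivlMr// => hk.
apply: le_trans _ (ltW hk); rewrite mulrDr mulr1 lerDl ltW//.
Qed.

(** [Z] is the norm limit of the geometric series. Only the one-sided identity Z (1 - x) = 1 is
    kept: it is the one that a unital endomorphism carries over into a lower bound. *)
Lemma closure_neumann x q : A x -> 0 <= q < 1 -> opnorm_le x q ->
  exists2 Z, A Z & forall v, Z (v - x v) = v.
Proof.
move=> Ax /andP[q0 q1] xq.
have xl := (closure_bounded Ax).1.
pose P n : op := iter n x.
have PA n : A (P n).
  by elim: n => [|n ih]; [exact: closure_id|exact: (closure_comp Ax ih)].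
have Pl n : linear_op (P n) by exact: (closure_bounded (PA n)).1.
have Pq n : opnorm_le (P n) (q ^+ n).
  elim: n => [|n ih]; first by rewrite expr0; exact: opnorm_le_id.
  by rewrite exprS; exact: (opnorm_le_comp q0 xq ih).
pose Sn n : op := \sum_(k < n) P k.
have SA n : A (Sn n).
  elim: n => [|n ih].
    rewrite /Sn big_ord0 -(subrr id) -scaleN1r addrC.
    by apply: closure_lin; exact: closure_id.
  rewrite /Sn big_ord_recr /= -[\sum_(i < n) _]scale1r.
  exact: closure_lin.
have SS n : Sn n.+1 = Sn n + P n by rewrite /Sn big_ord_recr.
have q1' : 0 < 1 - q by rewrite subr_gt0.
pose e n := q ^+ n / (1 - q).
have Se n j : opnorm_le (Sn (n + j)%N - Sn n) ((q ^+ n - q ^+ (n + j)) / (1 - q)).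
  elim: j => [|j ih].
    move=> v; rewrite addn0 opE_sub !subrr ell2_norm0 mul0r mul0r//.
  have := opnorm_leD ih (Pq (n + j)%N).
  have -> : Sn (n + j)%N - Sn n + P (n + j)%N = Sn (n + j.+1)%N - Sn n.
    by rewrite addnS SS addrAC.
  move=> h; apply: opnorm_le_trans h _; rewrite addnS exprS.
  rewrite le_eqVlt; apply/orP; left; apply/eqP; field.
  by rewrite gt_eqF.
have e0 : e @ \oo --> (0 : R).
  rewrite -(mul0r (1 - q)^-1); apply: cvgMl; apply: cvg_expr.
  by rewrite ger0_norm.
have [n m nm|Z ZS] := op_complete (T := Sn) (e := e) _ e0.
  rewrite -(subnKC nm); apply: opnorm_le_trans (Se n _) _.
  rewrite /e; apply: ler_wpM2r; first by rewrite invr_ge0 ltW.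
  by rewrite gerBl exprn_ge0.
exists Z.
  apply: closure_lim => eps eps0; have /cvgrPdist_lt/(_ _ eps0)[k _ hk] := e0.
  exists (Sn k); first exact: SA.
  apply: opnorm_le_trans (ZS k) _; apply: ltW; apply: le_lt_trans (hk k _) => //=.
  by rewrite sub0r normrN ler_norm.
move=> v; apply/eqP; rewrite -subr_eq0; apply/eqP.
apply: (@eps_eq0 _ _ _ (N (v - x v) + N v)) => eps eps0.
have tele n : Sn n (v - x v) = v - P n v.
  elim: n => [|n ih]; first by rewrite /Sn big_ord0 /= subrr.
  by rewrite SS opE_add ih (linear_opB _ _ (Pl n)) addrA subrK /P -iterSr.
have [k hk] : exists k, e k < eps.
  have /cvgrPdist_lt/(_ _ eps0)[k _ hk] := e0; exists k.
  apply: le_lt_trans (hk k _) => //=; by rewrite sub0r normrN ler_norm.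
have -> : Z (v - x v) - v = (Z - Sn k) (v - x v) - P k v.
  by rewrite opE_sub tele opprB addrA addrAC addrK.
apply: le_trans (ell2_normB _ _) _; rewrite mulrDr; apply: lerD.
  apply: le_trans (ZS k _) _; rewrite ler_wpM2r ?ell2_norm_ge0// ltW//.
apply: le_trans (Pq k _) _; rewrite ler_wpM2r ?ell2_norm_ge0//.
apply: le_trans (ltW hk); rewrite /e ler_pdivlMr//.
by rewrite ler_piMr ?exprn_ge0// gerBl.
Qed.

(* C*-algebra homomorphisms are contractive. For [T = phi (x* x)] with norm
   [s] larger than the norm bound [r] of [x* x], [s^2 - (x* x)^2] would be
   invertible in [A], whence [s^2 - T^2] would be bounded below, which
   contradicts that [s] is the norm of the self-adjoint operator [T]. *)
Lemma star_endomorphism_contractive phi x c : star_endomorphism A phi ->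
  phi id = id -> A x -> 0 <= c -> opnorm_le x c -> opnorm_le (phi x) c.
Proof.
move=> hphi phi1 Ax c0 xc.
have [x' Ax' xx'] := closure_adj Ax.
have x'c := radjoint_opnorm c0 xx' xc.
pose y : op := x' \o x.
have Ay : A y by exact: closure_comp.
have yr : opnorm_le y (c * c) := opnorm_le_comp c0 x'c xc.
have c20 : 0 <= c * c by rewrite mulr_ge0.
have pxx' : radjoint (phi x) (phi x').
  apply: is_adjoint_radjoint; apply: (star_endo_adjoint hphi) => //.
  by apply: radjoint_is_adjoint => //; exact: (closure_bounded Ax').1.
pose T := phi y.
have TE : T = phi x' \o phi x by exact: (star_endo_mul hphi).
have Tsym v w : rdot (T v) w = rdot v (T w).
  by rewrite TE /= (radjoint_sym pxx') pxx'.
have [Tl [t t0 Tt]] := closure_bounded (star_endo_mem hphi Ay).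
(* The C*-identity: the squared norm of phi(x) v is the inner product of v with T v. *)
suff Tr : opnorm_le T (c * c).
  move=> v; rewrite -(@ler_pXn2r _ 2)// ?nnegrE ?mulr_ge0 ?ell2_norm_ge0//.
  rewrite -rdot_norm pxx' -[phi x' (phi x v)]/((phi x' \o phi x) v) -TE.
  apply: le_trans (ell2_cauchy_schwarz _ _) _.
  apply: (@le_trans _ _ (N v * (c * c * N v))).
    by rewrite ler_wpM2l ?ell2_norm_ge0//; exact: Tr.
  by rewrite le_eqVlt; apply/orP; left; apply/eqP; ring.
pose D := [set k | 0 <= k /\ opnorm_le T k].
have D0 : D !=set0 by exists t.
have infD : has_inf D by split => //; exists 0 => k [].
pose s := inf D.
have s0 : 0 <= s by apply: lb_le_inf => // k [].
have Ts : opnorm_le T s.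
  move=> v; rewrite -subr_le0; apply/ler_addgt0Pr => e e0; rewrite add0r lerBlDr.
  have n0 : 0 < N v + 1 by rewrite ltr_wpDl ?ell2_norm_ge0.
  have [k [k0 Tk] ks] := inf_adherent (divr_gt0 e0 n0) infD.
  apply: le_trans (Tk v) _.
  apply: (@le_trans _ _ ((inf D + e / (N v + 1)) * N v)).
    by rewrite ler_wpM2r ?ell2_norm_ge0// ltW.
  rewrite mulrDl addrC lerD2r mulrC; apply: mul_div_succ_le; last exact: ltW.
  exact: ell2_norm_ge0.
have [sr|rs] := leP s (c * c); first exact: opnorm_le_trans Ts sr.
exfalso.
have sp : 0 < s by exact: le_lt_trans rs.
pose z : op := ((s ^- 2)%:C)%C *: (y \o y).
have A0 : A 0.
  rewrite -(subrr id) -scaleN1r addrC; apply: closure_lin; exact: closure_id.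
have Ayy : A (y \o y) by exact: closure_comp.
have Az : A z by rewrite -[z]addr0; exact: closure_lin.
(* [y] has norm at most c^2 < s, so s^-2 y^2 has norm at most q < 1 and the Neumann series
   applies. *)
pose q := (c * c / s) ^+ 2.
have sqmodR (k : R) : sqmod (k%:C)%C = k ^+ 2.
  by rewrite /sqmod /= expr0n addr0.
have zq : opnorm_le z q.
  apply: opnorm_le_trans (opnorm_leZ _ (opnorm_le_comp c20 yr yr)) _.
  rewrite sqmodR sqrtr_sqr ger0_norm ?invr_ge0 ?sqr_ge0//.
  rewrite le_eqVlt; apply/orP; left; apply/eqP; rewrite /q; field.
  by rewrite gt_eqF.
have q01 : 0 <= q < 1.
  rewrite sqr_ge0 /=; rewrite exprn_ilt1//.
    by rewrite divr_ge0.
  by rewrite ltr_pdivrMr// mul1r.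
have [Z AZ Zz] := closure_neumann Az q01 zq.
have phiz : phi z = ((s ^- 2)%:C)%C *: (T \o T).
  have := star_endo_linear hphi (((s ^- 2)%:C)%C) Ayy A0.
  rewrite addr0 -/z => ->; rewrite (star_endo_mul hphi)//.
  have -> : phi 0 = 0.
    have := star_endo_linear hphi (-1) A0 A0.
    by rewrite scaler0 addr0 scaleN1r addNr.
  by rewrite addr0.
have inverse v : phi Z (v - (s ^- 2)%:C%C *: T (T v)) = v.
  have E : Z \o (- 1 *: z + id) = id.
    by apply/funext => w; rewrite /= opE_add opE_scale scaleN1r addrC Zz.
  have Az1 : A (- 1 *: z + id) by apply: closure_lin; [exact: Az|exact: closure_id].
  have := congr1 (fun f => f v) (esym (star_endo_mul hphi AZ Az1)).
  rewrite E phi1 (star_endo_linear hphi _ Az closure_id).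
  by rewrite phi1 phiz /= opE_add opE_scale scaleN1r addrC.
have [_ [zeta zeta0 hZ]] := closure_bounded (star_endo_mem hphi AZ).
(* With w = v - s^-2 T^2 v, symmetry of T and N(T T v) <= s N(T v) give N(w)^2 <= N(v)^2 - s^-2 N(T
   v)^2, while [inverse] gives N(v) <= (zeta + 1) N(w). Together they bound T by the square root of
   [k2], which is smaller than [s]. Using zeta + 1 in place of [zeta] keeps the divisor nonzero. *)
pose k2 := s ^+ 2 * (1 - (zeta + 1) ^- 2).
have z1 : 1 <= zeta + 1 by rewrite lerDr.
have zi : (zeta + 1) ^- 2 <= 1.
  by rewrite invf_le1 ?exprn_gt0 ?(lt_le_trans ltr01)// exprn_ege1.
have k20 : 0 <= k2 by rewrite mulr_ge0 ?sqr_ge0// subr_ge0.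
have Tk2 : opnorm_le T (Num.sqrt k2).
  move=> v; rewrite -(@ler_pXn2r _ 2)// ?nnegrE ?mulr_ge0 ?ell2_norm_ge0 ?sqrtr_ge0//.
  rewrite exprMn (sqr_sqrtr k20).
  pose w := v - (s ^- 2)%:C%C *: T (T v).
  have vw : N v <= (zeta + 1) * N w.
    rewrite -{1}(inverse v); apply: le_trans (hZ _) _.
    by rewrite ler_wpM2r ?ell2_norm_ge0// lerDl.
  have Nw : N w ^+ 2 <= N v ^+ 2 - s ^- 2 * N (T v) ^+ 2.
    rewrite -rdot_norm /w rdotBl !rdotBr !rdotZl !rdotZr.
    rewrite (rdotC (T (T v)) v) -(Tsym v (T v)) !rdot_norm.
    have h : N (T (T v)) ^+ 2 <= s ^+ 2 * N (T v) ^+ 2.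
      by rewrite -exprMn ler_pXn2r// ?nnegrE ?mulr_ge0 ?ell2_norm_ge0.
    have h' : s ^- 2 * (s ^- 2 * N (T (T v)) ^+ 2) <= s ^- 2 * N (T v) ^+ 2.
      rewrite ler_wpM2l ?invr_ge0 ?sqr_ge0//.
      by rewrite mulrC ler_pdivrMr ?exprn_gt0// mulrC.
    lra.
  have v2 : N v ^+ 2 <= (zeta + 1) ^+ 2 * N w ^+ 2.
    by rewrite -exprMn ler_pXn2r// ?nnegrE ?mulr_ge0 ?ell2_norm_ge0// (le_trans ler01).
  have zp : 0 < (zeta + 1) ^+ 2 by rewrite exprn_gt0// (lt_le_trans ltr01).
  have v3 : (zeta + 1) ^- 2 * N v ^+ 2 <= N w ^+ 2.
    by rewrite mulrC ler_pdivrMr// mulrC.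
  have v4 : s ^- 2 * N (T v) ^+ 2 <= (1 - (zeta + 1) ^- 2) * N v ^+ 2.
    rewrite mulrBl mul1r; lra.
  rewrite /k2 -mulrA -ler_pdivrMl ?exprn_gt0//.
have : s <= Num.sqrt k2.
  by apply: inf_lbound; [exact: infD.2|split => //; exact: sqrtr_ge0].
apply/negP; rewrite -ltNge -(@ltr_pXn2r _ 2)// ?nnegrE ?sqrtr_ge0//.
rewrite (sqr_sqrtr k20) /k2 gtr_pMr ?exprn_gt0//.
by rewrite ltrBlDr ltrDl invr_gt0 exprn_gt0// (lt_le_trans ltr01).
Qed.

End ClosedStarAlgebra.

(** * Complex exponential and analytic continuation *)

Section ComplexModulus.
Local Open Scope complex_scope.
Context {R : realType}.
Notation C := R[i].

Definition cmod (z : C) : R := Num.sqrt (sqmod z).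

Lemma normc_cmod (z : C) : `|z| = (cmod z)%:C. Proof. exact: normc_def. Qed.

Lemma cmod_ge0 z : 0 <= cmod z. Proof. exact: sqrtr_ge0. Qed.

Lemma cmodM y z : cmod (y * z) = cmod y * cmod z.
Proof. by apply: complexI; rewrite -normc_cmod normrM !normc_cmod rmorphM. Qed.

Lemma cmodX z n : cmod (z ^+ n) = cmod z ^+ n.
Proof. by apply: complexI; rewrite -normc_cmod normrX !normc_cmod rmorphXn. Qed.

Lemma cmodD y z : cmod (y + z) <= cmod y + cmod z.
Proof. by have := ler_normD y z; rewrite !normc_cmod -rmorphD lecR. Qed.

Lemma cmodN z : cmod (- z) = cmod z.
Proof. by apply: complexI; rewrite -!normc_cmod normrN. Qed.

Lemma cmodB y z : cmod (y - z) <= cmod y + cmod z.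
Proof. by rewrite -(cmodN z) cmodD. Qed.

Lemma cmod0 : cmod 0 = 0.
Proof. by apply: complexI; rewrite -normc_cmod normr0. Qed.

Lemma cmod_eq0 z : (cmod z == 0) = (z == 0).
Proof. by rewrite -(inj_eq (@complexI R)) -normc_cmod normr_eq0. Qed.

Lemma cmod_gt0 z : (0 < cmod z) = (z != 0).
Proof. by rewrite lt_def cmod_ge0 andbT cmod_eq0. Qed.

Lemma cmodR (x : R) : cmod x%:C = `|x|.
Proof. by rewrite /cmod /sqmod /= expr0n addr0 sqrtr_sqr. Qed.

Lemma sqr_cmod z : cmod z ^+ 2 = sqmod z.
Proof. by rewrite sqr_sqrtr// addr_ge0 ?sqr_ge0. Qed.

Lemma cmod_le_ReIm z : cmod z <= `|complex.Re z| + `|complex.Im z|.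
Proof.
rewrite -(@ler_pXn2r _ 2)// ?nnegrE ?cmod_ge0 ?addr_ge0// sqr_cmod /sqmod.
rewrite -(real_normK (num_real (complex.Re z))) -(real_normK (num_real (complex.Im z))).
have := normr_ge0 (complex.Re z); have := normr_ge0 (complex.Im z); nra.
Qed.

Lemma normr_Re_le z : `|complex.Re z| <= cmod z.
Proof.
rewrite -(@ler_pXn2r _ 2)// ?nnegrE ?cmod_ge0// sqr_cmod real_normK ?num_real//.
by rewrite lerDl sqr_ge0.
Qed.

Lemma normr_Im_le z : `|complex.Im z| <= cmod z.
Proof.
rewrite -(@ler_pXn2r _ 2)// ?nnegrE ?cmod_ge0// sqr_cmod real_normK ?num_real//.
by rewrite lerDr sqr_ge0.
Qed.

Lemma cReM (y z : C) : complex.Re (y * z) =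
  complex.Re y * complex.Re z - complex.Im y * complex.Im z.
Proof. by case: y z => a b []. Qed.

Lemma cImM (y z : C) : complex.Im (y * z) =
  complex.Re y * complex.Im z + complex.Im y * complex.Re z.
Proof. by case: y z => a b []. Qed.

Lemma cReD (y z : C) : complex.Re (y + z) = complex.Re y + complex.Re z.
Proof. by case: y z => a b []. Qed.

Lemma cImD (y z : C) : complex.Im (y + z) = complex.Im y + complex.Im z.
Proof. by case: y z => a b []. Qed.

Lemma cReB (y z : C) : complex.Re (y - z) = complex.Re y - complex.Re z.
Proof. by case: y z => a b []. Qed.

Lemma cImB (y z : C) : complex.Im (y - z) = complex.Im y - complex.Im z.
Proof. by case: y z => a b []. Qed.

Lemma Re_sum n (f : nat -> C) :
  complex.Re (\sum_(k < n) f k) = \sum_(k < n) complex.Re (f k).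
Proof. by elim: n => [|n ih]; rewrite ?big_ord0// !big_ord_recr /= cReD ih. Qed.

Lemma Im_sum n (f : nat -> C) :
  complex.Im (\sum_(k < n) f k) = \sum_(k < n) complex.Im (f k).
Proof. by elim: n => [|n ih]; rewrite ?big_ord0// !big_ord_recr /= cImD ih. Qed.

End ComplexModulus.

Section ComplexExponential.
Local Open Scope complex_scope.
Context {R : realType}.
Notation C := R[i].

Definition imagC : C := 0 +i* 1.

Definition cexp (z : C) : C := (expR (complex.Re z))%:C * cis (complex.Im z).

Lemma cexpD y z : cexp (y + z) = cexp y * cexp z.
Proof.
case: y z => a b [c e]; rewrite /cexp /cis /= expRD cosD sinD.
by apply/eqP; rewrite eq_complex /=; apply/andP; split; apply/eqP; ring.
Qed.

Lemma cmod_cexp z : cmod (cexp z) = expR (complex.Re z).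
Proof.
rewrite cmodM cmodR ger0_norm ?expR_ge0// /cmod /sqmod /= cos2Dsin2.
by rewrite sqrtr1 mulr1.
Qed.

Lemma cexpR (x : R) : cexp x%:C = (expR x)%:C.
Proof. by rewrite /cexp /cis /= cos0 sin0 mulr1. Qed.

Lemma cexpI (x : R) : cexp (0 +i* x) = cis x.
Proof. by rewrite /cexp /= expR0 mul1r. Qed.

Definition cexp_coeff (z : C) (k : nat) : C := z ^+ k / k`!%:R.

Let bound_from_derivative (g h dg dh : R -> R) (t : R) : 0 <= t ->
  (forall x : R, is_derive x (1 : R) g (dg x)) ->
  (forall x : R, is_derive x (1 : R) h (dh x)) ->
  g 0 = 0 -> h 0 = 0 -> (forall x, 0 <= x <= t -> `|dg x| <= dh x) ->
  `|g t| <= h t.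
Proof.
move=> t0 gd hd g0 h0 dgh.
have key (f df : R -> R) : (forall x : R, is_derive x (1 : R) f (df x)) ->
    f 0 = 0 -> (forall x, 0 <= x <= t -> 0 <= df x) -> 0 <= f t.
  move=> fd f0 df0.
  have cont : {within `[0, t], continuous f}.
    apply: continuous_subspaceT => x.
    apply: differentiable_continuous; apply/derivable1_diffP.
    exact: (@ex_derive _ _ _ _ _ _ _ (fd x)).
  have [c] := @MVT_segment _ _ _ 0 t t0 (fun x _ => fd x) cont.
  rewrite in_itv /= => c0t; rewrite f0 !subr0 => ->.
  by rewrite mulr_ge0// df0.
have h1 : 0 <= (h - g) t.
  apply: (key _ (fun x => dh x - dg x)).
  - by rewrite !fctE g0 h0 subr0.
  - by move=> x x0; have := dgh x x0; rewrite ler_norml => /andP[]; lra.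
have h2 : 0 <= (h + g) t.
  apply: (key _ (fun x => dh x + dg x)).
  - by rewrite !fctE g0 h0 addr0.
  - by move=> x x0; have := dgh x x0; rewrite ler_norml => /andP[]; lra.
by move: h1 h2; rewrite !fctE ler_norml => ? ?; apply/andP; split; lra.
Qed.

Section Taylor.
Local Open Scope complex_scope.
Variable w : C.
Let a := complex.Re w.
Let b := complex.Im w.
Let P n := \poly_(k < n) complex.Re (cexp_coeff w k).
Let Q n := \poly_(k < n) complex.Im (cexp_coeff w k).
(** [X] and [Y] are the real and imaginary parts of the Taylor remainder of order n of exp(t w) in
    the real variable [t]. Differentiating the remainder of order n + 1 gives [w] times the one of
    order n, so bounds propagate by integration from 0. *)
Let X n (t : R) := expR (t * a) * cos (t * b) - (P n).[t].
Let Y n (t : R) := expR (t * a) * sin (t * b) - (Q n).[t].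

Let coeffS k : k.+1%:R * cexp_coeff w k.+1 = w * cexp_coeff w k.
Proof.
rewrite /cexp_coeff exprS factS natrM invfM.
rewrite [LHS]mulrC -!mulrA; congr (_ * (_ * _)).
by rewrite mulrCA mulVf ?mulr1// pnatr_eq0.
Qed.

Let natrRe k (z : C) : complex.Re (k%:R * z) = k%:R * complex.Re z.
Proof. by rewrite mulr_natl mulr_natl raddfMn. Qed.

Let natrIm k (z : C) : complex.Im (k%:R * z) = k%:R * complex.Im z.
Proof. by rewrite mulr_natl mulr_natl raddfMn. Qed.

Let derivP n : (P n.+1)^`() = a *: P n - b *: Q n.
Proof.
apply/polyP => i; rewrite coef_deriv !coefE ltnS.
case: ifP => _; last by rewrite !mulr0 subr0 mul0rn.
by rewrite -mulr_natl -natrRe coeffS cReM.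
Qed.

Let derivQ n : (Q n.+1)^`() = b *: P n + a *: Q n.
Proof.
apply/polyP => i; rewrite coef_deriv !coefE ltnS.
case: ifP => _; last by rewrite !mulr0 addr0 mul0rn.
by rewrite -mulr_natl -natrIm coeffS cImM addrC.
Qed.

Let dlin (c x : R) : is_derive x (1 : R) (fun t => t * c) c.
Proof.
have := @is_derive_poly R ('X * c%:P) x.
rewrite derivM derivX derivC mul1r mulr0 addr0 hornerC.
by congr is_derive; apply/funext => t; rewrite hornerM hornerX hornerC.
Qed.

Let dX n (t : R) : is_derive t (1 : R) (X n.+1) (a * X n t - b * Y n t).
Proof.
have h : is_derive t (1 : R)
    ((fun t => expR (t * a)) * (fun t => cos (t * b)) - horner (P n.+1))
    (expR (t * a) *: (- sin (t * b) * b) + cos (t * b) *: (expR (t * a) * a) -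
     (P n.+1)^`().[t]).
  apply: is_deriveB; apply: is_deriveM.
  - exact: (@is_derive1_comp _ expR (fun t => t * a)).
  - exact: (@is_derive1_comp _ cos (fun t => t * b)).
move: h; rewrite derivP !hornerE /X /Y.
congr is_derive; rewrite /GRing.scale /=; ring.
Qed.

Let dY n (t : R) : is_derive t (1 : R) (Y n.+1) (b * X n t + a * Y n t).
Proof.
have h : is_derive t (1 : R)
    ((fun t => expR (t * a)) * (fun t => sin (t * b)) - horner (Q n.+1))
    (expR (t * a) *: (cos (t * b) * b) + sin (t * b) *: (expR (t * a) * a) -
     (Q n.+1)^`().[t]).
  apply: is_deriveB; apply: is_deriveM.
  - exact: (@is_derive1_comp _ expR (fun t => t * a)).
  - exact: (@is_derive1_comp _ sin (fun t => t * b)).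
move: h; rewrite derivQ !hornerE /X /Y.
congr is_derive; rewrite /GRing.scale /=; ring.
Qed.

Variable r : R.
Hypothesis wr : cmod w <= r.

Let ar : `|a| <= r. Proof. exact: le_trans (normr_Re_le w) wr. Qed.
Let br : `|b| <= r. Proof. exact: le_trans (normr_Im_le w) wr. Qed.
Let r0 : 0 <= r. Proof. exact: le_trans (cmod_ge0 w) wr. Qed.

Let dmonomial (c : R) n (x : R) :
  is_derive x (1 : R) (fun t : R => c * (t ^+ n.+1 / (n.+1)`!%:R)) (c * (x ^+ n / n`!%:R)).
Proof.
have := @is_derive_poly R ((c / (n.+1)`!%:R)%:P * 'X^(n.+1)) x.
rewrite derivM derivC mul0r add0r derivXn hornerM hornerC hornerMn hornerXn.
have -> : c / (n.+1)`!%:R * (x ^+ n.+1.-1 *+ n.+1) = c * (x ^+ n / n`!%:R).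
  rewrite /= factS natrM invfM -[x ^+ n *+ _]mulr_natl.
  have n1 : n.+1%:R != 0 :> R by rewrite pnatr_eq0.
  have f0 : n`!%:R != 0 :> R by rewrite pnatr_eq0 -lt0n fact_gt0.
  move: (n.+1%:R : R) (n`!%:R : R) n1 f0 => u f n1 f0.
  by field; rewrite n1 f0.
suff -> : (fun t : R => c * (t ^+ n.+1 / (n.+1)`!%:R)) =
  horner ((c / (n.+1)`!%:R)%:P * 'X^(n.+1)) by [].
by apply/funext => t; rewrite hornerM hornerC hornerXn mulrA mulrAC.
Qed.

Let coeff0 : cexp_coeff w 0 = 1.
Proof. by rewrite /cexp_coeff expr0 fact0 divr1. Qed.

Let X0 n : X n.+1 0 = 0.
Proof.
by rewrite /X !mul0r expR0 cos0 mulr1 horner_coef0 coef_poly ltn0Sn coeff0 /= subrr.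
Qed.

Let Y0 n : Y n.+1 0 = 0.
Proof.
by rewrite /Y !mul0r expR0 sin0 mulr0 horner_coef0 coef_poly ltn0Sn coeff0 /= subrr.
Qed.

Let XY_bound n t : 0 <= t <= 1 ->
  `|X n t| <= expR r * (2 * r) ^+ n * (t ^+ n / n`!%:R) /\
  `|Y n t| <= expR r * (2 * r) ^+ n * (t ^+ n / n`!%:R).
Proof.
elim: n t => [|n ih] t t01.
  have ta : t * a <= r.
    apply: le_trans (ler_norm _) _; rewrite normrM -[r]mul1r.
    by move: t01 => /andP[t0 t1]; apply: ler_pM => //; rewrite ger0_norm.
  rewrite /X /Y /P /Q !poly_def !big_ord0 horner0 !subr0 !expr0 fact0 invr1 !mulr1.
  rewrite !normrM ger0_norm ?expR_ge0//.
  by split; rewrite -[expR r]mulr1; apply: ler_pM; rewrite ?expR_ge0 ?ler_expR// ler_norml;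
    [rewrite cos_geN1 cos_le1|rewrite sin_geN1 sin_le1].
set c := expR r * (2 * r) ^+ n.+1.
have cE x : c * (x ^+ n / n`!%:R) = 2 * r * (expR r * (2 * r) ^+ n * (x ^+ n / n`!%:R)).
  by rewrite /c exprS; ring.
have h0 : c * (0 ^+ n.+1 / (n.+1)`!%:R) = 0 by rewrite expr0n /= mul0r mulr0.
(* Bounding the two parts separately costs a factor 2 at each order, whence (2 r)^n where r^n would
   be sharp; the factorial absorbs it. *)
have comb (s u v y z m : R) : `|s| <= r -> `|u| <= r -> `|y| <= m -> `|z| <= m ->
    `|s * y + u * z| <= 2 * r * m.
  move=> h1 h2 h3 h4; apply: le_trans (ler_normD _ _) _; rewrite !normrM.
  by rewrite -mulrA mulr_natl mulr2n lerD// ler_pM.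
have t0 : 0 <= t by case/andP: t01.
have sub x : 0 <= x <= t -> 0 <= x <= 1.
  by move=> /andP[-> xt] /=; apply: le_trans xt _; case/andP: t01.
split.
- apply: (@bound_from_derivative _ _ (fun x => a * X n x - b * Y n x)
    (fun x => c * (x ^+ n / n`!%:R)) t t0 (dX n) (dmonomial c n) (X0 n) h0) => x xt.
  have [h1 h2] := ih x (sub x xt); rewrite cE -mulNr.
  by apply: comb => //; rewrite normrN.
- apply: (@bound_from_derivative _ _ (fun x => b * X n x + a * Y n x)
    (fun x => c * (x ^+ n / n`!%:R)) t t0 (dY n) (dmonomial c n) (Y0 n) h0) => x xt.
  have [h1 h2] := ih x (sub x xt); rewrite cE.
  exact: comb.
Qed.

Lemma cexp_remainder n :
  cmod (cexp w - \sum_(k < n) cexp_coeff w k) <=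
  2 * expR r * ((2 * r) ^+ n / n`!%:R).
Proof.
have t01 : 0 <= (1 : R) <= 1 by rewrite ler01 lexx.
have [hX hY] := XY_bound n t01.
apply: le_trans (cmod_le_ReIm _) _.
have -> : complex.Re (cexp w - \sum_(k < n) cexp_coeff w k) = X n 1.
  rewrite cReB Re_sum /X !mul1r horner_poly cReM /= mul0r subr0; congr (_ - _).
  by apply: eq_bigr => i _; rewrite expr1n mulr1.
have -> : complex.Im (cexp w - \sum_(k < n) cexp_coeff w k) = Y n 1.
  rewrite cImB Im_sum /Y !mul1r horner_poly cImM /= mul0r addr0; congr (_ - _).
  by apply: eq_bigr => i _; rewrite expr1n mulr1.
apply: le_trans (lerD hX hY) _; rewrite expr1n mul1r.
by rewrite le_eqVlt; apply/orP; left; apply/eqP; ring.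
Qed.

End Taylor.

Lemma cexp_taylor (r e : R) : 0 <= r -> 0 < e -> exists N, forall n, (N <= n)%N ->
  forall w, cmod w <= r -> cmod (cexp w - \sum_(k < n) cexp_coeff w k) <= e.
Proof.
move=> r0 e0.
have c0 : (fun n => 2 * expR r * ((2 * r) ^+ n / n`!%:R)) @ \oo --> (0 : R).
  rewrite -(mulr0 (2 * expR r)); apply: cvgMr.
  by have := cvg_series_cvg_0 (is_cvg_series_exp_coeff (2 * r)).
have /cvgrPdist_lt/(_ _ e0)[N _ hN] := c0.
exists N => n Nn w wr; apply: le_trans (cexp_remainder wr n) _.
apply: le_trans (ltW (hN n Nn)); rewrite /= sub0r normrN.
exact: ler_norm.
Qed.

End ComplexExponential.

(** * Identity theorem along the imaginary axis *)

Section AnalyticContinuation.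
Local Open Scope complex_scope.
Context {R : realType}.
Notation C := R[i].
Implicit Types (z w : C) (c : nat -> C).

Definition power_series_at (H : C -> C) z (r : R) c := forall w,
  cmod (w - z) < r -> forall e : R, 0 < e -> exists N, forall n, (N <= n)%N ->
    cmod (H w - \sum_(k < n) (w - z) ^+ k * c k) <= e.

Definition scalar_entire (H : C -> C) :=
  forall z, exists2 r, 0 < r & exists c, power_series_at H z r c.

(** Identity theorem: if zeros accumulate at the centre, the coefficients vanish one after the
    other, since at a nearby zero the first remaining term must be cancelled by a tail of higher
    order. *)
Lemma power_series_coeff_eq0 H z r c : 0 < r -> power_series_at H z r c ->
  (forall e : R, 0 < e -> exists w, [/\ w != z, cmod (w - z) < e & H w = 0]) ->
  forall k, c k = 0.
Proof.
move=> r0 Hc acc.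
pose s := r / 2; have s0 : 0 < s by rewrite divr_gt0.
have [B [B0 hB]] : exists B, 0 <= B /\ forall n, s ^+ n * cmod (c n) <= B.
  have [N hN] : exists N, forall n, (N <= n)%N ->
      cmod (H (z + s%:C) - \sum_(k < n) (z + s%:C - z) ^+ k * c k) <= 1.
    apply: Hc => //; rewrite addrAC subrr add0r cmodR gtr0_norm//.
    by rewrite ltr_pdivrMr// mulr_natr mulr2n ltrDl.
  (* From N on, a term is the difference of two partial sums that are both within 1 of the value of
     [H], whence the 2; the earlier terms are bounded by their sum. *)
  exists (2 + \sum_(k < N) s ^+ k * cmod (c k)).
  have sum0 : 0 <= \sum_(k < N) s ^+ k * cmod (c k).
    by apply: sumr_ge0 => k _; rewrite mulr_ge0 ?cmod_ge0// exprn_ge0// ltW.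
  split=> [|n]; first by rewrite addr_ge0.
  have [Nn|nN] := leqP N n; last first.
    rewrite (bigD1 (Ordinal nN))//= addrCA lerDl addr_ge0//.
    by apply: sumr_ge0 => k _; rewrite mulr_ge0 ?cmod_ge0// exprn_ge0// ltW.
  have h1 := hN n Nn; have h2 := hN n.+1 (leqW Nn).
  apply: (@le_trans _ _ 2); last by rewrite lerDl.
  have -> : s ^+ n * cmod (c n) = cmod (s%:C ^+ n * c n).
    by rewrite cmodM cmodX cmodR gtr0_norm.
  move: h1 h2; rewrite big_ord_recr /= addrAC subrr add0r.
  set S := \sum_(k < n) _; set y := H _; set u := s%:C ^+ n * c n => h1 h2.
  have -> : u = (y - S) - (y - (S + u)) by rewrite opprB addrC subrKA addrAC subrr add0r.
  by apply: le_trans (cmodB _ _) _; rewrite (_ : 2 = 1 + 1)// lerD.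
move=> k; have [n] := ubnP k; elim: n k => // n ih k; rewrite ltnS => kn.
have ck j : (j < k)%N -> c j = 0 by move=> jk; apply: ih; exact: leq_trans jk kn.
apply/eqP; rewrite -cmod_eq0 eq_le cmod_ge0 andbT.
have sk0 : 0 < s ^+ k by rewrite exprn_gt0.
rewrite -(pmulr_rle0 _ sk0); apply/ler_addgt0Pr => e e0; rewrite add0r.
(* With x = |w - z| / s, the first bound gives x <= 1/2, so the tail after order k is at most 2 B
   x^(k+1). Dividing by x^k leaves 2 B x, and the second bound makes this at most [e]. *)
pose dl := Num.min (s / 2) (s * e / (2 * B + 1)).
have B1 : 0 < 2 * B + 1 by rewrite ltr_wpDl// mulr_ge0.
have dl0 : 0 < dl by rewrite lt_min !divr_gt0// mulr_gt0.
have [w [wz wd Hw]] := acc dl dl0.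
pose x := cmod (w - z) / s.
have wz0 : 0 < cmod (w - z) by rewrite cmod_gt0 subr_eq0.
have x0 : 0 < x by rewrite divr_gt0.
have x12 : x <= 1 / 2.
  rewrite ler_pdivrMr//; apply: le_trans (ltW wd) _.
  apply: (@le_trans _ _ (s / 2)); first by rewrite /dl ge_min lexx.
  by rewrite mul1r mulrC.
have xe : 2 * B * x <= e.
  have : x <= e / (2 * B + 1).
    rewrite ler_pdivrMr//; apply: le_trans (ltW wd) _.
    apply: (@le_trans _ _ (s * e / (2 * B + 1))).
      by rewrite /dl ge_min lexx orbT.
    by rewrite -mulrA mulrC.
  rewrite ler_pdivlMr// mulrC; apply: le_trans.
  by rewrite ler_wpM2r ?(ltW x0)// lerDl.
have wr : cmod (w - z) < r.
  apply: lt_le_trans wd _; rewrite ge_min; apply/orP; left.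
  by rewrite /s ler_pdivrMr// ler_pdivrMr// -mulrA ler_peMr ?ltW//; lra.
have tail m : cmod (\sum_(j < m) (w - z) ^+ (k.+1 + j)%N * c (k.+1 + j)%N) <=
    2 * B * x ^+ k.+1 * (1 - (1 / 2) ^+ m).
  elim: m => [|m ihm]; first by rewrite big_ord0 cmod0 expr0 subrr mulr0.
  rewrite big_ord_recr /=; apply: le_trans (cmodD _ _) _.
  apply: (@le_trans _ _ (2 * B * x ^+ k.+1 * (1 - (1 / 2) ^+ m) +
     B * (x ^+ k.+1 * (1 / 2) ^+ m))).
    rewrite lerD// cmodM cmodX.
    have -> : cmod (w - z) = x * s by rewrite /x divfK// gt_eqF.
    rewrite exprMn -mulrA mulrC; apply: ler_pM.
    - by rewrite mulr_ge0 ?cmod_ge0// exprn_ge0// ltW.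
    - by rewrite exprn_ge0// ltW.
    - exact: hB.
    - rewrite exprD ler_wpM2l ?exprn_ge0// ?(ltW x0)//.
      by rewrite lerXn2r ?nnegrE// ?(ltW x0)//; lra.
  rewrite le_eqVlt; apply/orP; left; apply/eqP.
  by rewrite (exprS (1 / 2)); field.
have main : cmod ((w - z) ^+ k * c k) <= 2 * B * x ^+ k.+1.
  apply/ler_addgt0Pr => e' e'0.
  have [N hN] := Hc w wr e' e'0.
  have := hN (k.+1 + N)%N (leq_addl _ _).
  rewrite Hw sub0r cmodN big_split_ord /= big_ord_recr /= big1 ?add0r; last first.
    by move=> i _; rewrite ck ?mulr0.
  set u := _ * c k; set t := \sum_(i < N) _ => h.
  have -> : u = (u + t) - t by rewrite addrK.
  apply: le_trans (cmodB _ _) _; rewrite addrC lerD//.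
  apply: le_trans (tail N) _; rewrite ler_piMr//.
  by rewrite !mulr_ge0// exprn_ge0// ltW.
have xk0 : 0 < x ^+ k by rewrite exprn_gt0.
rewrite -(ler_pM2l xk0); apply: (@le_trans _ _ (x ^+ k * (2 * B * x))); last first.
  by rewrite ler_pM2l.
have -> : x ^+ k * (2 * B * x) = 2 * B * x ^+ k.+1 by rewrite exprSr; ring.
apply: le_trans main; rewrite cmodM cmodX mulrA -exprMn.
by rewrite /x divfK// gt_eqF.
Qed.

Lemma power_series_eq0 H z r c : power_series_at H z r c ->
  (forall k, c k = 0) -> forall w, cmod (w - z) < r -> H w = 0.
Proof.
move=> Hc c0 w wr; apply/eqP; rewrite -cmod_eq0 eq_le cmod_ge0 andbT.
apply/ler_addgt0Pr => e e0; rewrite add0r.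
have [N hN] := Hc w wr e e0; have := hN N (leqnn N).
by rewrite big1 ?subr0// => i _; rewrite c0 mulr0.
Qed.

(** Continuation along the segment from 0 to ib, parametrized by [0, 1]. At the supremum [m] of the
    parameters reached, accumulating zeros come from the segment already covered, or from the real
    axis if m = 0; the power series there then vanishes and leads past [m]. *)
Lemma scalar_entire_eq0 H : scalar_entire H -> (forall t : R, H t%:C = 0) ->
  forall b : R, H (0 +i* b) = 0.
Proof.
move=> HE Hreal b.
have [->|b0] := eqVneq b 0; first exact: (Hreal 0).
pose D := [set s : R | 0 <= s <= 1 /\ forall x, 0 <= x <= s -> H (0 +i* (x * b)) = 0].
have b'0 : 0 < `|b| by rewrite normr_gt0.
have distE (x y : R) : cmod ((0 +i* (x * b)) - (0 +i* (y * b))) = `|x - y| * `|b|.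
  rewrite -normrM /cmod /sqmod /= subrr expr0n add0r -mulrBl sqrtr_sqr//.
have D0 : D 0.
  split; first by rewrite lexx ler01.
  move=> x; rewrite -eq_le => /eqP <-; rewrite mul0r; exact: (Hreal 0).
have supD : has_sup D by split; [exists 0|exists 1 => x [/andP[]]].
pose m := sup D.
have m0 : 0 <= m by exact: sup_ubound supD.2 _ D0.
have m1 : m <= 1 by apply: sup_le_ub; [exists 0|move=> x [/andP[]]].
have below x : 0 <= x < m -> H (0 +i* (x * b)) = 0.
  move=> /andP[x0 xm]; have [s [s01 hs] xs] := sup_gt (ex_intro _ _ D0 : D !=set0) xm.
  by apply: hs; rewrite x0 ltW.
have [r r0 [c Hc]] := HE (0 +i* (m * b)).
have c0 : forall k, c k = 0.
  apply: (power_series_coeff_eq0 r0 Hc) => e e0.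
  have [mz|mn] := eqVneq m 0.
    exists (e / 2)%:C; rewrite mz mul0r.
    have e2 : 0 < e / 2 by rewrite divr_gt0.
    have -> : (0 +i* 0 : C) = 0 by [].
    rewrite subr0 cmodR gtr0_norm//; split; last exact: Hreal.
      by rewrite -(rmorph0 (real_complex R)) (inj_eq (@complexI R)) gt_eqF.
    by rewrite ltr_pdivrMr// mulr_natr mulr2n ltrDl.
  have mp : 0 < m by rewrite lt_def mn.
  pose x := Num.max (m / 2) (m - e / (2 * `|b|)).
  have xm : x < m.
    rewrite gt_max ltrBlDr ltrDl divr_gt0 ?mulr_gt0// andbT.
    by rewrite ltr_pdivrMr// mulr_natr mulr2n ltrDl.
  have x0 : 0 <= x by rewrite le_max divr_ge0.
  exists (0 +i* (x * b)); split; last by apply: below; rewrite x0.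
    apply/eqP => -[] /(mulIf b0) xm'; by rewrite xm' ltxx in xm.
  rewrite distE ltr0_norm ?subr_lt0// opprB.
  apply: (@le_lt_trans _ _ (e / (2 * `|b|) * `|b|)).
    apply: ler_wpM2r; first exact: ltW.
    by rewrite lerBlDr addrC -lerBlDr le_max lexx orbT.
  rewrite invfM mulrA divfK ?gt_eqF//.
  by rewrite ltr_pdivrMr// mulr_natr mulr2n ltrDl.
have nearm x : `|x - m| * `|b| < r -> H (0 +i* (x * b)) = 0.
  by move=> xm; apply: (power_series_eq0 Hc c0); rewrite distE.
have [m1'|m1'] := eqVneq m 1.
  by rewrite -[b]mul1r; apply: nearm; rewrite m1' subrr normr0 mul0r.
have ml1 : m < 1 by rewrite lt_neqAle m1'.
pose y := Num.min 1 (m + r / (2 * `|b|)).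
have rb0 : 0 < r / (2 * `|b|) by rewrite divr_gt0// mulr_gt0.
have my : m < y by rewrite lt_min ml1 ltrDl.
have Dy : D y.
  split; first by rewrite ge_min lexx andbT (le_trans m0)// ltW.
  move=> x /andP[x0 xy]; have [xm|mx] := ltP x m; first by apply: below; rewrite x0.
  apply: nearm; rewrite ger0_norm ?subr_ge0//.
  apply: (@le_lt_trans _ _ (r / (2 * `|b|) * `|b|)).
    apply: ler_wpM2r; first exact: ltW.
    rewrite lerBlDr; apply: le_trans xy _; rewrite ge_min; apply/orP; right.
    by rewrite addrC.
  rewrite invfM mulrA divfK ?gt_eqF//.
  by rewrite ltr_pdivrMr// mulr_natr mulr2n ltrDl.
by have := sup_ubound supD.2 Dy; rewrite leNgt my.
Qed.

End AnalyticContinuation.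

(** * The crossed product *)

Section ContinuousComplexFunctions.
Local Open Scope complex_scope.
Context {R : realType} {G : groupType} {mu : G -> R}.
Variable M : martin_compactification mu.
Notation X := (martin_boundary M).
Notation C := R[i].
Implicit Types f h : X -> C.

Lemma contC_dist f : contC f <->
  forall x (e : R), 0 < e -> \forall y \near x, cmod (f x - f y) < e.
Proof.
split=> [fc x e e0|h x].
  have e0' : 0 < e%:C :> C by rewrite ltcR.
  have := fc x; move/(@cvgrPdist_lt _ _ _ _ _ _ _)/(_ _ e0').
  by apply: filterS => y; rewrite normc_cmod ltcR.
apply/(@cvgrPdist_lt _ _ _ (nbhs x) _ _ _) => e e0.
have eE : e = (complex.Re e)%:C.
  by move: e0; rewrite ltcE => /andP[/eqP + _]; case: e => a b /= ->.
have e1 : 0 < complex.Re e by rewrite eE ltcR in e0.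
have := h x _ e1; apply: filterS => y hy.
by rewrite eE normc_cmod ltcR.
Qed.

Lemma contC_Re f : contC f -> continuous (fun x => complex.Re (f x) : R).
Proof.
move=> /contC_dist fc x; apply/(@cvgrPdist_lt _ _ _ (nbhs x) _ _ _) => e e0; have := fc x e e0.
by apply: filterS => y; apply: le_lt_trans; rewrite -cReB normr_Re_le.
Qed.

Lemma contC_Im f : contC f -> continuous (fun x => complex.Im (f x) : R).
Proof.
move=> /contC_dist fc x; apply/(@cvgrPdist_lt _ _ _ (nbhs x) _ _ _) => e e0; have := fc x e e0.
by apply: filterS => y; apply: le_lt_trans; rewrite -cImB normr_Im_le.
Qed.

Lemma contC_ReIm f : continuous (fun x => complex.Re (f x) : R) ->
  continuous (fun x => complex.Im (f x) : R) -> contC f.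
Proof.
move=> cre cim; apply/contC_dist => x e e0.
have e2 : 0 < e / 2 by rewrite divr_gt0.
have FX : Filter (nbhs x) by exact: nbhs_filter.
have h1 := (@cvgrPdist_lt _ _ _ _ FX _ _).1 (cre x) _ e2.
have h2 := (@cvgrPdist_lt _ _ _ _ FX _ _).1 (cim x) _ e2.
apply: (@filterS2 _ _ FX) h1 h2 => y h1 h2; apply: le_lt_trans (cmod_le_ReIm _) _.
by rewrite cReB cImB [e]splitr ltrD.
Qed.

Lemma contC_cst (c : C) : contC (fun _ : X => c).
Proof. by apply: contC_ReIm; exact: cst_continuous. Qed.

Lemma contCD f h : contC f -> contC h -> contC (fun x => f x + h x).
Proof.
move=> fc hc; apply: contC_ReIm => x.
  under eq_fun do rewrite cReD.
  by apply: (@cvgD _ _ _ (nbhs x)); exact: contC_Re.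
under eq_fun do rewrite cImD.
by apply: (@cvgD _ _ _ (nbhs x)); exact: contC_Im.
Qed.

Lemma contCM f h : contC f -> contC h -> contC (fun x => f x * h x).
Proof.
move=> fc hc; apply: contC_ReIm => x.
  under eq_fun do rewrite cReM.
  by apply: (@cvgB _ _ _ (nbhs x)); apply: (@cvgM _ _ (nbhs x));
    (exact: contC_Re || exact: contC_Im).
under eq_fun do rewrite cImM.
by apply: (@cvgD _ _ _ (nbhs x)); apply: (@cvgM _ _ (nbhs x));
  (exact: contC_Re || exact: contC_Im).
Qed.

Lemma contC_conj f : contC f -> contC (fun x => (f x)^*).
Proof.
have re (z : C) : complex.Re z^* = complex.Re z by case: z.
have im (z : C) : complex.Im z^* = - complex.Im z by case: z.
move=> fc; apply: contC_ReIm => x.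
  by under eq_fun do rewrite re; exact: contC_Re.
under eq_fun do rewrite im.
by apply: (@cvgN _ _ _ (nbhs x)); exact: contC_Im.
Qed.

Lemma contC_real (q : X -> R) : continuous q -> contC (fun x => (q x)%:C).
Proof. by move=> qc; apply: contC_ReIm => //; exact: cst_continuous. Qed.

Lemma contC_comp (a : X -> X) f : continuous a -> contC f -> contC (fun x => f (a x)).
Proof.
move=> ac fc; apply: contC_ReIm => x.
  apply: (@cvg_comp _ _ _ a (fun x => complex.Re (f x)) _ (nbhs (a x))).
    exact: ac.
  exact: contC_Re.
apply: (@cvg_comp _ _ _ a (fun x => complex.Im (f x)) _ (nbhs (a x))).
  exact: ac.
exact: contC_Im.
Qed.

Lemma contC_uniform_limit f :
  (forall e : R, 0 < e -> exists2 h, contC h & forall x, cmod (f x - h x) <= e) ->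
  contC f.
Proof.
move=> lim; apply/contC_dist => x e e0.
have e3 : 0 < e / 3 by rewrite divr_gt0.
have [h /contC_dist hc fh] := lim _ e3.
have := hc x _ e3; apply: filterS => y hxy.
have -> : f x - f y = (f x - h x) + ((h x - h y) - (f y - h y)) by ring.
apply: le_lt_trans (cmodD _ _) _; apply: le_lt_trans (lerD (fh x) (cmodB _ _)) _.
have := fh y; move: hxy; set u := cmod _; set v := cmod _; lra.
Qed.

Lemma contC_cmod_bounded f : contC f -> exists2 c, 0 <= c & forall x, cmod (f x) <= c.
Proof.
move=> /contC_bounded[c fc]; exists (Num.sqrt `|c|); first exact: sqrtr_ge0.
by move=> x; apply: ler_wsqrtr; apply: le_trans (fc x) _; exact: ler_norm.
Qed.

End ContinuousComplexFunctions.

Section NormComparison.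
Local Open Scope complex_scope.
Context {R : realType} {I : choiceType}.
Local Notation N := (@ell2_norm R I).

Lemma ell2_norm_le_pointwise (c : R) (v w : ell2 R I) : 0 <= c ->
  (forall p, sqmod (v p) <= c ^+ 2 * sqmod (w p)) -> N v <= c * N w.
Proof.
move=> c0 h.
rewrite -(@ler_pXn2r _ 2)// ?nnegrE ?mulr_ge0 ?ell2_norm_ge0//.
rewrite exprMn -!rdot_norm /rdot -rsumZ; last exact: rdot_summable.
apply: ler_rsum => [||p]; first exact: rdot_summable.
  by apply: abs_summableZ; exact: rdot_summable.
by rewrite /rdot_term -!expr2; exact: h.
Qed.

End NormComparison.

Section CrossedProductAlgebra.
Local Open Scope complex_scope.
Context {R : realType} {G : groupType} {mu : G -> R}.
Variable M : martin_compactification mu.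
Notation X := (martin_boundary M).
Notation C := R[i].
Notation I := (G * X)%type.
Notation op := (ell2 R I -> ell2 R I).
Local Notation N := (@ell2_norm R I).
Notation B := (@algebraic_crossed_product R G mu M).
Notation A := (@reduced_crossed_product R G mu M).
Implicit Types (f : X -> C) (v w : ell2 R I) (g : G).

Definition gen f g : op := mult_op f \o canonical_unitary g.

Lemma genE f g v p : contC f -> gen f g v p = f (bact p.1 p.2) * v ((g^-1 * p.1)%g, p.2).
Proof. by move=> fc; rewrite /gen /= mult_opE// canonical_unitaryE. Qed.

Lemma gen_linear f g : contC f -> linear_op (gen f g).
Proof.
move=> fc c v w; apply: ell2P => p.
by rewrite ell2D ell2Z !(genE g _ p fc) ell2D ell2Z mulrDr mulrCA.
Qed.

Lemma canonical_unitary_norm g v : N (@canonical_unitary R G mu M g v) = N v.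
Proof.
congr (Num.sqrt (fine _)); rewrite /sqnorm.
rewrite [RHS](reindex_esum [set: I] [set: I] (fun p => ((g^-1 * p.1)%g, p.2)))//.
  by apply: eq_esum => p _; rewrite canonical_unitaryE.
split => // [[a x] [b y] _ _ /= [/mulgI -> ->]//|[a x] _].
by exists ((g * a)%g, x) => //=; rewrite mulKg.
Qed.

Lemma mult_op_norm f c : contC f -> 0 <= c -> (forall x, cmod (f x) <= c) ->
  opnorm_le (mult_op f) c.
Proof.
move=> fc c0 h v; apply: ell2_norm_le_pointwise => // p.
rewrite mult_opE// sqmodM ler_wpM2r ?sqmod_ge0// -sqr_cmod.
by rewrite ler_pXn2r// ?nnegrE// cmod_ge0.
Qed.

Lemma gen_norm f g c : contC f -> 0 <= c -> (forall x, cmod (f x) <= c) ->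
  opnorm_le (gen f g) c.
Proof.
by move=> fc c0 h v; have := mult_op_norm fc c0 h (canonical_unitary g v);
  rewrite canonical_unitary_norm.
Qed.

Lemma gen_bounded f g : contC f -> bounded_op (gen f g).
Proof.
move=> fc; split; first exact: gen_linear.
by have [c c0 h] := contC_cmod_bounded fc; exists c => //; exact: gen_norm.
Qed.

Lemma genD f h g : contC f -> contC h ->
  gen (fun x => f x + h x) g = gen f g + gen h g.
Proof.
move=> fc hc; apply/funext => v; apply: ell2P => p.
rewrite (genE g v p (contCD fc hc)) -[RHS]/((gen f g v + gen h g v) p) [RHS]ell2D.
by rewrite (genE g v p fc) (genE g v p hc) mulrDl.
Qed.

Lemma genZ (c : C) f g : contC f -> gen (fun x => c * f x) g = c *: gen f g.
Proof.
move=> fc; apply/funext => v; apply: ell2P => p.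
have fc' : contC (fun x => c * f x) := contCM (@contC_cst _ _ _ M c) fc.
rewrite (genE g v p fc') -[RHS]/((c *: gen f g v) p) [RHS]ell2Z.
by rewrite (genE g v p fc) mulrA.
Qed.

Lemma gen_one : gen (fun=> 1) 1%g = id.
Proof.
apply/funext => v; apply: ell2P => -[x xi].
by rewrite genE; [rewrite invg1 mul1g mul1r|exact: contC_cst].
Qed.

Lemma mult_op_gen f : contC f -> mult_op f = gen f 1%g.
Proof.
move=> fc; apply/funext => v; apply: ell2P => -[x xi].
by rewrite genE// mult_opE// invg1 mul1g.
Qed.

Lemma gen_comp f g h k : contC f -> contC h ->
  gen f g \o gen h k = gen (fun x => f x * h (bact g^-1%g x)) (g * k)%g.
Proof.
move=> fc hc; apply/funext => v; apply: ell2P => -[x xi] /=.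
have hgc : contC (fun x => h (bact g^-1%g x)).
  exact: (contC_comp (@bact_continuous _ _ _ M g^-1%g) hc).
rewrite (genE g _ _ fc) (genE k _ _ hc) (genE _ v _ (contCM fc hgc)) /=.
by rewrite bactM mulrA invgM mulgA.
Qed.

Lemma gen_adjoint f g : contC f ->
  radjoint (gen f g) (gen (fun x => (f (bact g x))^*) g^-1%g).
Proof.
move=> fc v w.
have fc' : contC (fun x => (f (bact g x))^*).
  exact: (contC_conj (contC_comp (@bact_continuous _ _ _ M g) fc)).
rewrite /rdot /rsum.
have E p : rdot_term (gen f g v) w ((g * p.1)%g, p.2) =
    rdot_term v (gen (fun x => (f (bact g x))^*) g^-1%g w) p.
  rewrite /rdot_term (genE _ _ _ fc) (genE _ _ _ fc') /= mulKg invgK bactM.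
  case: p => x xi /=.
  case: (f _) (v _) (w _) => a b [c d] [y z] /=; ring.
have re (F H : I -> R) : (forall p, F ((g * p.1)%g, p.2) = H p) ->
    (\esum_(i in [set: I]) (F i)%:E = \esum_(i in [set: I]) (H i)%:E)%E.
  move=> FH; rewrite (reindex_esum [set: I] [set: I] (fun p => ((g * p.1)%g, p.2)))//.
    by apply: eq_esum => p _; rewrite -FH.
  split => // [[a x] [b y] _ _ /= [/mulgI -> ->]//|[a x] _].
  by exists ((g^-1 * a)%g, x) => //=; rewrite mulVKg.
by congr (fine _ - fine _); apply: re => p; rewrite -E.
Qed.

Lemma acp0 : B 0.
Proof. by exists [::], (fun _ _ => 0); split => [g|]; [exact: contC_cst|rewrite big_nil]. Qed.

Lemma acp_genD f g T : contC f -> B T -> B (gen f g + T).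
Proof.
move=> fc [s [F [Fc ->]]].
have [gs|gs] := boolP (g \in s); last first.
  exists (g :: s), (fun h => if h == g then f else F h); split.
    by move=> h; case: eqP => _; [exact: fc|exact: Fc].
  rewrite big_cons eqxx; congr (_ + _); apply: eq_big_seq => h hs.
  by case: eqP hs gs => [->|//] ->.
(* A sum in the algebra has one function per group element, but its index sequence may repeat. If
   [g] occurs [k] times, each occurrence must receive the share f / k. *)
have [k kE] : exists k, count_mem g s = k by exists (count_mem g s).
have k0 : (k%:R : C) != 0 by rewrite pnatr_eq0 -lt0n -kE -has_count has_pred1.
exists s, (fun h => if h == g then (fun x => F h x + k%:R^-1 * f x) else F h).
have fkc : contC (fun x : X => (k%:R^-1 : C) * f x).
  exact: (contCM (@contC_cst _ _ _ M _) fc).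
split=> [h|].
  by case: eqP => _; [exact: (contCD (Fc h) fkc)|exact: Fc].
rewrite [RHS](_ : _ = \sum_(h <- s) (gen (F h) h +
    (if h == g then k%:R^-1 *: gen f g else 0))); last first.
  apply: eq_bigr => h _; case: eqP => [->|_]; last by rewrite addr0.
  by rewrite -(genZ _ g fc) -(genD g (Fc g) fkc).
rewrite big_split /= addrC; congr (_ + _).
rewrite -big_mkcond /= big_const_seq kE.
have -> : iter k (+%R (k%:R^-1 *: gen f g)) 0 = (k%:R^-1 *: gen f g) *+ k.
  by elim: k {kE k0 fkc} (k%:R^-1) => [|n ih] //= a; rewrite ih mulrS.
by rewrite -scaler_nat scalerA mulfV// scale1r.
Qed.

Lemma acp_ind (Q : op -> Prop) : Q 0 ->
  (forall f g T, contC f -> Q T -> Q (gen f g + T)) -> forall T, B T -> Q T.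
Proof.
move=> Q0 QD _ [s [F [Fc ->]]]; elim: s => [|g s ih]; first by rewrite big_nil.
by rewrite big_cons; exact: QD.
Qed.

Lemma acp_gen f g : contC f -> B (gen f g).
Proof. by move=> fc; rewrite -[gen f g]addr0; apply: acp_genD => //; exact: acp0. Qed.

Lemma bounded_opD (S T : op) : bounded_op S -> bounded_op T -> bounded_op (S + T).
Proof.
move=> [Sl [a a0 Sa]] [Tl [b b0 Tb]]; split.
  by have := linear_op_lin 1 Sl Tl; rewrite scale1r.
by exists (a + b); [exact: addr_ge0|exact: opnorm_leD].
Qed.

Lemma acp_bounded T : B T -> bounded_op T.
Proof.
move: T; apply: acp_ind => [|f g T fc Tb].
  split; first by move=> c v w; rewrite scaler0 addr0.
  by exists 0 => // v; rewrite ell2_norm0 mul0r.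
by apply: bounded_opD => //; exact: gen_bounded.
Qed.

Lemma acp_lin (c : C) S T : B S -> B T -> B (c *: S + T).
Proof.
move=> BS BT; move: S BS; apply: acp_ind => [|f g S fc ih].
  by rewrite scaler0 add0r.
rewrite scalerDr -addrA -(genZ c g fc); apply: acp_genD ih.
exact: (contCM (@contC_cst _ _ _ M c) fc).
Qed.

Lemma acpD S T : B S -> B T -> B (S + T).
Proof. by move=> BS BT; rewrite -[S]scale1r; exact: acp_lin. Qed.

Lemma acp_comp S T : B S -> B T -> B (S \o T).
Proof.
move=> BS BT; move: S BS; apply: acp_ind => [|f g S fc ih].
  by rewrite (_ : _ \o _ = 0)//; exact: acp0.
rewrite (_ : _ \o _ = gen f g \o T + (S \o T))//; apply: acpD ih.
move: T BT; apply: acp_ind => [|h k T hc ih].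
  rewrite (_ : _ \o _ = 0); first exact: acp0.
  by apply/funext => v /=; rewrite (linear_op0 (gen_linear _ fc)).
rewrite (_ : _ \o _ = gen f g \o gen h k + (gen f g \o T)); last first.
  by apply/funext => v; rewrite /= !opE_add /= (linear_opD _ _ (gen_linear _ fc)).
apply: acpD ih; rewrite (gen_comp g k fc hc); apply: acp_gen.
exact: (contCM fc (contC_comp (@bact_continuous _ _ _ M g^-1%g) hc)).
Qed.

Lemma acp_id : B id.
Proof. by rewrite -gen_one; apply: acp_gen; exact: contC_cst. Qed.

Lemma acp_adj T : B T -> exists2 T', B T' & radjoint T T'.
Proof.
move: T; apply: acp_ind => [|f g T fc [T' BT' TT']].
  exists 0; first exact: acp0.
  move=> v w; rewrite -[X in rdot X _](scale0r 0) -[X in _ = rdot _ X](scale0r 0).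
  by rewrite -(rmorph0 (real_complex R)) rdotZl rdotZr !mul0r.
have fc' : contC (fun x => (f (bact g x))^*).
  exact: (contC_conj (contC_comp (@bact_continuous _ _ _ M g) fc)).
exists (gen (fun x => (f (bact g x))^*) g^-1%g + T'); first exact: (acp_genD _ fc' BT').
by move=> v w; rewrite !opE_add rdotDl rdotDr (gen_adjoint g fc) TT'.
Qed.

Definition crossed_sub := @closure_sub R I B.
Definition crossed_bounded := @closure_bounded R I B acp_bounded.
Definition crossed_lin := @closure_lin R I B acp_lin.
Definition crossed_comp := @closure_comp R I B acp_bounded acp_comp.
Definition crossed_contractive := @star_endomorphism_contractive R I B
  acp_bounded acp_lin acp_comp acp_id acp_adj.

Lemma crossed_gen f g : contC f -> A (gen f g).
Proof. by move=> fc; apply: crossed_sub; exact: acp_gen. Qed.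

Definition entry (T : op) (p q : I) : C := T (delta q) p.

Lemma entry_le T c p q : opnorm_le T c -> cmod (entry T p q) <= c.
Proof.
move=> Tc; have c0 : 0 <= c.
  have := Tc (delta q); rewrite norm_delta mulr1; apply: le_trans.
  exact: ell2_norm_ge0.
rewrite -(@ler_pXn2r _ 2)// ?nnegrE ?cmod_ge0// sqr_cmod.
apply: le_trans (sqmod_le_norm _ _) _.
rewrite ler_pXn2r// ?nnegrE ?ell2_norm_ge0//.
by have := Tc (delta q); rewrite norm_delta mulr1.
Qed.

Lemma entryB S T p q : entry (S - T) p q = entry S p q - entry T p q.
Proof. by rewrite /entry opE_sub ell2B. Qed.

Lemma entryD S T p q : entry (S + T) p q = entry S p q + entry T p q.
Proof. by rewrite /entry opE_add ell2D. Qed.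

Lemma entry0 p q : entry 0 p q = 0. Proof. by rewrite /entry ell20. Qed.

Lemma entry_gen f g (p q : I) : contC f ->
  entry (gen f g) p q = f (bact p.1 p.2) * (((g^-1 * p.1)%g, p.2) == q)%:R.
Proof. by move=> fc; rewrite /entry genE// deltaE. Qed.

(** For T a finite sum of terms f_h U_h this is the coefficient function of the inverse of [g]. With
    g = 1 it is the canonical conditional expectation onto C(X). *)
Definition column g T (xi : X) : C := entry T (1%g, xi) (g, xi).

Lemma column_gen f h g xi : contC f ->
  column g (gen f h) xi = f xi * (h^-1%g == g)%:R.
Proof. by move=> fc; rewrite /column entry_gen//= bact1 mulg1 xpair_eqE eqxx andbT. Qed.

Lemma column_continuous g T : A T -> contC (column g T).
Proof.
move=> AT; apply: contC_uniform_limit => e e0.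
have [S BS TS] := AT e e0; exists (column g S); last first.
  by move=> x; rewrite -entryB; exact: entry_le.
move: S BS {TS}; apply: acp_ind => [|f h S fc ih].
  by rewrite /column; under eq_fun do rewrite entry0; exact: contC_cst.
rewrite /column; under eq_fun do rewrite entryD.
have E : (fun x : X => f x * (h^-1%g == g)%:R) = column g (gen f h).
  by apply/funext => x; rewrite (column_gen h g x fc).
have H : contC (fun x : X => f x * (h^-1%g == g)%:R).
  exact: (contCM fc (@contC_cst _ _ _ M _)).
by rewrite E in H; exact: (contCD H ih).
Qed.

(** Entries of the crossed product are unchanged when (x, xi) is replaced by (x g, g^-1 xi) in both
    indices, because generators see a point only through its translate [bact x xi]. It suffices to
    check this on the algebra, entries being bounded by the norm. *)
Lemma entry_equivariant T g xi : A T ->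
  entry T (g^-1%g, xi) (1%g, xi) = column g T (bact g^-1%g xi).
Proof.
move=> AT; apply/eqP; rewrite -subr_eq0 -cmod_eq0 eq_le cmod_ge0 andbT.
apply/ler_addgt0Pr => e e0; rewrite add0r.
have e2 : 0 < e / 2 by rewrite divr_gt0.
have [S BS TS] := AT _ e2.
have SE : entry S (g^-1%g, xi) (1%g, xi) = column g S (bact g^-1%g xi).
  move: S BS {TS}; apply: acp_ind => [|f h S fc ih].
    by rewrite /column !entry0.
  rewrite /column !entryD ih -/(column _ _ _) (column_gen h g _ fc) (entry_gen _ _ _ fc) /=.
  rewrite /column; congr (_ * _%:R + _); rewrite xpair_eqE eqxx andbT.
  by rewrite -(inj_eq (mulIg g)) mulgVK mul1g.
rewrite (_ : _ - _ = entry (T - S) (g^-1%g, xi) (1%g, xi) -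
  entry (T - S) (1%g, bact g^-1%g xi) (g, bact g^-1%g xi)); last first.
  by rewrite !entryB SE /column; ring.
apply: le_trans (cmodB _ _) _; rewrite [e]splitr lerD//; exact: entry_le.
Qed.

End CrossedProductAlgebra.

(** * KMS states and conformal functionals *)

Section CexpOfRealFunctions.
Local Open Scope complex_scope.
Context {R : realType} {G : groupType} {mu : G -> R}.
Variable M : martin_compactification mu.
Notation X := (martin_boundary M).

Lemma contC_cexp (c : R[i]) (q : X -> R) : continuous q ->
  contC (fun x => cexp (c * (q x)%:C)).
Proof.
move=> qc.
have lin (a : R) : continuous (fun x => a * q x).
  by move=> x; apply: (@cvgMr _ _ (nbhs x)); exact: qc.
have re (x : R) : complex.Re (c * x%:C) = complex.Re c * x.
  by rewrite cReM /= mulr0 subr0.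
have im (x : R) : complex.Im (c * x%:C) = complex.Im c * x.
  by rewrite cImM /= mulr0 add0r.
have comp (h : R -> R) (a : R) : continuous h -> continuous (fun x => h (a * q x)).
  by move=> hc x; apply: (@cvg_comp _ _ _ (fun x => a * q x) h _ (nbhs (a * q x)));
    [exact: lin|exact: hc].
rewrite /cexp; under eq_fun do rewrite re im.
apply: contCM; first by apply: contC_real; apply: comp; exact: continuous_expR.
by apply: contC_ReIm; apply: comp; [exact: continuous_cos|exact: continuous_sin].
Qed.

Lemma cis_cexp (t x : R) : cis (- (t * x)) = cexp (- imagC * t%:C * x%:C) :> R[i].
Proof.
rewrite -cexpI; congr cexp; apply/eqP.
by rewrite eq_complex /= !(mul0r, mulr0, subr0, addr0, add0r, mulN1r, oppr0) !eqxx mulNr eqxx.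
Qed.

End CexpOfRealFunctions.

Section MartinFlow.
Local Open Scope complex_scope.
Context {R : realType} {G : groupType}.
Variable mu : G -> R.
Hypothesis walk : random_walk mu.
Hypothesis trans : transient mu.
Variables (d : G -> G -> nat) (C0 : R).
Hypothesis C_gt0 : 0 < C0.
Hypothesis harnack : forall x y z, green mu x z / green mu y z <= C0 ^+ d x y.
Variable M : martin_compactification mu.
Notation X := (martin_boundary M).
Notation C := R[i].
Notation I := (G * X)%type.
Notation op := (ell2 R I -> ell2 R I).
Notation A := (reduced_crossed_product M).
Variable alpha : R -> op -> op.
Hypothesis alpha_flow : martin_flow M alpha.

Let kernel_gt0 g (xi : X) : 0 < bkernel g xi.
Proof. exact: (bkernel_gt0 walk trans C_gt0 harnack). Qed.

Let lnk g (xi : X) : R := ln (bkernel g xi).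

Let lnk_continuous g : continuous (lnk g).
Proof.
move=> x; apply: (@cvg_comp _ _ _ (bkernel g) (@ln R) _ (nbhs (bkernel g x))).
  exact: bkernel_continuous.
by apply: continuous_ln; exact: kernel_gt0.
Qed.

Let alpha_star t : star_endomorphism A (alpha t).
Proof. exact: (flow_star alpha_flow.1 t). Qed.

Let twist t g (xi : X) : C := cexp (- imagC * t%:C * (lnk g^-1%g xi)%:C).

Let twist_cont t g : contC (twist t g).
Proof. exact: (contC_cexp (@lnk_continuous g^-1%g)). Qed.

Let alpha_gen t f g : contC f -> alpha t (gen f g) = gen f g \o mult_op (twist t g).
Proof.
move=> fc; rewrite /gen (alpha_flow.2 t f g fc).
by congr (_ \o mult_op _); apply/funext => xi; rewrite cis_cexp.
Qed.

Let alpha_id t : alpha t id = id.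
Proof.
have c1 := @contC_cst _ _ _ M 1.
rewrite -(@gen_one _ _ _ M) (alpha_gen t 1%g c1) (@gen_one _ _ _ M).
have -> : twist t 1%g = fun=> 1.
  apply/funext => xi; rewrite /twist /lnk invg1 (bkernel1 walk trans) ln1 mulr0.
  by rewrite -[0]/(0%:C) cexpR expR0.
by rewrite (mult_op_gen c1) (@gen_one _ _ _ M).
Qed.

Let alphaD t a b : A a -> A b -> alpha t (a + b) = alpha t a + alpha t b.
Proof.
by move=> Aa Ab; have := star_endo_linear (alpha_star t) 1 Aa Ab; rewrite !scale1r.
Qed.

Let A0 : A 0.
Proof. exact: (crossed_sub (@acp0 _ _ _ M)). Qed.

Let alpha0 t : alpha t 0 = 0.
Proof.
have := star_endo_linear (alpha_star t) (-1) A0 A0.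
by rewrite scaler0 addr0 scaleN1r addNr.
Qed.

Let A_sub a b : A a -> A b -> A (a - b).
Proof.
by move=> Aa Ab; rewrite addrC -scaleN1r; exact: (crossed_lin (-1) Ab Aa).
Qed.

Let alphaB t a b : A a -> A b -> alpha t (a - b) = alpha t a - alpha t b.
Proof.
move=> Aa Ab; have := star_endo_linear (alpha_star t) (-1) Ab Aa.
by rewrite !scaleN1r addrC => ->; rewrite addrC.
Qed.

(** On generators this is the definition of the flow. It passes to norm limits because [alpha t] is
    contractive and the factor has modulus 1. *)
Lemma column_flow t g a xi : A a ->
  column g (alpha t a) xi =
  cexp (- imagC * t%:C * (lnk g (bact g xi))%:C) * column g a xi.
Proof.
move=> Aa; set u := cexp _.
have u1 : cmod u = 1.
  rewrite cmod_cexp cReM /= !(mul0r, mulr0, subr0, oppr0, addr0) expR0//.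
have alg S : algebraic_crossed_product S -> column g (alpha t S) xi = u * column g S xi.
  suff: forall T, algebraic_crossed_product T ->
      A T /\ column g (alpha t T) xi = u * column g T xi.
    by move=> H BS; exact: (H S BS).2.
  apply: acp_ind => [|f h T fc [AT ih]].
    by rewrite alpha0 /column !entry0 mulr0.
  split.
    by have := crossed_lin 1 (crossed_gen h fc) AT; rewrite scale1r.
  rewrite (alphaD t (crossed_gen h fc) AT) /column !entryD mulrDr.
  congr (_ + _); last exact: ih.
  rewrite (alpha_gen t h fc) (entry_gen _ _ _ fc) /entry /=.
  rewrite (genE h _ _ fc) (mult_opE _ _ (@twist_cont t h)) deltaE /= bact1 mulg1.
  rewrite [RHS]mulrCA; congr (_ * _).
  case: eqP => [[E]|_]; last by rewrite !mulr0.
  by rewrite !mulr1 /twist /u -E.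
apply/eqP; rewrite -subr_eq0 -cmod_eq0 eq_le cmod_ge0 andbT.
apply/ler_addgt0Pr => e e0; rewrite add0r.
have e2 : 0 < e / 2 by rewrite divr_gt0.
have [S BS aS] := Aa _ e2.
have AS : A S := crossed_sub BS.
have AaS := A_sub Aa AS.
have h1 := crossed_contractive (alpha_star t) (alpha_id t) AaS (ltW e2) aS.
rewrite (alphaB t Aa AS) in h1.
have -> : column g (alpha t a) xi - u * column g a xi =
    entry (alpha t a - alpha t S) (1%g, xi) (g, xi) - u * entry (a - S) (1%g, xi) (g, xi).
  by rewrite !entryB -![entry _ _ _]/(column g _ xi) (alg S BS); ring.
apply: le_trans (cmodB _ _) _; rewrite cmodM u1 mul1r [e]splitr.
by apply: lerD; apply: entry_le.
Qed.

Lemma entryZ (c : C) (T : op) p q : entry (c *: T) p q = c * entry T p q.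
Proof. by rewrite /entry opE_scale ell2Z. Qed.

Lemma entry_sum n (T : nat -> op) (z : nat -> C) p q :
  entry (\sum_(k < n) z k *: T k) p q = \sum_(k < n) z k * entry (T k) p q.
Proof.
elim: n => [|n ih]; first by rewrite !big_ord0 entry0.
by rewrite !big_ord_recr /= entryD entryZ ih.
Qed.

(** Both sides extend from the real line to entire functions of z, where [column_flow] identifies
    them; the identity theorem compares them at ib, where exp(m z) becomes the power [b] of the
    kernel. *)
Lemma column_analytic_extension a F g xi (b : R) :
  analytic_extension A alpha a F -> A a ->
  column g (F (0 +i* b)) xi = (bkernel g (bact g xi) `^ b)%:C * column g a xi.
Proof.
move=> [AF FE Ft] Aa.
pose m : C := - imagC * (lnk g (bact g xi))%:C.
pose c0 := column g a xi.
pose H z := column g (F z) xi - cexp (m * z) * c0.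
have HE : scalar_entire H.
  move=> z; have [r r0 [c Ac hc]] := FE z; exists r => //.
  exists (fun k => entry (c k) (1%g, xi) (g, xi) - c0 * cexp (m * z) * (m ^+ k / k`!%:R)).
  move=> w wr e e0.
  have e2 : 0 < e / 2 by rewrite divr_gt0.
  have wr' : `|w - z| < r%:C by rewrite normc_cmod ltcR.
  have [N1 hN1] := hc w wr' _ e2.
  pose B := cmod (c0 * cexp (m * z)).
  have B0 : 0 <= B by exact: cmod_ge0.
  have e3 : 0 < e / 2 / (B + 1) by rewrite divr_gt0// ltr_wpDl.
  have [N2 hN2] := cexp_taylor (cmod_ge0 (m * (w - z))) e3.
  exists (maxn N1 N2) => n; rewrite geq_max => /andP[n1 n2].
  have h1 := entry_le (1%g, xi) (g, xi) (hN1 n n1).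
  have h2 := hN2 n n2 (m * (w - z)) (lexx _).
  have -> : H w - \sum_(k < n) (w - z) ^+ k *
      (entry (c k) (1%g, xi) (g, xi) - c0 * cexp (m * z) * (m ^+ k / k`!%:R)) =
    entry (F w - \sum_(k < n) (w - z) ^+ k *: c k) (1%g, xi) (g, xi) -
    c0 * cexp (m * z) * (cexp (m * (w - z)) -
       \sum_(k < n) cexp_coeff (m * (w - z)) k).
    rewrite entryB (entry_sum _ (fun k => c k) (fun k => (w - z) ^+ k)).
    rewrite /H -[entry (F w) _ _]/(column g (F w) xi).
    have -> : cexp (m * w) = cexp (m * z) * cexp (m * (w - z)).
      by rewrite -cexpD; congr cexp; ring.
    have -> : \sum_(k < n) (w - z) ^+ k *
        (entry (c k) (1%g, xi) (g, xi) - c0 * cexp (m * z) * (m ^+ k / k`!%:R)) =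
      \sum_(k < n) (w - z) ^+ k * entry (c k) (1%g, xi) (g, xi) -
      c0 * cexp (m * z) * \sum_(k < n) cexp_coeff (m * (w - z)) k.
      rewrite mulr_sumr -sumrB; apply: eq_bigr => k _.
      by rewrite /cexp_coeff [(m * _) ^+ k]exprMn; ring.
    by ring.
  apply: le_trans (cmodB _ _) _; rewrite [e]splitr; apply: lerD => //.
  rewrite cmodM -/B; apply: le_trans (ler_wpM2l B0 h2) _.
  by apply: mul_div_succ_le => //; exact: ltW.
have Hreal (t : R) : H t%:C = 0.
  have -> : H t%:C = column g (alpha t a) xi - cexp (m * t%:C) * c0 by rewrite /H Ft.
  by rewrite (column_flow t g xi Aa) /m /c0 [- imagC * t%:C * _]mulrAC subrr.
have := scalar_entire_eq0 HE Hreal b; rewrite /H => /eqP; rewrite subr_eq0 => /eqP ->.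
congr (_ * _); rewrite /powR gt_eqF ?kernel_gt0// -cexpR; congr cexp.
apply/eqP; rewrite /m eq_complex /= /lnk.
by rewrite !(mul0r, mulr0, subr0, sub0r, addr0, add0r, mulN1r, oppr0, mulNr, opprK) eqxx mulrC eqxx.
Qed.

Section KMSOfConformal.
Local Open Scope complex_scope.
Variables (beta : R) (nu : (X -> R) -> R).
Hypothesis nu_conf : conformal beta nu.

Let nu_abs_le q c : (forall x, `|q x| <= c) -> `|nu q| <= c.
Proof.
exact: (functional_abs_le (conformal_linear nu_conf) (conformal_ge0 nu_conf)
  (conformal_one nu_conf)).
Qed.

Let nuC (f : X -> C) : C :=
  nu (fun x => complex.Re (f x)) +i* nu (fun x => complex.Im (f x)).

Let boundedC (f : X -> C) := exists c, forall x, cmod (f x) <= c.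

Let boundedC_Re f : boundedC f -> bounded_fun_on (fun x => complex.Re (f x)).
Proof. by move=> [c fc]; exists c => x; apply: le_trans (normr_Re_le _) _. Qed.

Let boundedC_Im f : boundedC f -> bounded_fun_on (fun x => complex.Im (f x)).
Proof. by move=> [c fc]; exists c => x; apply: le_trans (normr_Im_le _) _. Qed.

Let nuC_linear (c : C) f h : boundedC f -> boundedC h ->
  nuC (fun x => c * f x + h x) = c * nuC f + nuC h.
Proof.
move=> bf bh; apply/eqP; rewrite eq_complex; apply/andP; split; apply/eqP => /=.
  rewrite cReD cReM /=.
  have -> : (fun x => complex.Re (c * f x + h x)) = (fun x =>
      complex.Re c * complex.Re (f x) +
      (- complex.Im c * complex.Im (f x) + complex.Re (h x))).
    by apply/funext => x; rewrite cReD cReM; ring.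
  rewrite (conformal_linear nu_conf); first last.
  - apply: bounded_fun_onD (boundedC_Re bh); apply: bounded_fun_onZ.
    exact: boundedC_Im.
  - exact: boundedC_Re.
  rewrite (conformal_linear nu_conf); last 2 first.
  - exact: boundedC_Im.
  - exact: boundedC_Re.
  by ring.
rewrite cImD cImM /=.
have -> : (fun x => complex.Im (c * f x + h x)) = (fun x =>
    complex.Re c * complex.Im (f x) +
    (complex.Im c * complex.Re (f x) + complex.Im (h x))).
  by apply/funext => x; rewrite cImD cImM; ring.
rewrite (conformal_linear nu_conf); first last.
- apply: bounded_fun_onD (boundedC_Im bh); apply: bounded_fun_onZ.
  exact: boundedC_Re.
- exact: boundedC_Im.
rewrite (conformal_linear nu_conf); last 2 first.
- exact: boundedC_Re.
- exact: boundedC_Im.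
by ring.
Qed.

Let nuC_le f c : (forall x, cmod (f x) <= c) -> cmod (nuC f) <= 2 * c.
Proof.
move=> fc; apply: le_trans (cmod_le_ReIm _) _; rewrite mulr_natl mulr2n /=.
apply: lerD; apply: nu_abs_le => x; apply: le_trans (fc x).
  exact: normr_Re_le.
exact: normr_Im_le.
Qed.

Let nuC_act g f : contC f ->
  nuC (fun xi => (bkernel g xi `^ beta)%:C * f (bact g^-1%g xi)) = nuC f.
Proof.
move=> fc; rewrite /nuC; congr (_ +i* _).
  rewrite -[RHS](conformal_act nu_conf g (contC_Re fc)); congr nu.
  by apply/funext => xi; rewrite cReM /= mul0r subr0 mulrC.
rewrite -[RHS](conformal_act nu_conf g (contC_Im fc)); congr nu.
by apply/funext => xi; rewrite cImM /= mul0r addr0 mulrC.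
Qed.

Let omega (T : op) : C := nuC (column 1%g T).

Let column_bounded g T : A T -> boundedC (column g T).
Proof.
move=> AT; have [_ [c c0 Tc]] := crossed_bounded AT; exists c => x.
exact: entry_le.
Qed.

Let omega_linear (c : C) a b : A a -> A b ->
  omega (c *: a + b) = c * omega a + omega b.
Proof.
move=> Aa Ab; rewrite /omega -nuC_linear; try exact: column_bounded.
by congr nuC; apply/funext => x; rewrite /column entryD entryZ.
Qed.

Let omegaB a b : A a -> A b -> omega (a - b) = omega a - omega b.
Proof.
by move=> Aa Ab; rewrite addrC -scaleN1r omega_linear// mulN1r addrC.
Qed.

Let omega_le T c : opnorm_le T c -> cmod (omega T) <= 2 * c.
Proof. by move=> Tc; apply: nuC_le => x; exact: entry_le. Qed.

Let Im_entry (v : ell2 R I) p : rdot v (imagC *: delta p) = complex.Im (v p).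
Proof.
have tE j : rdot_term v (imagC *: delta p) j = if j == p then complex.Im (v j) else 0.
  rewrite /rdot_term (ell2Z imagC (delta p) j) deltaE.
  by case: eqP => _; case: (v j) => a b; rewrite /imagC /=; ring.
rewrite /rdot (@rsum_single _ _ p) => [|j /negPf jp]; by rewrite tE ?eqxx ?jp.
Qed.

Let rdot_imag (v : ell2 R I) : rdot v (imagC *: v) = 0.
Proof.
rewrite /rdot (_ : rdot_term _ _ = fun=> 0).
  by rewrite rsum_ge0E//; [rewrite esum1|rewrite /abs_summable esum1 ?ltry// => i _; rewrite normr0].
by apply/funext => p; rewrite /rdot_term ell2Z; case: (v p) => a b /=; ring.
Qed.

Let omega_state : state A omega.
Proof.
split.
- exact: omega_linear.
- move=> a a' Aa Aa' aa'.
  have raa := is_adjoint_radjoint aa'.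
  have al := (crossed_bounded Aa).1.
  (* Pairing with a delta vector reads off the real part of the diagonal entry, pairing with i times
     it the imaginary part. Moving [a'] across, the first is a squared norm and the second
     vanishes. *)
  have re x : 0 <= complex.Re (column 1%g (a' \o a) x).
    rewrite /column /entry -rdot_delta /= (radjoint_sym raa); exact: rdot_ge0.
  have im x : complex.Im (column 1%g (a' \o a) x) = 0.
    rewrite /column /entry -Im_entry /= (radjoint_sym raa) (linear_opZ _ _ al).
    exact: rdot_imag.
  have Aaa := crossed_comp Aa' Aa.
  rewrite lecE /=; apply/andP; split; last first.
    by apply: (conformal_ge0 nu_conf) => //; apply: boundedC_Re; exact: column_bounded.
  apply/eqP; rewrite -[RHS](functional0 (conformal_linear nu_conf)); congr nu; apply/funext => x; exact: im.
- rewrite /omega /nuC; apply/eqP; rewrite eq_complex /=; apply/andP; split.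
    apply/eqP; rewrite -[RHS](conformal_one nu_conf); congr nu; apply/funext => x.
    by rewrite /column /entry deltaE eqxx.
  apply/eqP; rewrite -[RHS](functional0 (conformal_linear nu_conf)); congr nu; apply/funext => x.
  by rewrite /column /entry deltaE eqxx.
Qed.

Let gen_delta f g x (xi : X) : contC f ->
  gen f g (delta (x, xi)) = f (bact (g * x)%g xi) *: delta ((g * x)%g, xi).
Proof.
move=> fc; apply: ell2P => -[y eta].
rewrite (genE g _ _ fc) ell2Z !deltaE /= !xpair_eqE.
have -> : (g^-1 * y == x)%g = (y == g * x)%g.
  by rewrite -(inj_eq (mulgI g)) mulVKg.
by case: eqP => [->|]; case: eqP => [->|]; rewrite ?mulr0.
Qed.

(** Both sides are linear and norm continuous in [b], so b = f U_g suffices. Then the left side is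
    [nu] of a function [q], and by [entry_equivariant] and [column_analytic_extension] the right
    side is [nu] of q(g^-1 xi) K(g, xi)^beta, so that the KMS relation is the transport rule. *)
Lemma KMS_of_conformal : exists omega, KMS_state A alpha beta omega.
Proof.

have key a b F : A a -> A b -> analytic_extension A alpha a F ->
    omega (a \o b) = omega (b \o F (0 +i* beta)); last first.
  exists omega; split; [exact: omega_state|].
  by move=> a b F [Aa _] [Ab _]; apply: key.
move=> Aa Ab ext.
pose Fb := F (0 +i* beta).
have AFb : A Fb by case: ext => AF _ _; exact: AF.
have al := (crossed_bounded Aa).1.
have [_ [ca ca0 hca]] := crossed_bounded Aa.
have [_ [cF cF0 hcF]] := crossed_bounded AFb.
have omegaD S T : A S -> A T -> omega (S + T) = omega S + omega T.
  by move=> AS AT; rewrite -[S]scale1r omega_linear// mul1r scale1r.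
have on_gen f g : contC f -> omega (a \o gen f g) = omega (gen f g \o Fb).
  move=> fc.
  pose q (xi : X) := f (bact g xi) * column g a xi.
  have qc : contC q.
    apply: contCM; last exact: column_continuous.
    exact: (contC_comp (@bact_continuous _ _ _ M g) fc).
  have -> : omega (a \o gen f g) = nuC q.
    congr nuC; apply/funext => xi; rewrite /column /entry /=.
    by rewrite (gen_delta g 1%g xi fc) (linear_opZ _ _ al) ell2Z mulg1.
  rewrite -(nuC_act g qc); congr nuC; apply/funext => xi.
  rewrite /q (bactVK g xi) /column /entry /= (genE g _ _ fc) /= bact1 mulg1.
  rewrite -/(entry Fb (g^-1%g, xi) (1%g, xi)) (entry_equivariant g xi AFb).
  rewrite (column_analytic_extension g _ beta ext Aa).
  by rewrite (bactVK g xi) /column /entry mulrCA.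
have on_alg S : algebraic_crossed_product S ->
    A S /\ omega (a \o S) = omega (S \o Fb).
  move: S; apply: acp_ind => [|f g S fc [AS ih]].
    split; first exact: (crossed_sub (@acp0 _ _ _ M)).
    congr omega; apply/funext => v /=; exact: linear_op0.
  have Ag := crossed_gen g fc.
  split.
    by have := crossed_lin 1 Ag AS; rewrite scale1r.
  have -> : a \o (gen f g + S) = (a \o gen f g) + (a \o S).
    by apply/funext => v; rewrite /= !opE_add /= (linear_opD _ _ al).
  have -> : (gen f g + S) \o Fb = (gen f g \o Fb) + (S \o Fb) by [].
  rewrite (omegaD _ _ (crossed_comp Aa Ag) (crossed_comp Aa AS)) (on_gen f g fc) ih.
  by rewrite (omegaD _ _ (crossed_comp Ag AFb) (crossed_comp AS AFb)).
apply/eqP; rewrite -subr_eq0 -cmod_eq0 eq_le cmod_ge0 andbT.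
apply/ler_addgt0Pr => e e0; rewrite add0r.
have s0 : 0 < 2 * (ca + cF) + 1 by rewrite ltr_wpDl// mulr_ge0// addr_ge0.
have e1 : 0 < e / (2 * (ca + cF) + 1) by rewrite divr_gt0.
have [S BS bS] := Ab _ e1.
have [AS SE] := on_alg S BS.
have -> : omega (a \o b) - omega (b \o Fb) =
    omega (a \o b - (a \o S)) - omega (b \o Fb - (S \o Fb)).
  rewrite (omegaB (crossed_comp Aa Ab) (crossed_comp Aa AS)).
  by rewrite (omegaB (crossed_comp Ab AFb) (crossed_comp AS AFb)) SE; ring.
apply: le_trans (cmodB _ _) _.
have h1 : opnorm_le (a \o b - (a \o S)) (ca * (e / (2 * (ca + cF) + 1))).
  have := opnorm_le_comp ca0 hca bS; congr opnorm_le.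
  by apply/funext => v; rewrite /= !opE_sub /= (linear_opB _ _ al).
have h2 : opnorm_le (b \o Fb - (S \o Fb)) (e / (2 * (ca + cF) + 1) * cF).
  exact: (opnorm_le_comp (ltW e1) bS hcF).
apply: le_trans (lerD (omega_le h1) (omega_le h2)) _.
apply: (@le_trans _ _ (2 * (ca + cF) * (e / (2 * (ca + cF) + 1)))).
  by rewrite le_eqVlt; apply/orP; left; apply/eqP; ring.
by apply: mul_div_succ_le; [rewrite mulr_ge0// addr_ge0|exact: ltW].
Qed.

End KMSOfConformal.

(** * The functional of a KMS state *)

Section FunctionalOfKMS.
Local Open Scope complex_scope.
(** The flow multiplies U_g on the right; moving the factor to the left of U_g translates its
    argument by the inverse of [g]. *)
Let lnk_act g (xi : X) : R := lnk g^-1%g (bact g^-1%g xi).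

Let lnk_act_continuous g : continuous (lnk_act g).
Proof.
move=> x; apply: (@cvg_comp _ _ _ (bact g^-1%g : X -> X) (lnk g^-1%g) _
  (nbhs (bact g^-1%g x))); first exact: bact_continuous.
exact: lnk_continuous.
Qed.

Let one_cont : contC (fun _ : X => 1 : C) := @contC_cst _ _ _ M 1.

Lemma gen_sum g (f : nat -> X -> C) (z : nat -> C) n : (forall k, contC (f k)) ->
  contC (fun x => \sum_(k < n) z k * f k x) /\
  \sum_(k < n) z k *: gen (f k) g = gen (fun x => \sum_(k < n) z k * f k x) g.
Proof.
move=> fc; have zc k : contC (fun x => z k * f k x).
  exact: (contCM (@contC_cst _ _ _ M (z k)) (fc k)).
elim: n => [|n [ihc ih]].
  have -> : (fun x : X => \sum_(k < 0) z k * f k x) = (fun x => 0 * 1).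
    by apply/funext => x; rewrite big_ord0 mul0r.
  split; first exact: (contCM (@contC_cst _ _ _ M 0) one_cont).
  by rewrite big_ord0 (genZ 0 g one_cont) scale0r.
have -> : (fun x => \sum_(k < n.+1) z k * f k x) =
    (fun x => \sum_(k < n) z k * f k x + z n * f n x).
  by apply/funext => x; rewrite big_ord_recr.
split; first exact: (contCD ihc (zc n)).
by rewrite big_ord_recr /= ih (genD g ihc (zc n)) (genZ (z n) g (fc n)).
Qed.

Let twist_act g (z : C) (xi : X) : C := cexp (- imagC * z * (lnk_act g xi)%:C).

Let twist_act_cont g z : contC (twist_act g z).
Proof. exact: (contC_cexp (@lnk_act_continuous g)). Qed.

(** The exponential series in w - z converges uniformly on the boundary because the logarithm of the
    kernel is bounded there, so it converges in operator norm. The radius 1 is arbitrary. *)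
Lemma analytic_canonical_unitary g :
  analytic_extension A alpha (gen (fun=> 1) g) (fun z => gen (twist_act g z) g).
Proof.
split.
- by move=> z; exact: (crossed_gen g (@twist_act_cont g z)).
- move=> z; exists 1 => //.
  pose m (xi : X) : C := - imagC * (lnk_act g xi)%:C.
  have mc : contC m.
    exact: (contCM (@contC_cst _ _ _ M (- imagC)) (contC_real (@lnk_act_continuous g))).
  have [L L0 mL] := contC_cmod_bounded mc.
  have [B B0 tB] := contC_cmod_bounded (@twist_act_cont g z).
  pose f k (xi : X) : C := twist_act g z xi * (m xi ^+ k * (k`!%:R)^-1).
  have fc k : contC (f k).
    apply: (contCM (@twist_act_cont g z)).
    apply: (@contCM _ _ _ _ (fun xi => m xi ^+ k) (fun=> (k`!%:R)^-1)); last exact: contC_cst.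
    elim: k => [|k ih]; first exact: one_cont.
    have -> : (fun xi => m xi ^+ k.+1) = (fun xi => m xi * m xi ^+ k).
      by apply/funext => xi; rewrite exprS.
    exact: contCM.
  exists (fun k => gen (f k) g); first by move=> k; exact: (crossed_gen g (fc k)).
  move=> w wz e e0.
  have e1 : 0 < e / (B + 1) by rewrite divr_gt0// ltr_wpDl.
  have [n0 hn] := cexp_taylor L0 e1; exists n0 => n n0n.
  have [sc ->] := gen_sum g (fun k => (w - z) ^+ k) n fc.
  set s := fun x => _ in sc *.
  have -> : gen (twist_act g w) g - gen s g = gen (fun x => -1 * s x + twist_act g w x) g.
    have nc : contC (fun x => -1 * s x) := contCM (@contC_cst _ _ _ M (-1)) sc.
    by rewrite (genD g nc (@twist_act_cont g w)) (genZ (-1) g sc) scaleN1r addrC.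
  apply: gen_norm.
  + apply: (@contCD _ _ _ _ (fun x => -1 * s x)); last exact: twist_act_cont.
    exact: (contCM (@contC_cst _ _ _ M (-1)) sc).
  + exact: ltW.
  + move=> xi.
    have -> : -1 * s xi + twist_act g w xi = twist_act g z xi *
        (cexp (m xi * (w - z)) - \sum_(k < n) cexp_coeff (m xi * (w - z)) k).
      rewrite mulN1r addrC mulrBr -cexpD mulr_sumr; congr (_ - _).
        by congr cexp; rewrite /m; ring.
      apply: eq_bigr => k _; rewrite /f /cexp_coeff [(m xi * _) ^+ k]exprMn.
      by rewrite mulrCA; congr (_ * _); rewrite mulrC -!mulrA; congr (_ * _); rewrite mulrC.
    rewrite cmodM.
    have wz1 : cmod (w - z) <= 1 by move: wz; rewrite normc_cmod ltcR => /ltW.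
    have mw : cmod (m xi * (w - z)) <= L.
      by rewrite cmodM -[L]mulr1; apply: ler_pM; rewrite ?cmod_ge0.
    have h := hn n n0n _ mw.
    apply: (@le_trans _ _ (B * (e / (B + 1)))).
      by apply: ler_pM; rewrite ?cmod_ge0.
    by apply: mul_div_succ_le => //; exact: ltW.
- move=> t; pose q (xi : X) : C := cis (- (t * ln (bkernel g^-1%g xi))).
  have qE : (fun xi => q (bact g^-1%g xi)) = twist_act g t%:C.
    by apply/funext => xi; rewrite /q cis_cexp.
  have qc : contC q.
    have -> : q = (fun xi => twist_act g t%:C (bact g xi)).
      by apply/funext => xi; rewrite -qE bactK.
    exact: (contC_comp (@bact_continuous _ _ _ M g) (@twist_act_cont g t%:C)).
  have aE : alpha t (gen (fun=> 1) g) = gen (fun=> 1) g \o mult_op q :=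
    alpha_flow.2 t _ g one_cont.
  rewrite aE (mult_op_gen qc) (gen_comp g 1%g one_cont qc) mulg1; congr (gen _ g).
  by apply/funext => xi; rewrite mul1r -qE.
Qed.

Variables (beta : R) (omega : op -> C).
Hypothesis KMS : KMS_state A alpha beta omega.

Let omega_linear := state_linear KMS.1.

Let A_gen f g : contC f -> A (gen f g) := @crossed_gen _ _ _ M f g.

(** The KMS relation for a = U_g and b its inverse, with g = x^-1: the product ab is the identity,
    while b alpha_(i beta)(a) is multiplication by K_x^beta. *)
Let omega_kernel x : omega (gen (fun xi => (bkernel x xi `^ beta)%:C) 1%g) = 1.
Proof.
pose g := (x^-1)%g.
have ext h := analytic_canonical_unitary h.
have an h : analytic_element A alpha (gen (fun=> 1) h).
  by split; [exact: A_gen|exists (fun z => gen (twist_act h z) h)].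
have E := KMS.2 _ _ _ (an g) (an (g^-1)%g) (ext g).
have ab : gen (fun=> 1 : C) g \o gen (fun=> 1) g^-1%g = id :> op.
  rewrite (gen_comp g g^-1%g one_cont one_cont) mulgV.
  have -> : (fun _ : X => 1 * 1 : C) = (fun=> 1) by apply/funext => xi; rewrite mulr1.
  exact: gen_one.
have ba : gen (fun=> 1 : C) g^-1%g \o gen (twist_act g (0 +i* beta)) g =
    gen (fun xi => (bkernel x xi `^ beta)%:C) 1%g :> op.
  rewrite (gen_comp g^-1%g g one_cont (@twist_act_cont g _)) mulVg; congr (gen _ 1%g).
  apply/funext => xi; rewrite mul1r /twist_act /lnk_act bactVK /g invgK.
  rewrite /powR gt_eqF ?kernel_gt0// -cexpR; congr cexp.
  apply/eqP; rewrite eq_complex /=.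
  by rewrite !(mul0r, mulr0, subr0, sub0r, addr0, add0r, mulN1r, oppr0, mulNr, opprK, mul1r) !eqxx.
exact: etrans (congr1 omega (esym ba)) (etrans (esym E) (etrans (congr1 omega ab) (state_id KMS.1))).
Qed.

Lemma functional_of_KMS : exists nu : (X -> R) -> R, [/\
  forall c (p q : X -> R), continuous p -> continuous q ->
    nu (fun x => c * p x + q x) = c * nu p + nu q,
  forall q : X -> R, continuous q -> (forall x, 0 <= q x) -> 0 <= nu q &
  forall x, nu (fun xi => bkernel x xi `^ beta) = 1].
Proof.
exists (fun q => complex.Re (omega (gen (fun xi => (q xi)%:C) 1%g))); split.
- move=> c p q pc qc.
  have rp := contC_real pc; have rq := contC_real qc.
  have crp : contC (fun x => c%:C * (p x)%:C) := contCM (@contC_cst _ _ _ M c%:C) rp.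
  have -> : (fun x => (c * p x + q x)%:C) = (fun x => c%:C * (p x)%:C + (q x)%:C).
    by apply/funext => x; rewrite rmorphD rmorphM.
  rewrite (genD 1%g crp rq) (genZ c%:C 1%g rp).
  rewrite (omega_linear c%:C (A_gen 1%g rp) (A_gen 1%g rq)) cReD cReM /=.
  by rewrite mul0r subr0.
(* Positivity of a state concerns products of an element with its adjoint; a nonnegative function is
   the square of a self-adjoint one. *)
- move=> q qc q0; pose s x : C := (Num.sqrt (q x))%:C.
  have sc : contC s.
    apply: contC_real => x; apply: (@cvg_comp _ _ _ q (@Num.sqrt R) _ (nbhs (q x))).
      exact: qc.
    exact: sqrt_continuous.
  have adj : is_adjoint (gen s 1%g) (gen s 1%g).
    have := @gen_adjoint _ _ _ M s 1%g sc.
    have -> : (fun x => (s (bact 1%g x))^*) = s.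
      by apply/funext => x; rewrite bact1 /s /= oppr0.
    rewrite invg1; apply: radjoint_is_adjoint; exact: (gen_linear 1%g sc).
  have := state_ge0 KMS.1 (A_gen 1%g sc) (A_gen 1%g sc) adj.
  rewrite (gen_comp _ _ sc sc) mulg1 => h.
  have E : (fun x => s x * s (bact (1^-1)%g x)) = (fun x => (q x)%:C).
    by apply/funext => x; rewrite invg1 bact1 /s -rmorphM /= -expr2 sqr_sqrtr.
  by move: h; rewrite E lecE => /andP[_].
- by move=> x; rewrite omega_kernel.
Qed.

End FunctionalOfKMS.

End MartinFlow.

(** * Exponents in the absence of spines *)

Section PowerTangent.
Context {R : realType}.
Implicit Types b k : R.

(** exp(b ln k) > 1 + b ln k, and b ln k >= b (k - 1) because b is negative. The other ranges reduce
    to this one: b > 1 through the exponent 1 - b at 1/k, and 0 < b < 1 through the exponent 1/b at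
    k^b. *)
Lemma powR_gt_tangent_neg b k : b < 0 -> 0 < k -> k != 1 ->
  1 + b * (k - 1) < k `^ b.
Proof.
move=> b0 k0 k1; rewrite /powR gt_eqF//.
apply: le_lt_trans (_ : 1 + b * ln k < _); last first.
  by apply: expR_gt1Dx; apply: mulf_neq0; rewrite ?ln_eq0// lt_eqF.
rewrite lerD2l ler_nM2l//; have := @le_ln1Dx R (k - 1).
by rewrite addrCA subrr addr0; apply; rewrite ltrBDr addNr.
Qed.

Lemma powR_gt_tangent b k : 1 < b -> 0 < k -> k != 1 -> 1 + b * (k - 1) < k `^ b.
Proof.
move=> b1 k0 k1; have kV0 : 0 < k^-1 by rewrite invr_gt0.
have kV1 : k^-1 != 1 by rewrite invr_eq1.
have b0 : 1 - b < 0 by rewrite subr_lt0.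
have := powR_gt_tangent_neg b0 kV0 kV1; rewrite -(ltr_pM2l k0).
have -> : k * k^-1 `^ (1 - b) = k `^ b.
  rewrite /powR !gt_eqF// lnV// -{1}[k]lnK// -expRD; congr expR; ring.
by congr (_ < _); field; rewrite gt_eqF.
Qed.

Lemma powR_lt_tangent b k : 0 < b < 1 -> 0 < k -> k != 1 -> k `^ b < 1 + b * (k - 1).
Proof.
move=> /andP[b0 b1] k0 k1; have c1 : 1 < b^-1 by rewrite invf_gt1.
have u0 : 0 < k `^ b by exact: powR_gt0.
have uk : (k `^ b) `^ b^-1 = k by rewrite -powRrM mulfV ?gt_eqF// powRr1// ltW.
have u1 : k `^ b != 1.
  by apply: contra k1 => /eqP u1; rewrite -uk u1 powR1.
have := powR_gt_tangent c1 u0 u1; rewrite uk -(ltr_pM2l b0) mulrDr mulrA mulfV ?gt_eqF//.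
by lra.
Qed.

Lemma powR_tangent_sign b : b != 0 -> b != 1 -> exists2 s : R, s ^+ 2 = 1 &
  forall k, 0 < k -> k != 1 -> 0 < s * (k `^ b - 1 - b * (k - 1)).
Proof.
move=> bn0 bn1.
have [b0|b0|b0] := ltrgtP b 0; last by rewrite b0 eqxx in bn0.
  exists 1 => [|k k0 k1]; first by rewrite expr1n.
  by rewrite mul1r; have := powR_gt_tangent_neg b0 k0 k1; lra.
have [b1|b1|b1] := ltrgtP b 1; last by rewrite b1 eqxx in bn1.
  exists (-1) => [|k k0 k1]; first by rewrite sqrrN expr1n.
  have b01 : 0 < b < 1 by rewrite b0.
  by rewrite mulN1r; have := powR_lt_tangent b01 k0 k1; lra.
exists 1 => [|k k0 k1]; first by rewrite expr1n.
by rewrite mul1r; have := powR_gt_tangent b1 k0 k1; lra.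
Qed.

End PowerTangent.

Section CompactLowerBound.
Context {R : realType} {T : topologicalType}.
Hypothesis cT : compact [set: T].

Lemma compact_lower_bound (v : T -> R) : continuous v -> (forall z, 0 < v z) ->
  exists2 e, 0 < e & forall z, e < v z.
Proof.
move=> vc v0.
apply: (@compact_directed T cT R [set e | 0 < e] (fun e z => e < v z)).
- by exists 1 => /=.
- move=> a b /= a0 b0; exists (Num.min a b); first by rewrite /= lt_min a0.
  by move=> z; rewrite gt_min => -[->//|->]; rewrite orbT.
- move=> y; exists (v y / 2); first by rewrite /= divr_gt0.
  by apply: (cvgr_gt (v y)); [exact: vc|rewrite ltr_pdivrMr// mulr_natr mulr2n ltrDl].
Qed.

End CompactLowerBound.

(** * Uniform harmonicity and the excluded exponents *)

Section KernelPowers.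
Context {R : realType} {G : groupType}.
Variable mu : G -> R.
Hypothesis walk : random_walk mu.
Hypothesis trans : transient mu.
Variables (S : seq G) (d : G -> G -> nat) (C : R).
Hypothesis d_word : word_metric S d.
Hypothesis C_gt0 : 0 < C.
Hypothesis harnack : forall x y z, green mu x z / green mu y z <= C ^+ d x y.
Hypothesis moment : (\esum_(g in [set: G]) (mu g * C ^+ d g 1%g)%:E < +oo)%E.
Variable M : martin_compactification mu.
Notation X := (martin_boundary M).
Notation K := (@mkernel _ _ _ M).
Notation emb := (@memb _ _ _ M).
Notation green := (green mu).

Let green_gt0 x y : 0 < green x y := green_gt0 walk trans x y.
Let mu0 g : 0 <= mu g := walk_ge0 walk g.

Let ratio x h g := green (x * g)%g h / green x h.

Let ratio_ge0 x h g : 0 <= ratio x h g.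
Proof. by rewrite divr_ge0// ltW. Qed.

Let ratio_le x h g : ratio x h g <= C ^+ d g 1%g.
Proof. by rewrite -(word_metric_mul d_word x g); exact: harnack. Qed.

Let esum_ratio x h : h != x -> (\esum_(g in [set: G]) (mu g * ratio x h g)%:E = 1)%E.
Proof.
move=> hx; have := green_step walk trans x h; rewrite eq_sym (negPf hx) add0e.
rewrite -(esum_mull x); move: (green_gt0 x h) => g0 E.
have {E} : ((green x h)^-1%:E * (green x h)%:E = (green x h)^-1%:E *
    \esum_(g in [set: G]) ((mu g)%:E * (green (x * g)%g h)%:E))%E.
  by rewrite E; congr (_ * _)%E; apply: eq_esum => g _; rewrite mulKg.
rewrite -EFinM mulVf ?gt_eqF// -esumZl ?lee_fin ?invr_ge0 ?ltW// => [->|g].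
  by apply: eq_esum => g _; rewrite -!EFinM /ratio; congr EFin; ring.
by rewrite -EFinM lee_fin mulr_ge0// ltW.
Qed.

Let sum_subset (f : G -> R) (s t : seq G) : (forall g, 0 <= f g) -> uniq s ->
  {subset s <= t} -> \sum_(g <- s) f g <= \sum_(g <- undup t) f g.
Proof.
move=> f0 us st; rewrite -lee_fin -!sumEFin.
rewrite (fsbig_seq _ _ us) (fsbig_seq _ _ (undup_uniq t)).
apply: lee_fsum_nneg_subset => //.
- by move=> g; rewrite !in_setE /= mem_undup => /st.
- by move=> g _; rewrite lee_fin.
Qed.

(** For h other than [x] the Green ratios average exactly to 1, and each is at most C^d(g,1). The
    moment condition makes this bound summable, so one finite [s] serves all such [h], and the
    estimate passes to the boundary. Requiring [a] in [s] allows the term of [a] to be singled out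
    later. *)
Lemma kernel_almost_harmonic x a (e : R) : 0 < e -> exists s : seq G,
  [/\ uniq s, a \in s & forall xi : X,
    `|\sum_(g <- s) mu g * (bkernel (x * g)%g xi / bkernel x xi - 1)| <= e].
Proof.
move=> e0.
pose m g := mu g * C ^+ d g 1%g.
have m0 g : 0 <= m g by rewrite mulr_ge0// exprn_ge0// ltW.
pose b := fine (\esum_(g in [set: G]) (m g)%:E).
have bE : (\esum_(g in [set: G]) (m g)%:E = b%:E)%E.
  by rewrite fineK// ge0_fin_numE// esum_ge0// => g _; rewrite lee_fin.
have [s1 [us1 hs1]] := esum_fin_approx mu0 (walk_sum1 walk) e0.
have [s2 [us2 hs2]] := esum_fin_approx m0 bE e0.
pose s := undup (a :: s1 ++ s2).
have us : uniq s by exact: undup_uniq.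
have h1 : 1 - e < \sum_(g <- s) mu g.
  apply: lt_le_trans hs1 _; apply: sum_subset => // g gs.
  by rewrite inE mem_cat gs orbT.
have h2 : b - e < \sum_(g <- s) m g.
  apply: lt_le_trans hs2 _; apply: sum_subset => // g gs.
  by rewrite inE mem_cat gs !orbT.
have h3 : \sum_(g <- s) mu g <= 1.
  rewrite -lee_fin -sumEFin -(walk_sum1 walk).
  by apply: esum_seq_le => // g; rewrite lee_fin.
exists s; split => //; first by rewrite mem_undup inE eqxx.
have bound h : h != x -> `|\sum_(g <- s) mu g * (ratio x h g - 1)| <= e.
  move=> hx; have rE := esum_ratio hx.
  have r0 g : 0 <= mu g * ratio x h g by rewrite mulr_ge0.
  have mr g : 0 <= m g - mu g * ratio x h g by rewrite subr_ge0 ler_wpM2l.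
  have up : \sum_(g <- s) mu g * ratio x h g <= 1.
    rewrite -lee_fin -sumEFin -rE.
    by apply: esum_seq_le => // g; rewrite lee_fin.
  (* The dominating sum minus the ratio sum totals b - 1 and has nonnegative terms. As [s] misses
     less than [e] of [b], the partial ratio sum exceeds 1 - e. *)
  have low : \sum_(g <- s) (m g - mu g * ratio x h g) <= b - 1.
    rewrite -lee_fin -sumEFin EFinB.
    have -> : (b%:E - 1%:E = \esum_(g in [set: G]) (m g - mu g * ratio x h g)%:E)%E.
      rewrite -bE -rE; have -> : (\esum_(g in [set: G]) (m g)%:E =
          \esum_(g in [set: G]) (m g - mu g * ratio x h g)%:E +
          \esum_(g in [set: G]) (mu g * ratio x h g)%:E)%E.
        rewrite -esumD; first last.
        - by move=> g _; rewrite lee_fin.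
        - by move=> g _; rewrite lee_fin.
        by apply: eq_esum => g _; rewrite -EFinD subrK.
      by rewrite rE addeK.
    by apply: esum_seq_le => // g; rewrite lee_fin.
  under eq_bigr do rewrite mulrBr mulr1.
  rewrite sumrB ler_norml; move: low up; rewrite sumrB; move: h1 h2 h3.
  move: (\sum_(g <- s) mu g) (\sum_(g <- s) m g) (\sum_(g <- s) _) => u v w.
  by move=> *; lra.
pose f z := \sum_(g <- s) mu g * (K (x * g)%g z / K x z - 1).
have fc : continuous f.
  rewrite /f; elim: s {us h1 h2 h3 bound f} => [|g s ih] z.
    by under eq_fun do rewrite big_nil; exact: cvg_cst.
  under eq_fun do rewrite big_cons.
  apply: cvgD; last exact: ih.
  apply: cvgMr; apply: cvgB; last exact: cvg_cst.
  apply: cvgM; first exact: mkernel_continuous.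
  apply: cvgV; last exact: mkernel_continuous.
  by rewrite gt_eqF// (mkernel_gt0 walk trans C_gt0 harnack).
have fE h : f (emb h) = \sum_(g <- s) mu g * (ratio x h g - 1).
  apply: eq_bigr => g _; rewrite !mkernelE; congr (_ * (_ - 1)).
  by rewrite /ratio invf_div mulrA divfK// gt_eqF.
move=> xi; rewrite ler_norml lerNl; apply/andP; split; last first.
  apply: (@boundary_le _ _ _ _ _ x _ fc) => h hx; rewrite fE.
  by apply: le_trans (ler_norm _) _; exact: bound hx.
have nfc : continuous (fun z => - f z) by move=> z; apply: cvgN; exact: fc.
apply: (@boundary_le _ _ _ _ _ x _ nfc) => h hx; rewrite fE.
by apply: le_trans (ler_norm _) _; rewrite normrN; exact: bound hx.
Qed.

Let kernel_gt0 g (xi : X) : 0 < bkernel g xi.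
Proof. exact: (bkernel_gt0 walk trans C_gt0 harnack). Qed.

Lemma kernel_powR_continuous (b : R) g : continuous (fun xi : X => bkernel g xi `^ b).
Proof.
have -> : (fun xi : X => bkernel g xi `^ b) = fun xi => expR (b * ln (bkernel g xi)).
  by apply/funext => xi; rewrite /powR gt_eqF.
have lnc : continuous (fun xi : X => ln (bkernel g xi)).
  move=> x; apply: (@cvg_comp _ _ _ (bkernel g : X -> R) (@ln R) _ (nbhs (bkernel g x))).
    exact: bkernel_continuous.
  by apply: continuous_ln; exact: kernel_gt0.
move=> x; apply: (@cvg_comp _ _ _ (fun xi : X => b * ln (bkernel g xi)) (@expR R)
  _ (nbhs (b * ln (bkernel g x)))); last exact: continuous_expR.
by apply: (@cvgMr _ _ (nbhs x)); exact: lnc.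
Qed.

Lemma spine_of_invariant (xi : X) :
  (forall x g, 0 < mu g -> bkernel (x * g)%g xi = bkernel x xi) -> spine xi.
Proof.
move=> inv g; have [s _ [sS <-]] := walk_generates walk g.
suff: forall x, bkernel (x * foldr (fun x y => x * y) 1 s)%g xi = bkernel x xi.
  by move/(_ 1%g); rewrite mul1g (bkernel1 walk trans).
elim: s sS => [|h s ih] sS x /=; first by rewrite mulg1.
rewrite mulgA ih => [|y ys]; last by apply: sS; rewrite inE ys orbT.
by apply: inv; apply: sS; rewrite inE eqxx.
Qed.

Variables (beta : R) (nu : (X -> R) -> R).
Hypothesis nu_linear : forall c (p q : X -> R), continuous p -> continuous q ->
  nu (fun x => c * p x + q x) = c * nu p + nu q.
Hypothesis nu_ge0 : forall q : X -> R, continuous q -> (forall x, 0 <= q x) -> 0 <= nu q.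
Hypothesis nu_kernel : forall x, nu (fun xi => bkernel x xi `^ beta) = 1.

Let cst_cont (c : R) : continuous (fun _ : X => c).
Proof. by move=> x; apply: (@cvg_cst _ _ _ (nbhs x)). Qed.

Let lin_cont c (p q : X -> R) : continuous p -> continuous q ->
  continuous (fun x => c * p x + q x).
Proof. by move=> pc qc x; apply: (@cvgD _ _ _ (nbhs x)); [apply: (@cvgMr _ _ (nbhs x)); exact: pc|exact: qc]. Qed.

Let nu0 : nu (fun=> 0) = 0.
Proof.
have := nu_linear (-1) (@cst_cont 0) (@cst_cont 0).
have -> : (fun _ : X => -1 * 0 + 0 : R) = fun=> 0 by apply/funext => x; rewrite mulr0 addr0.
by move=> E; lra.
Qed.

Let nu1 : nu (fun=> 1) = 1.
Proof.
rewrite -[RHS](nu_kernel 1%g); congr nu; apply/funext => xi.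
by rewrite (bkernel1 walk trans) powR1.
Qed.

Let nuZ c (q : X -> R) : continuous q -> nu (fun x => c * q x) = c * nu q.
Proof.
move=> qc; rewrite -[RHS]addr0 -nu0 -nu_linear//.
by congr nu; apply/funext => x; rewrite addr0.
Qed.

Let nu_le (p q : X -> R) : continuous p -> continuous q -> (forall x, p x <= q x) ->
  nu p <= nu q.
Proof.
move=> pc qc pq; rewrite -subr_ge0 addrC -mulN1r -nu_linear//; apply: nu_ge0.
  exact: lin_cont.
by move=> x; rewrite mulN1r addrC subr_ge0.
Qed.

Let W x (xi : X) := bkernel x xi `^ beta.

Let W_cont x : continuous (W x).
Proof. exact: kernel_powR_continuous. Qed.

Let drift x g (xi : X) := W x xi * (bkernel (x * g)%g xi / bkernel x xi - 1).

Let drift_cont x g : continuous (drift x g).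
Proof.
move=> xi; apply: (@cvgM _ _ (nbhs xi)); first exact: W_cont.
apply: (@cvgB _ _ _ (nbhs xi)); last exact: cst_cont.
apply: (@cvgM _ _ (nbhs xi)); first exact: bkernel_continuous.
by apply: (@cvgV _ _ (nbhs xi)); [rewrite gt_eqF|exact: bkernel_continuous].
Qed.

Let drift_sum x (s : seq G) :
  continuous (fun xi => \sum_(g <- s) mu g * drift x g xi) /\
  nu (fun xi => \sum_(g <- s) mu g * drift x g xi) = \sum_(g <- s) mu g * nu (drift x g).
Proof.
elim: s => [|g s [ihc ih]].
  rewrite big_nil; have -> : (fun xi => \sum_(g <- [::]) mu g * drift x g xi) = fun=> 0.
    by apply/funext => xi; rewrite big_nil.
  by split.
have -> : (fun xi => \sum_(h <- g :: s) mu h * drift x h xi) =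
    fun xi => mu g * drift x g xi + \sum_(h <- s) mu h * drift x h xi.
  by apply/funext => xi; rewrite big_cons.
by split; [exact: lin_cont|rewrite big_cons nu_linear// ih].
Qed.

Lemma no_spine_exponent : ~ (exists xi : X, spine xi) -> beta = 0 \/ beta = 1.
Proof.
move=> noS; have [->|b0] := eqVneq beta 0; first by left.
have [->|b1] := eqVneq beta 1; first by right.
exfalso; have [sg sg2 sgP] := powR_tangent_sign b0 b1.
(* This is [W x] times the signed gap of the power above its tangent at the ratio of the kernels,
   hence nonnegative. Since [nu] takes the same value on all [W x], only the drift contributes to
   [nu (D x g)]. *)
pose D x g (xi : X) := sg * (W (x * g)%g xi - W x xi - beta * drift x g xi).
have DE x g xi : D x g xi = W x xi * (sg * ((bkernel (x * g)%g xi / bkernel x xi) `^ beta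
    - 1 - beta * (bkernel (x * g)%g xi / bkernel x xi - 1))).
  have -> : (bkernel (x * g)%g xi / bkernel x xi) `^ beta = W (x * g)%g xi / W x xi.
    have k0 y : 0 <= bkernel y xi by exact: ltW.
    rewrite powRM ?invr_ge0 ?k0// /W; congr (_ * _).
    by rewrite -(powR_inv1 (k0 x)) -powRrM mulN1r powRN.
  rewrite /D /drift; have w0 : W x xi != 0 by rewrite gt_eqF// powR_gt0.
  have k0 : bkernel x xi != 0 by rewrite gt_eqF.
  move: (W x xi) (W (x * g)%g xi) w0 => u w w0; field.
  by rewrite w0 k0.
have ratio_gt0 x g (xi : X) : 0 < bkernel (x * g)%g xi / bkernel x xi.
  by rewrite divr_gt0.
have D_gt0 x g xi : bkernel (x * g)%g xi / bkernel x xi != 1 -> 0 < D x g xi.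
  by move=> k1; rewrite DE mulr_gt0 ?powR_gt0//; exact: sgP.
have D_ge0 x g xi : 0 <= D x g xi.
  have [k1|k1] := eqVneq (bkernel (x * g)%g xi / bkernel x xi) 1.
    by rewrite DE k1 powR1 !subrr mulr0 subrr !mulr0.
  exact: ltW (D_gt0 x g xi k1).
have DL x g : D x g = fun xi => sg * (-1 * W x xi + (W (x * g)%g xi)) +
    (- (sg * beta) * drift x g xi).
  by apply/funext => xi; rewrite /D; ring.
have dc x g c : continuous (fun xi => c * drift x g xi).
  by move=> xi; apply: (@cvgMr _ _ (nbhs xi)); exact: drift_cont.
have wc x g : continuous (fun xi => -1 * W x xi + W (x * g)%g xi).
  exact: lin_cont.
have Dc x g : continuous (D x g) by rewrite DL; exact: lin_cont.
have nuD x g : nu (D x g) = - (sg * beta) * nu (drift x g).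
  rewrite DL nu_linear// nu_linear// (nuZ _ (@drift_cont x g)).
  by rewrite !nu_kernel mulN1r addNr mulr0 add0r.
(* The average over [mu] of the drifts is nearly annihilated by [nu], so a sum of nonnegative terms,
   one of which is mu a * nu (D x a), is arbitrarily small. *)
have nuD0 x a : 0 < mu a -> nu (D x a) = 0.
  move=> a0; apply/eqP; rewrite eq_le nu_ge0// andbT.
  apply/ler_addgt0Pr => e e0; rewrite add0r.
  have e1 : 0 < mu a * e / (`|beta| + 1) by rewrite divr_gt0 ?mulr_gt0// ltr_wpDl.
  have [s [us as_ hs]] := kernel_almost_harmonic x a e1.
  rewrite -(ler_pM2l a0).
  have [sc sE] := drift_sum x s.
  have h1 : mu a * nu (D x a) <= \sum_(g <- s) mu g * nu (D x g).
    rewrite (big_rem a)//= lerDl; apply: sumr_ge0 => g _.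
    by rewrite mulr_ge0 ?nu_ge0//; exact: (walk_ge0 walk).
  apply: le_trans h1 _.
  have -> : \sum_(g <- s) mu g * nu (D x g) = - (sg * beta) *
      nu (fun xi => \sum_(g <- s) mu g * drift x g xi).
    rewrite sE mulr_sumr; apply: eq_bigr => g _; rewrite nuD; ring.
  apply: le_trans (ler_norm _) _; rewrite normrM normrN normrM.
  have -> : `|sg| = 1.
    by apply/eqP; rewrite -(@pexpr_eq1 _ _ 2)// -normrX sg2 normr1.
  rewrite mul1r.
  set e' := mu a * e / _ in e1 hs.
  apply: le_trans (_ : `|beta| * e' <= _); last first.
    by apply: mul_div_succ_le => //; rewrite mulr_ge0 ?ltW.
  apply: ler_wpM2l => //.
  have sumE xi : \sum_(g <- s) mu g * drift x g xi =
      W x xi * \sum_(g <- s) mu g * (bkernel (x * g)%g xi / bkernel x xi - 1).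
    by rewrite mulr_sumr; apply: eq_bigr => g _; rewrite /drift mulrCA.
  have eW (c : R) : nu (fun xi => c * W x xi) = c by rewrite nuZ// nu_kernel mulr1.
  have cW (c : R) : continuous (fun xi => c * W x xi).
    by move=> xi; apply: (@cvgMr _ _ (nbhs xi)); exact: W_cont.
  rewrite ler_norml -{1}(eW (- e')) -{2}(eW e').
  apply/andP; split; apply: nu_le => // xi; rewrite sumE mulrC.
    by rewrite ler_wpM2l ?powR_ge0//; have := hs xi; rewrite ler_norml => /andP[].
  by rewrite ler_wpM2r ?powR_ge0//; have := hs xi; rewrite ler_norml => /andP[].
have cX := @boundary_space_compact _ _ _ M.
(* Every boundary point is not a spine, so some [D x g] in this class is positive near it. The class
   is closed under sums, so compactness yields a member positive everywhere, hence bounded below by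
   a positive constant, against nu(1) = 1. *)
pose V : set (X -> R) := [set v : X -> R | [/\ continuous v, forall xi, 0 <= v xi & nu v = 0]].
have [v [vc v0 nuv] vgt0] : exists2 v, V v & forall xi, 0 < v xi.
  apply: (@compact_directed X cX _ V (fun v xi => 0 < v xi)).
  - by exists (fun=> 0).
  - move=> v w [vc v0 nuv] [wc' w0 nuw]; exists (fun xi => 1 * v xi + w xi).
      split; first exact: lin_cont.
        by move=> xi; rewrite mul1r addr_ge0.
      by rewrite nu_linear// nuv nuw mulr0 addr0.
    by move=> xi [h|h]; rewrite mul1r; [rewrite ltr_pwDl|rewrite ltr_wpDl].
  - move=> xi.
    have [x [g [g0 neq]]] : exists x g, 0 < mu g /\ bkernel (x * g)%g xi <> bkernel x xi.
      apply: contrapT => nx; apply: noS; exists xi; apply: spine_of_invariant.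
      by move=> x g g0; apply: contrapT => neq; apply: nx; exists x, g.
    exists (D x g); first by split => //; exact: nuD0.
    apply: (@cvgr_gt _ _ (nbhs xi) _ (D x g) (D x g xi)); first exact: Dc.
    apply: D_gt0; apply/eqP => k1; apply: neq.
    by rewrite -[RHS]mul1r -k1 divfK// gt_eqF.
have [e e0 ve] := compact_lower_bound cX vc vgt0.
have : e <= nu v.
  rewrite -[e]mulr1 -nu1 -(nuZ _ (@cst_cont 1)); apply: nu_le => //.
  by move=> x; rewrite mulr1 ltW.
by rewrite nuv leNgt e0.
Qed.

End KernelPowers.

Lemma conformal_spine (R : realType) (G : groupType) (mu : G -> R)
  (M : martin_compactification mu) (beta : R) (xi : martin_boundary M) :
  random_walk mu -> transient mu -> spine xi ->
  conformal beta (fun q : martin_boundary M -> R => q xi).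
Proof.
move=> walk trans sxi; split=> //.
by move=> g q _; rewrite (spine_fixed walk trans _ sxi) sxi powR1 mulr1.
Qed.

Unset Implicit Arguments.

Theorem corollary5p9 (R : realType) (G : groupType) (mu : G -> R)
  (mu_walk : random_walk mu) (mu_transient : transient mu)
  (S : seq G) (S_sym : forall s, s \in S -> (s^-1)%g \in S)
  (S_gen : semigroup_generates [set` S])
  (d : G -> G -> nat) (d_word : word_metric S d)
  (C : R) (C_gt0 : 0 < C)
  (harnack : forall x y z, green mu x z / green mu y z <= C ^+ d x y)
  (moment : (\esum_(g in [set: G]) (mu g * C ^+ d g 1%g)%:E < +oo)%E)
  (M : martin_compactification mu)
  (alpha : R -> (ell2 R (G * martin_boundary M)%type ->
                 ell2 R (G * martin_boundary M)%type) ->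
                (ell2 R (G * martin_boundary M)%type ->
                 ell2 R (G * martin_boundary M)%type))
  (alpha_flow : martin_flow M alpha) :
  ((exists xi : martin_boundary M, spine xi) ->
     KMS_spectrum (reduced_crossed_product M) alpha = [set: R]) /\
  (~ (exists xi : martin_boundary M, spine xi) ->
     KMS_spectrum (reduced_crossed_product M) alpha = [set 0; 1] \/
     KMS_spectrum (reduced_crossed_product M) alpha = [set 1]).
Proof.
pose A := reduced_crossed_product M.
have KMS1 : KMS_spectrum A alpha 1.
  have [L [L_linear L_ge0 L_pot]] := boundary_average mu_walk mu_transient.
  have [nu nuP] := conformal_functional1 mu_walk mu_transient C_gt0 harnack M
    L_linear L_ge0 L_pot.
  exact: (KMS_of_conformal mu_walk mu_transient C_gt0 harnack alpha_flow nuP).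
split=> [[xi sxi]|noS].
  apply/seteqP; split=> // beta _.
  exact: (KMS_of_conformal mu_walk mu_transient C_gt0 harnack alpha_flow
    (conformal_spine beta mu_walk mu_transient sxi)).
have sub beta : KMS_spectrum A alpha beta -> beta = 0 \/ beta = 1.
  move=> [omega KMS].
  have [nu [nu_linear nu_ge0 nu_kernel]] :=
    functional_of_KMS mu_walk mu_transient C_gt0 harnack alpha_flow KMS.
  exact: (no_spine_exponent mu_walk mu_transient d_word C_gt0 harnack moment
    nu_linear nu_ge0 nu_kernel noS).
(* The preceding steps leave the exponent 0 undecided; this case distinction produces the two
   alternatives. *)
have [KMS0|nKMS0] := pselect (KMS_spectrum A alpha 0).
  left; apply/seteqP; split=> [beta /sub //|beta [->|->]//].
right; apply/seteqP; split=> [beta bE|beta ->//].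
by have [b0|//] := sub _ bE; case: nKMS0; rewrite -b0.
Qed.
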